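(* Let $I\in\mathcal I$, let $H=\mathfrak B(M_I)\#\Bbbk\mathbb D_m$, and let $$\eta=\sum_{(p,q),(i,k)\in I,\ 1\le r,s\le 2}\alpha^{r,s}_{p,q,i,k}\,d^{(p,q)}_r\otimes d^{(i,k)}_s ,\qquad \alpha^{r,s}_{p,q,i,k}\in\Bbbk,$$ be a linear functional on $M_I\otimes M_I$ whose coefficients satisfy, for all $(p,q),(i,k)\in I$: (1) $\alpha^{r,s}_{p,q,i,k}=\alpha^{s,r}_{p,q,i,k}$ for $r,s=1,2$; (2) $\alpha^{1,1}_{p,q,i,k}=\alpha^{2,2}_{p,q,i,k}$; (3) $\alpha^{r,r}_{p,q,i,k}=\delta_{q,m-k}\,\alpha^{r,r}_{p,q,i,k}$ for $r=1,2$; (4) $\alpha^{r,s}_{p,q,i,k}=\delta_{q,k}\,\alpha^{r,s}_{p,q,i,k}$ for $1\le r\ne s\le 2$. Let $\sigma=e^{\tilde\eta}$, which is a multiplicative $2$-cocycle for $H$. Then $H_\sigma\simeq A_I(\lambda,\gamma)$ as Hopf algebras, where $$\lambda_{p,q,i,k}=\alpha^{r,r}_{p,q,i,k}+\alpha^{r,r}_{i,k,p,q},\qquad \gamma_{p,q,i,k}=\alpha^{r,s}_{p,q,i,k}+\alpha^{r,s}_{i,k,p,q}\quad (1\le r\neq s\le 2)$$ for all $(p,q),(i,k)\in I$. In particular, $A_I(\lambda,\gamma)$ is a cocycle deformation of $H$ (i.e. isomorphic to $H_\sigma$ for some multiplicative $2$-cocycle $\sigma$) for every lifting datum $(\lam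bda,\gamma)$.
   Context: $\Bbbk$ is an algebraically closed field of characteristic zero; $m=4t\ge 12$, $n=m/2=2t$, $\omega\in\Bbbk$ is a fixed primitive $m$-th root of unity, and $\mathbb D_m=\langle g,h\mid g^2=1=h^m,\ gh=h^{-1}g\rangle$. Yetter-Drinfeld modules. $J=\{(i,k): 1\le i<n,\ 1\le k<m,\ \omega^{ik}=-1\}$. For $(i,k)\in J$, $M_{(i,k)}$ is the Yetter-Drinfeld module over $\Bbbk\mathbb D_m$ with basis $y_1^{(i,k)},y_2^{(i,k)}$ and $g\cdot y_1^{(i,k)}=y_2^{(i,k)}$, $g\cdot y_2^{(i,k)}=y_1^{(i,k)}$, $h\cdot y_1^{(i,k)}=\omega^k y_1^{(i,k)}$, $h\cdot y_2^{(i,k)}=\omega^{-k}y_2^{(i,k)}$, $\delta(y_1^{(i,k)})=h^i\otimes y_1^{(i,k)}$, $\delta(y_2^{(i,k)})=h^{-i}\otimes y_2^{(i,k)}$. $\mathcal I$ is the set of all finite sequences $I=((i_1,k_1),\dots,(i_r,k_r))$ of elements of $J$ with $\omega^{i_sk_t+i_tk_s}=1$ for all $s,t$; $|I|=r$; $M_I=\bigoplus_{j}M_{(i_j,k_j)}$. By abuse of notation one writes $(p,q)\in I$ for the entries of $I$ (if an entry is repeated, indices run over positions in the sequence). $d_r^{(p,q)}$ are the linear functionals on $M_I$ dual to the basis: $d_r^{(p,q)}(y_s^{(i,k)})=\delta_{r,s}\delta_{p,i}\delta_{q,k}$. Nichols algebra and bosonization. For $V$ a Yetter-Drinfeld module over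 a Hopf algebra $K$, $\mathfrak B(V)=\bigoplus_{n\ge0}\mathfrak B^n(V)$ is its Nichols algebra (the quotient of $T(V)$ by the largest homogeneous two-sided ideal, generated in degrees $\ge2$, that is also a coideal), and $A=\mathfrak B(V)\#K$ is its bosonization (Majid-Radford biproduct), graded by $A_n=\mathfrak B^n(V)\#K$. Lifting of $\eta$ and exponential. For $\eta:V\otimes V\to\Bbbk$ that is $K$-invariant ($\eta(h_{(1)}\cdot x,h_{(2)}\cdot y)=\varepsilon(h)\eta(x,y)$), $\tilde\eta:A\otimes A\to\Bbbk$ is defined by $\tilde\eta(A_a\otimes A_b)=0$ for $(a,b)\ne(1,1)$ and $\tilde\eta(x\#h,y\#h')=\eta(x,h\cdot y)\varepsilon(h')$ for $x,y\in V$, $h,h'\in K$; $e^{\tilde\eta}=\sum_{i\ge0}\tilde\eta^{*i}/i!$ (convolution powers). Conditions (1)-(4) on the coefficients make $\eta$ $\mathbb D_m$-invariant. Cocycle deformation. A multiplicative $2$-cocycle on a Hopf algebra $A$ is a convolution invertible $\sigma:A\otimes A\to\Bbbk$ with $\sigma(b_{(1)},c_{(1)})\sigma(a,b_{(2)}c_{(2)})=\sigma(a_{(1)},b_{(1)})\sigma(a_{(2)}b_{(2)},c)$ and $\sigma(a,1)=\varepsilon(a)=\sigma(1,a)$. $A_\sigma$ is the Hopf algebra equal to $A$ as a coalgebra with product $a\cdot_\sigma b=\sigma(a_{(1)},b_{(1)})a_{(2)}b_{(2)}\sigma^{-1}(a_{(3)},b_{(3)})$. The algebras $A_I(\lambda,\gamma)$.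 A lifting datum is a pair of families $\lambda=(\lambda_{p,q,i,k})$, $\gamma=(\gamma_{p,q,i,k})$ in $\Bbbk$, indexed by $(p,q),(i,k)\in I$, with $\lambda_{p,m-k,i,k}=\lambda_{i,k,p,m-k}$ and $\gamma_{p,k,i,k}=\gamma_{i,k,p,k}$ (set $\gamma=0$ if $|I|=1$). $A_I(\lambda,\gamma)$ is the algebra generated by $g,h,a_1^{(p,q)},a_2^{(p,q)}$, $(p,q)\in I$, with relations $g^2=1=h^m$, $ghg=h^{m-1}$, $ga_1^{(p,q)}=a_2^{(p,q)}g$, $ha_1^{(p,q)}=\omega^q a_1^{(p,q)}h$, $ha_2^{(p,q)}=\omega^{-q}a_2^{(p,q)}h$, $a_1^{(p,q)}a_1^{(i,k)}+a_1^{(i,k)}a_1^{(p,q)}=\delta_{q,m-k}\lambda_{p,q,i,k}(1-h^{p+i})$, $a_1^{(p,q)}a_2^{(i,k)}+a_2^{(i,k)}a_1^{(p,q)}=\delta_{q,k}\gamma_{p,q,i,k}(1-h^{p-i})$. It is a Hopf algebra with $g,h$ group-like, $\Delta(a_1^{(p,q)})=a_1^{(p,q)}\otimes1+h^p\otimes a_1^{(p,q)}$, $\Delta(a_2^{(p,q)})=a_2^{(p,q)}\otimes1+h^{-p}\otimes a_2^{(p,q)}$. *)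

(* Defs.v *)
From HB Require Import structures.
From mathcomp Require Import all_boot all_order all_algebra all_fingroup.
From mathcomp Require Import all_solvable.
From mathcomp Require Import generic_quotient ring_quotient finmap.
From mathcomp Require Import boolp classical_sets fsbigop.
From mathcomp Require Import monalg.

Set Implicit Arguments.
Unset Strict Implicit.
Unset Printing Implicit Defensive.

Import GRing.Theory.
Local Open Scope classical_set_scope.
Local Open Scope ring_scope.
Local Open Scope quotient_scope.

Section Quotient.
Variables (k : fieldType) (W : lmodType k) (S : set W).

Inductive span : W -> Prop :=
| span0 : span 0
| span_lin a x y : S x -> span y -> span (a *: x + y).

Lemma span_sub x : S x -> span x.
Proof. by move=> Sx; rewrite -[x]addr0 -[x]scale1r; apply: span_lin span0. Qed.

Lemma spanD x y : span x -> span y -> span (x + y).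
Proof.
by elim=> [|a u v Su _ IH] sy; rewrite ?add0r // -addrA; apply/span_lin/IH.
Qed.

Lemma spanZ a x : span x -> span (a *: x).
Proof.
elim=> [|b u v Su _ IH]; first by rewrite scaler0; apply: span0.
by rewrite scalerDr scalerA; apply: span_lin.
Qed.

Definition in_span : {pred W} := fun x => `[< span x >].

Lemma in_span_closed : zmod_closed in_span.
Proof.
split=> [|x y /asboolP sx /asboolP sy]; apply/asboolP; first exact: span0.
by apply: spanD => //; rewrite -scaleN1r; apply: spanZ.
Qed.

HB.instance Definition _ := GRing.isZmodClosed.Build W in_span in_span_closed.

Definition vquot : Type := Quotient.quot in_span.

HB.instance Definition _ := GRing.Zmodule.on vquot.

Definition vpi (x : W) : vquot := \pi_(Quotient.quot in_span) x.
Definition vrepr (x : vquot) : W := repr (x : Quotient.quot in_span).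

Lemma vreprK x : vpi (vrepr x) = x. Proof. exact: reprK. Qed.

Lemma vpiP x y : vpi x = vpi y <-> span (x - y).
Proof.
split=> [/eqP|sxy]; first by rewrite -Quotient.idealrBE => /asboolP.
by apply/eqP; rewrite -Quotient.idealrBE; apply/asboolP.
Qed.

Lemma vpiD x y : vpi (x + y) = vpi x + vpi y.
Proof. exact: (raddfD \pi_(Quotient.quot in_span)). Qed.

Definition vscale (a : k) (x : vquot) : vquot := vpi (a *: vrepr x).

Lemma vscale_pi a x : vscale a (vpi x) = vpi (a *: x).
Proof.
apply/vpiP; rewrite -scalerBr; apply: spanZ.
by apply/vpiP; rewrite vreprK.
Qed.

Lemma vscaleA a b x : vscale a (vscale b x) = vscale (a * b) x.
Proof. by rewrite {2}/vscale vscale_pi scalerA. Qed.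

Lemma vscale1 : left_id 1 vscale.
Proof. by move=> x; rewrite /vscale scale1r vreprK. Qed.

Lemma vscaleDr : right_distributive vscale +%R.
Proof.
by move=> a x y; rewrite -[x]vreprK -[y]vreprK -vpiD !vscale_pi scalerDr vpiD.
Qed.

Lemma vscaleDl x : {morph vscale^~ x : a b / a + b}.
Proof. by move=> a b; rewrite -[x]vreprK !vscale_pi scalerDl vpiD. Qed.

HB.instance Definition _ := GRing.Zmodule_isLmodule.Build k vquot
  vscaleA vscale1 vscaleDr vscaleDl.

End Quotient.

(* The linear extension of f, defined on the basis K of {malg k[K]}. *)
Definition malg_lin (k : fieldType) (K : choiceType) (W : lmodType k)
    (f : K -> W) (u : {malg k[K]}) : W :=
  \sum_(w <- msupp u) u@_w *: f w.

Definition bilin (k : fieldType) (A B W : lmodType k) (f : A -> B -> W) :=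
  (forall a x x' y, f (a *: x + x') y = a *: f x y + f x' y) /\
  (forall a x y y', f x (a *: y + y') = a *: f x y + f x y').

Section Tensor.
Variables (k : fieldType) (A B : lmodType k).

Notation free := {malg k[(A * B)%type]}.

Definition tensor_rel : set free :=
  [set u | (exists a x x' y,
              u = << (a *: x + x', y) >> - a *: << (x, y) >> - << (x', y) >>)
        \/ (exists a x y y',
              u = << (x, a *: y + y') >> - a *: << (x, y) >> - << (x, y') >>)].

Definition tensor : lmodType k := vquot tensor_rel.

Definition tens (x : A) (y : B) : tensor := vpi tensor_rel << (x, y) >>.

(* The linear map on the tensor product induced by a bilinear map f; the value
   is computed on a representative and is meaningful only for bilinear f. *)
Definition tlift (W : lmodType k) (f : A -> B -> W) (t : tensor) : W :=
  malg_lin (fun p => f p.1 p.2) (vrepr t).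

Lemma malg_linP (K : choiceType) (W : lmodType k) (f : K -> W) a u v :
  malg_lin f (a *: u + v) = a *: malg_lin f u + malg_lin f v.
Proof.
have ext (S : {fset K}) w : (msupp w `<=` S)%fset ->
    malg_lin f w = \sum_(i <- S) w@_i *: f i.
  move=> sub; rewrite /malg_lin; apply: big_fset_incl => // i iS iw.
  by rewrite mcoeff_outdom // scale0r.
pose S := (msupp u `|` msupp v `|` msupp (a *: u + v))%fset.
rewrite !(ext S); try by apply/fsubsetP => i; rewrite !inE => ->; rewrite ?orbT.
rewrite scaler_sumr -big_split /=; apply: eq_bigr => i _.
by rewrite mcoeffD mcoeffZ scalerDl scalerA.
Qed.

Lemma malg_linU (K : choiceType) (W : lmodType k) (f : K -> W) i :
  malg_lin f << i >> = f i.
Proof.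
by rewrite /malg_lin msuppU oner_eq0 big_seq_fset1 mcoeffUU scale1r.
Qed.

Lemma tliftE (W : lmodType k) (f : A -> B -> W) x y :
  bilin f -> tlift f (tens x y) = f x y.
Proof.
move=> [fl fr]; pose F := malg_lin (fun p : A * B => f p.1 p.2).
have FD u v : F (u + v) = F u + F v.
  by have := malg_linP (fun p : A * B => f p.1 p.2) 1 u v; rewrite !scale1r.
have F0 : F 0 = 0 by rewrite /F /malg_lin msupp0 big_seq_fset0.
have FZ a u : F (a *: u) = a *: F u.
  by rewrite -[a *: u]addr0 /F malg_linP -/F -/(F 0) F0 addr0.
have FN u : F (- u) = - F u by have := FZ (-1) u; rewrite !scaleN1r.
have Frel u : tensor_rel u -> F u = 0.
  case=> [[a [x1 [x' [z ->]]]]|[a [z [x1 [x' ->]]]]];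
    by rewrite !(FD, FN, FZ) /F !malg_linU /= ?fl ?fr addrAC addrK subrr.
have Fspan u : span tensor_rel u -> F u = 0.
  by elim=> [//|a u1 v1 /Frel Fu _ Fv]; rewrite FD FZ Fu Fv scaler0 addr0.
have /vpiP/Fspan : vpi tensor_rel (vrepr (tens x y)) = vpi tensor_rel << (x, y) >>.
  exact: vreprK.
rewrite FD FN => /eqP; rewrite subr_eq0 => /eqP.
by rewrite /tlift -/F => ->; rewrite /F malg_linU.
Qed.

End Tensor.

Notation "x \ox y" := (tens x y) (at level 38, y at next level).

(* Sweedler sums: \tsum_(a, b <- t) F(a, b) is sum F(t_(1), t_(2)) for a tensor
   t = sum t_(1) \ox t_(2), and \ksum is the same for scalar-valued F. *)
Notation "\tsum_ ( a , b <- t ) F" := (tlift (fun a b => F) t)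
  (at level 41, a name, b name, F at level 41).
Notation "\ksum_ ( a , b <- t ) F" :=
  (@tlift _ _ _ (GRing.regular _) (fun a b => F) t)
  (at level 41, a name, b name, F at level 41).

Definition tmap (k : fieldType) (A B A' B' : lmodType k)
    (f : A -> A') (g : B -> B') (t : tensor A B) : tensor A' B' :=
  \tsum_(x, y <- t) f x \ox g y.

Definition tmul (k : fieldType) (A : lmodType k) (mul : A -> A -> A)
    (s t : tensor A A) : tensor A A :=
  \tsum_(a, b <- s) \tsum_(c, d <- t) mul a c \ox mul b d.

(* The structure maps of a Hopf algebra; the axioms are is_hopf. *)
Record hopf (k : fieldType) := Hopf {
  hsort :> lmodType k;
  hmul : hsort -> hsort -> hsort;
  hone : hsort;
  hcomul : hsort -> tensor hsort hsort;
  hcounit : hsort -> k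
}.

Section HopfTheory.
Variables (k : fieldType) (A : hopf k).
Implicit Types (x y : A) (s t : A -> A -> k).

Notation Delta := (@hcomul k A).
Notation eps := (@hcounit k A).

Definition is_algebra :=
  [/\ bilin (@hmul k A), associative (@hmul k A),
      left_id (hone A) (@hmul k A) & right_id (hone A) (@hmul k A)].

Definition is_coalgebra :=
  [/\ linear Delta, linear (eps : A -> k^o),
      forall x, \tsum_(a, b <- Delta x) \tsum_(a1, a2 <- Delta a)
                  a1 \ox (a2 \ox b) =
                \tsum_(a, b <- Delta x) a \ox Delta b,
      forall x, \tsum_(a, b <- Delta x) eps a *: b = x &
      forall x, \tsum_(a, b <- Delta x) eps b *: a = x].

Definition is_bialgebra :=
  [/\ is_algebra, is_coalgebra,
      forall x y, Delta (hmul x y) = tmul (@hmul k A) (Delta x) (Delta y),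
      Delta (hone A) = (hone A) \ox (hone A) &
      (forall x y, eps (hmul x y) = eps x * eps y) /\ eps (hone A) = 1].

Definition is_antipode (S : A -> A) :=
  linear S /\
  forall x, \tsum_(a, b <- Delta x) (hmul (S a) b) = eps x *: (hone A) /\
            \tsum_(a, b <- Delta x) (hmul a (S b)) = eps x *: (hone A).

Definition is_hopf := is_bialgebra /\ exists S, is_antipode S.

(* Linear functionals on A \ox A are represented by bilinear forms on A. *)
Definition is_form (s : A -> A -> k) := bilin (s : A -> A -> k^o).

Definition conv s t : A -> A -> k := fun x y =>
  \ksum_(x1, x2 <- Delta x) \ksum_(y1, y2 <- Delta y) s x1 y1 * t x2 y2.

Definition conv1 : A -> A -> k := fun x y => eps x * eps y.

Definition conv_pow s n : A -> A -> k := iter n (conv s) conv1.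

(* The sum is a finitely supported one, over all natural numbers: it is the
   exponential of s whenever, for each x and y, almost all s^{*n}(x, y) are 0. *)
Definition conv_exp s : A -> A -> k := fun x y =>
  \sum_(n \in [set: nat]) (n`!%:R)^-1 * conv_pow s n x y.

Definition is_conv_inv s t :=
  is_form t /\
  forall x y, conv s t x y = conv1 x y /\ conv t s x y = conv1 x y.

Definition conv_inv s : A -> A -> k := xget conv1 (is_conv_inv s).

Definition cocycle s :=
  [/\ is_hopf, is_form s, exists t, is_conv_inv s t,
      forall a b c,
        \ksum_(b1, b2 <- Delta b) \ksum_(c1, c2 <- Delta c)
          s b1 c1 * s a (hmul b2 c2) =
        \ksum_(a1, a2 <- Delta a) \ksum_(b1, b2 <- Delta b)
          s a1 b1 * s (hmul a2 b2) c &
      forall a, s a (hone A) = eps a /\ s (hone A) a = eps a].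

Definition deform_mul s (a b : A) : A :=
  \tsum_(a1, a' <- Delta a) \tsum_(b1, b' <- Delta b)
  \tsum_(a2, a3 <- Delta a') \tsum_(b2, b3 <- Delta b')
    (s a1 b1 * conv_inv s a3 b3) *: (hmul a2 b2).

Definition deform s : hopf k :=
  @Hopf k A (deform_mul s) (hone A) Delta eps.

End HopfTheory.

Definition hopf_iso (k : fieldType) (A B : hopf k) :=
  [/\ is_hopf A, is_hopf B &
      exists f : A -> B,
        [/\ linear f, bijective f,
            (forall x y, f (hmul x y) = hmul (f x) (f y)) /\
              f (hone A) = hone B,
            forall x, hcomul (f x) = tmap f f (hcomul x) &
            forall x, hcounit (f x) = hcounit x]].

Definition cocycle_deformation (k : fieldType) (A B : hopf k) :=
  exists s : A -> A -> k, cocycle s /\ hopf_iso (deform s) B.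

(* A Yetter-Drinfeld module over the group algebra of the finite group gT, of
   finite dimension, in a basis ydX that is homogeneous for the coaction:
   delta(x) = (yddeg x) \ox x. *)
Record ydmod (k : fieldType) (gT : finGroupType) := YDmod {
  ydX : finType;
  yddeg : ydX -> gT;
  ydact : gT -> ydX -> {ffun ydX -> k^o}
}.

(* The structure maps of a Hopf algebra in the category of Yetter-Drinfeld
   modules over the group algebra of gT; bcomp g is the projection on the
   homogeneous component of degree g, that is, x |-> sum_g g \ox bcomp g x is
   the coaction. *)
Record bhopf (k : fieldType) (gT : finGroupType) := BHopf {
  bsort :> lmodType k;
  bmul : bsort -> bsort -> bsort;
  bone : bsort;
  bcomul : bsort -> tensor bsort bsort;
  bcounit : bsort -> k;
  bact : gT -> bsort -> bsort;
  bcomp : gT -> bsort -> bsort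
}.

Section Nichols.
Variables (k : fieldType) (gT : finGroupType) (V : ydmod k gT).

Notation X := (ydX V).
Notation vect := {ffun X -> k^o}.

Definition vbase (x : X) : vect := [ffun y => (y == x)%:R].

Definition vact (g : gT) (v : vect) : vect := \sum_x v x *: ydact g x.

Definition is_ydmod :=
  [/\ forall v, vact 1 v = v,
      forall g h v, vact (g * h)%g v = vact g (vact h v) &
      forall (g : gT) (x y : X), ydact g x y != 0 ->
        yddeg y = (g * yddeg x * g^-1)%g].

(* The tensor algebra T(V), as the free algebra on the basis X of V. *)
Notation TV := {malg k[{fmonom X}]}.

Definition tvar (x : X) : TV := << fmu x >>.
Definition tvect (v : vect) : TV := \sum_x v x *: tvar x.

Definition homog (n : nat) (u : TV) := forall w, w \in msupp u -> fdeg w = n.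

Definition tact (g : gT) : TV -> TV :=
  malg_lin (fun w : {fmonom X} => \prod_(x <- w) tvect (ydact g x)).

Definition tdeg (w : {fmonom X}) : gT := (\prod_(x <- w) yddeg x)%g.

Definition tcomp (g : gT) : TV -> TV :=
  malg_lin (fun w : {fmonom X} => if tdeg w == g then << w >> else 0).

(* (a \ox b)(c \ox d) = a (b_(-1) . c) \ox b_(0) d *)
Definition braided_mul (s t : tensor TV TV) : tensor TV TV :=
  \tsum_(a, b <- s) \tsum_(c, d <- t)
    \sum_(g : gT) (a * tact g c) \ox (tcomp g b * d).

Definition tcomul : TV -> tensor TV TV :=
  malg_lin (fun w : {fmonom X} =>
    foldr (fun x t => braided_mul (tvar x \ox 1 + 1 \ox tvar x) t)
          ((1 : TV) \ox (1 : TV)) w).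

Definition tcounit (u : TV) : k := u@_(fmone X).

Definition ideal_gen (E : set TV) : set TV :=
  span [set u | exists a e b, E e /\ u = a * e * b].

Definition is_coideal (S : set TV) :=
  forall u, S u -> tcounit u = 0 /\
    span [set t | exists a b, (S a \/ S b) /\ t = a \ox b] (tcomul u).

Definition nichols_candidate (S : set TV) :=
  (exists E : set TV,
     (forall e, E e -> exists2 n, (2 <= n)%N & homog n e) /\
     S = ideal_gen E) /\
  is_coideal S.

(* The sum of all candidates, which is the largest of them, is the span of
   their union. *)
Definition nichols_union : set TV :=
  [set u | exists2 S, nichols_candidate S & S u].

Notation BV := (vquot nichols_union).
Notation pi := (vpi nichols_union).

(* The structure maps are induced from those of T(V), through representatives;
   they do not depend on them, the ideal being a homogeneous coideal that is
   stable under the action and the coaction. *)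
Definition nichols : bhopf k gT := @BHopf k gT BV
  (fun x y => pi (vrepr x * vrepr y))
  (pi 1)
  (fun x => tmap pi pi (tcomul (vrepr x)))
  (fun x => tcounit (vrepr x))
  (fun g x => pi (tact g (vrepr x)))
  (fun g x => pi (tcomp g (vrepr x))).

(* The projection of B(V) on its component of degree 1, identified with V. *)
Definition nichols1 (x : nichols) : vect := [ffun i => (vrepr x)@_(fmu i)].

End Nichols.

(* The bosonization B # k[gT]; the vector space B \ox k[gT] is represented by
   the functions from gT to B, x # g being the function smash x g. *)
Section Bosonization.
Variables (k : fieldType) (gT : finGroupType) (B : bhopf k gT).

Notation BG := {ffun gT -> B}.

Definition smash (x : B) (g : gT) : BG := [ffun h => if h == g then x else 0].

Definition boson_mul (u v : BG) : BG :=
  \sum_g \sum_h smash (bmul (u g) (bact g (v h))) (g * h)%g.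

(* Delta(x # g) =
     sum (x_(1) # (x_(2))_(-1) g) \ox ((x_(2))_(0) # g) *)
Definition boson_comul (u : BG) : tensor BG BG :=
  \sum_g \tsum_(x1, x2 <- bcomul (u g))
    \sum_(h : gT) smash x1 (h * g)%g \ox smash (bcomp h x2) g.

Definition bosonization : hopf k := @Hopf k BG
  boson_mul (smash (bone B) 1%g) boson_comul
  (fun u => \sum_g bcounit (u g)).

End Bosonization.

(* The extension of a form eta on V to B(V) # k[gT]: it only sees the component
   of bidegree (1, 1), where (x # g, y # h) |-> eta (x, g . y). *)
Definition lift_form (k : fieldType) (gT : finGroupType) (V : ydmod k gT)
    (eta : {ffun ydX V -> k^o} -> {ffun ydX V -> k^o} -> k)
    (u v : bosonization (nichols V)) : k :=
  let u' : {ffun gT -> nichols V} := u in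
  let v' : {ffun gT -> nichols V} := v in
  \sum_g \sum_h eta (nichols1 (u' g)) (vact g (nichols1 (v' h))).

Section Presented.
Variables (k : fieldType) (gen : choiceType).
Notation F := {malg k[{fmonom gen}]}.
Variables (rel : F -> F -> Prop).
Variables (Delta : gen -> tensor F F) (eps : gen -> k).

Definition relators : set F :=
  [set u | exists a x y b, rel x y /\ u = a * (x - y) * b].

Definition free_comul : F -> tensor F F :=
  malg_lin (fun w : {fmonom gen} =>
    foldr (fun x t => tmul *%R (Delta x) t) ((1 : F) \ox (1 : F)) w).

Definition free_counit : F -> k :=
  @malg_lin k _ k^o (fun w : {fmonom gen} => \prod_(x <- w) eps x).

Notation pi := (vpi relators).

Definition presented : hopf k := @Hopf k (vquot relators)
  (fun x y => pi (vrepr x * vrepr y))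
  (pi 1)
  (fun x => tmap pi pi (free_comul (vrepr x)))
  (fun x => free_counit (vrepr x)).

End Presented.

(* The pair (a, b) stands for h^a g^b. *)
Definition dihedral (m : nat) : Type := ('Z_m * bool)%type.

Section Dihedral.
Variable m : nat.

HB.instance Definition _ := Finite.on (dihedral m).

Definition dih_mul (u v : dihedral m) : dihedral m :=
  (u.1 + (if u.2 then - v.1 else v.1), u.2 (+) v.2).
Definition dih_one : dihedral m := (0, false).
Definition dih_inv (u : dihedral m) : dihedral m :=
  ((if u.2 then u.1 else - u.1), u.2).

Lemma dih_mulA : associative dih_mul.
Proof.
move=> [a x] [b y] [c z]; rewrite /dih_mul /= addbA; congr (_, _).
by case: x y => [] [] //=; rewrite ?opprD ?opprK addrA.
Qed.

Lemma dih_mul1 : left_id dih_one dih_mul.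
Proof. by case=> a b; rewrite /dih_mul /= add0r. Qed.

Lemma dih_mulV : left_inverse dih_one dih_inv dih_mul.
Proof. by case=> a []; rewrite /dih_mul /dih_inv /= ?subrr ?addNr. Qed.

HB.instance Definition _ :=
  Finite_isGroup.Build (dihedral m) dih_mulA dih_mul1 dih_mulV.

Definition dih_g : dihedral m := (0, true).
Definition dih_h : dihedral m := (1, false).

Lemma dih_hX n : (dih_h ^+ n)%g = (n%:R, false).
Proof.
elim: n => [|n IH]; first by rewrite expg0.
by rewrite expgS IH; congr (_, _); rewrite /= -natr1 addrC.
Qed.

Lemma dihedral_isog : (1 < m)%N -> [set: dihedral m]%G \isog 'D_(m.*2).
Proof.
move=> m1; have eD (u : dihedral m) : u = (dih_h ^+ u.1 * dih_g ^+ u.2)%g.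
  case: u => a b; rewrite dih_hX Zp_nat; have -> : inZp a = a by apply: valZpK.
  by case: b; rewrite /= ?expg1 ?expg0 ?mulg1 //; congr (_, _); rewrite /= addr0.
rewrite isogEcard; apply/andP; split; last first.
  rewrite card_dihedral //=.
  by rewrite cardsT card_prod card_bool card_ord Zp_cast // muln2.
rewrite (Grp_dihedral m1); apply/existsP.
exists (dih_h, dih_g); rewrite /= !xpair_eqE; apply/and4P; split.
- apply/eqP/setP=> u; rewrite !inE (eD u).
  by rewrite groupM // groupX // mem_gen // inE cycle_id ?orbT.
- by rewrite dih_hX pchar_Zp.
- by rewrite /= oppr0 addr0 !eqxx.
- have -> : (dih_g^-1)%g = dih_g by [].
  by rewrite /= !addr0 add0r !eqxx.
Qed.

End Dihedral.

(* Families indexed by the entries (p, q) of I are indexed by the positions s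
   of the sequence. Indices in {1, 2} are booleans: false is 1 and true is 2. *)

Section Family.
Variables (k : fieldType) (m : nat) (omega : k) (r : nat).
Variable (I : r.-tuple (nat * nat)).

Definition fst_at (s : 'I_r) : nat := (tnth I s).1.
Definition snd_at (s : 'I_r) : nat := (tnth I s).2.

Notation p := fst_at.
Notation q := snd_at.

Definition in_J (x : nat * nat) : Prop :=
  [/\ (1 <= x.1 < m./2)%N, (1 <= x.2 < m)%N & omega ^+ (x.1 * x.2) = -1].

Definition admissible : Prop :=
  (forall s, in_J (tnth I s)) /\
  (forall s t, omega ^+ (p s * q t + p t * q s) = 1).

Definition MI_act (u : dihedral m) (x : 'I_r * bool) :
    {ffun 'I_r * bool -> k^o} :=
  let y := (x.1, u.2 (+) x.2) in
  [ffun z => if z == y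
             then (if y.2 then omega^-1 else omega) ^+ (q x.1 * u.1) else 0].

Definition MI : ydmod k (dihedral m) := @YDmod k (dihedral m)
  ('I_r * bool)%type
  (fun x => if x.2 then (dih_h m ^- p x.1)%g else (dih_h m ^+ p x.1)%g)
  MI_act.

Lemma MI_act_g s a : MI_act (dih_g m) (s, a) = vbase (V := MI) (s, ~~ a).
Proof. by apply/ffunP => z; rewrite !ffunE /= muln0 expr0; case: eqP. Qed.

Lemma MI_act_h s a : (1 < m)%N ->
  MI_act (dih_h m) (s, a) =
    (if a then omega ^- q s else omega ^+ q s) *: vbase (V := MI) (s, a).
Proof.
move=> m1; apply/ffunP => z; rewrite !ffunE /= Zp_cast // modn_small // muln1.
by case: eqP => _; rewrite /GRing.scale /= ?mulr1 ?mulr0 //; case: a; rewrite ?exprVn.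
Qed.

Lemma MI_ydmod : (1 < m)%N -> omega ^+ m = 1 -> is_ydmod MI.
Proof.
move=> m1 om; pose e (c : bool) := if c then omega^-1 else omega.
have eV c : e (~~ c) = (e c)^-1 by case: c; rewrite /= ?invrK.
have em c : e c ^+ m = 1 by case: c; rewrite //= exprVn om invr1.
have e0 c : e c != 0.
  by apply/eqP => ec; have/eqP := em c; rewrite ec expr0n eqn0Ngt (ltnW m1) eq_sym oner_eq0.
have eD c (a b : 'Z_m) n : e c ^+ (n * (a + b)%R) = e c ^+ (n * a) * e c ^+ (n * b).
  rewrite -exprD -mulnDr ![(n * _)%N]mulnC !exprM; congr (_ ^+ n).
  rewrite -[RHS](expr_mod _ (em c)) /=; congr (_ ^+ (_ %% _)); exact: Zp_cast.
have eN c (a : 'Z_m) n : e (~~ c) ^+ (n * a) = e c ^+ (n * (- a)%R).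
  have /eqP := eD c a (- a) n; rewrite subrr muln0 expr0 eq_sym eV exprVn => /eqP h.
  by rewrite -[LHS]mulr1 -h mulrA mulVf ?mul1r // expf_neq0.
have actE (u : dihedral m) v s c :
    vact (V := MI) u v (s, c) = v (s, u.2 (+) c) * e c ^+ (q s * u.1).
  rewrite /vact sum_ffunE (bigD1 (s, u.2 (+) c)) //= big1 => [|[t d] ne].
    by rewrite addr0 !ffunE /= addKb eqxx.
  rewrite !ffunE /= xpair_eqE; case: eqP => [st|_] /=; last exact: mulr0.
  case: eqP => [cE|_]; last exact: mulr0.
  by move: ne; rewrite cE addKb st eqxx.
split=> [v|u w v|u [s a] [t b]].
- by apply/ffunP => -[s c]; rewrite actE /= muln0 expr0 mulr1.
- apply/ffunP => -[s c]; rewrite !actE /= eD -mulrA addbA [w.2 (+) u.2]addbC.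
  congr (_ * _); rewrite mulrC; congr (_ * _).
  by case: (u.2) => //=; rewrite eN.
- rewrite ffunE /=; case: ((t, b) =P _) => [[-> ->] _|_]; last by rewrite eqxx.
  have E (n : nat) (d : bool) :
      (if d then (dih_h m ^- n)%g else (dih_h m ^+ n)%g) =
      ((if d then - n%:R else n%:R), false) :> dihedral m.
    by case: d; rewrite dih_hX.
  rewrite !E; case: u => x y; apply/eqP; rewrite xpair_eqE /=.
  by apply/andP; split; case: y; case: a;
    rewrite //= ?opprK ?addr0 ?addrK ?[x + _]addrC ?addrK ?subrK ?addrNK.
Qed.

Definition MI_dual (s : 'I_r) (a : bool) (v : {ffun ydX MI -> k^o}) : k :=
  v (s, a).

Definition MI_form (alpha : 'I_r -> 'I_r -> bool -> bool -> k)
    (v w : {ffun ydX MI -> k^o}) : k :=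
  \sum_s \sum_t \sum_(a : bool) \sum_(b : bool)
    alpha s t a b * (MI_dual s a v * MI_dual t b w).

Definition coef_cond (alpha : 'I_r -> 'I_r -> bool -> bool -> k) : Prop :=
  forall s t,
    [/\ forall a b, alpha s t a b = alpha s t b a,
        alpha s t false false = alpha s t true true,
        forall a, alpha s t a a = (q s == m - q t)%N%:R * alpha s t a a &
        forall a b, a != b -> alpha s t a b = (q s == q t)%:R * alpha s t a b].

Definition lifting_datum (lam gam : 'I_r -> 'I_r -> k) : Prop :=
  [/\ forall s t, q s = (m - q t)%N -> lam s t = lam t s,
      forall s t, q s = q t -> gam s t = gam t s &
      r = 1%N -> forall s t, gam s t = 0].

(* inl true is g, inl false is h, and inr (s, a) is a_1 or a_2 at position s. *)
Definition AI_gen : Type := (bool + 'I_r * bool)%type.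
HB.instance Definition _ := Choice.on AI_gen.

Notation F := {malg k[{fmonom AI_gen}]}.

Definition gen_g : F := << fmu (inl true : AI_gen) >>.
Definition gen_h : F := << fmu (inl false : AI_gen) >>.
Definition gen_a (b : bool) (s : 'I_r) : F := << fmu (inr (s, b) : AI_gen) >>.

Notation a1 := (gen_a false).
Notation a2 := (gen_a true).

(* Negative powers of h are written with h^(-j) = h^(m - j), 0 <= j <= m. *)
Inductive AI_rel (lam gam : 'I_r -> 'I_r -> k) : F -> F -> Prop :=
| AI_gg : AI_rel lam gam (gen_g ^+ 2) 1
| AI_hm : AI_rel lam gam (gen_h ^+ m) 1
| AI_ghg : AI_rel lam gam (gen_g * gen_h * gen_g) (gen_h ^+ (m - 1))
| AI_ga s : AI_rel lam gam (gen_g * a1 s) (a2 s * gen_g)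
| AI_ha1 s : AI_rel lam gam (gen_h * a1 s) (omega ^+ q s *: (a1 s * gen_h))
| AI_ha2 s : AI_rel lam gam (gen_h * a2 s) (omega ^- q s *: (a2 s * gen_h))
| AI_a1a1 s t : AI_rel lam gam (a1 s * a1 t + a1 t * a1 s)
    (((q s == m - q t)%N%:R * lam s t) *: (1 - gen_h ^+ (p s + p t)))
| AI_a1a2 s t : AI_rel lam gam (a1 s * a2 t + a2 t * a1 s)
    (((q s == q t)%:R * gam s t) *: (1 - gen_h ^+ (p s + (m - p t)))).

Definition AI_comul (x : AI_gen) : tensor F F :=
  match x with
  | inl true => gen_g \ox gen_g
  | inl false => gen_h \ox gen_h
  | inr (s, false) => a1 s \ox 1 + (gen_h ^+ p s) \ox a1 s
  | inr (s, true) => a2 s \ox 1 + (gen_h ^+ (m - p s)) \ox a2 s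
  end.

Definition AI_counit (x : AI_gen) : k := if x is inl _ then 1 else 0.

Definition AI (lam gam : 'I_r -> 'I_r -> k) : hopf k :=
  presented (AI_rel lam gam) AI_comul AI_counit.

End Family.

(* Main.v *)
Require Import Defs.
From HB Require Import structures.
From mathcomp Require Import all_boot all_order all_algebra all_fingroup.
From mathcomp Require Import generic_quotient ring_quotient finmap.
From mathcomp Require Import boolp classical_sets fsbigop cardinality.
From mathcomp Require Import monalg ring zify.

Set Implicit Arguments.
Unset Strict Implicit.
Unset Printing Implicit Defensive.

Import GRing.Theory.
Local Open Scope ring_scope.

(** The idea of the proof. Write V for M_I and H for its bosonization.

   Admissibility forces omega^(p q') = -1 for all entries (p, q), (p', q') of the
   sequence ([expr_mixed]): the degree of every basis vector acts on V by -1, and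
   the braiding of V is minus the flip. So B(V) is an exterior algebra. Indeed the
   anticommutators of generators are primitive, and generate a coideal; and in
   characteristic zero Euler's formula for the skew derivations shows that they
   generate every ideal that is a candidate ([cand_tproj], [nichols_unionE]).
   Hence H has the presentation of A_I(0, 0) ([bos_iso]).

   H and the algebras A_I(lambda, gamma) are treated through one interface,
   [dalg]: they are generated by group-like elements el u and skew-primitive
   elements ax x, the anticommutator of ax x and ax y being a scalar Lam x y times
   1 - deg x deg y, and they carry a map D onto V that behaves as the projection
   on degree 1.

   Let eta be an invariant form, and let Il_v a = eta(v, D a_1) a_2 and
   Ir_v a = eta(v, D a_2) a_1 be the two contractions of a with v. They are skew
   derivations, and the operators Z_x a = ax x a + Il_x a - deg x Ir_x a satisfy
   the relations of ax x with eta(x, y) + eta(y, x) added to Lam x y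
   ([Zop_uniform]); moreover Z_x has the coproduct of a skew-primitive element
   ([sw_Zop]). Sending generators to these operators thus defines an isomorphism
   of coalgebras from the algebra with the new scalars onto the old one
   ([zop_iso]); its inverse comes from -eta.

   It remains to identify Z_x with left multiplication by a generator in the
   cocycle deformation. The exponential of the lifted form has a closed form: it
   maps the word x_1 ... x_n u and b to the counit of Il_(x_1) ... Il_(x_n) (u b)
   ([conv_pow_word], [exp_is_sigma]), and its convolution inverse is the
   exponential for -eta ([conv_sigma]). The product twisted on the left only, by
   sigma(a_1, b_1) a_2 b_2, commutes in its first argument with the operators
   ax x + Il_x ([star_X]). These generate H from 1, so that this product is
   associative ([starA]); applying the counit gives the cocycle identity
   ([sigma_cocycle]). Twisting on the right by the inverse adds the contraction
   Ir_x, and the deformed product commutes in its first argument with Z_x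
   ([deform_X]): the isomorphism of coalgebras is one of Hopf algebras
   ([deform_iso]). Finally, every lifting datum is the symmetrization of half of
   itself ([half_coef]). *)

(** * Linear maps, tensors and Sweedler sums *)

Definition lin (k : fieldType) (A B : lmodType k) (f : A -> B) : Prop :=
  forall a x y, f (a *: x + y) = a *: f x + f y.

(** The shape of the predicates that induction on a spanning set can prove. *)
Definition lin_closed (k : fieldType) (A : lmodType k) (P : A -> Prop) :=
  P 0 /\ forall a x y, P x -> P y -> P (a *: x + y).

Section Linear.
Variable k : fieldType.
Implicit Types A B C D W : lmodType k.

Lemma linD A B (f : A -> B) : lin f -> forall x y, f (x + y) = f x + f y.
Proof. by move=> lf x y; have := lf 1 x y; rewrite !scale1r. Qed.

Lemma lin0 A B (f : A -> B) : lin f -> f 0 = 0.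
Proof.
by move=> lf; apply/(@addrI _ (f 0)); rewrite -linD // !addr0.
Qed.

Lemma linZ A B (f : A -> B) : lin f -> forall a x, f (a *: x) = a *: f x.
Proof. by move=> lf a x; rewrite -[a *: x]addr0 lf lin0 // addr0. Qed.

Lemma linN A B (f : A -> B) : lin f -> forall x, f (- x) = - f x.
Proof. by move=> lf x; rewrite -!scaleN1r linZ. Qed.

Lemma linB A B (f : A -> B) : lin f -> forall x y, f (x - y) = f x - f y.
Proof. by move=> lf x y; rewrite linD // linN. Qed.

Lemma lin_big A B (f : A -> B) I (r : seq I) (P : pred I) (F : I -> A) :
  lin f -> f (\sum_(i <- r | P i) F i) = \sum_(i <- r | P i) f (F i).
Proof. by move=> lf; apply: (big_morph f (linD lf) (lin0 lf)). Qed.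

Lemma lin_id A : lin (fun x : A => x).
Proof. by []. Qed.

Lemma lin_comp A B C (f : A -> B) (g : B -> C) :
  lin f -> lin g -> lin (fun x => g (f x)).
Proof. by move=> lf lg a x y; rewrite lf lg. Qed.

Lemma lin_add A B (f g : A -> B) :
  lin f -> lin g -> lin (fun x => f x + g x).
Proof. by move=> lf lg a x y; rewrite lf lg scalerDr addrACA. Qed.

Lemma lin_opp A B (f : A -> B) : lin f -> lin (fun x => - f x).
Proof. by move=> lf a x y; rewrite lf opprD scalerN. Qed.

Lemma lin_zero A B : lin (fun _ : A => 0 : B).
Proof. by move=> a x y; rewrite scaler0 addr0. Qed.

Lemma lin_sum A B I (r : seq I) (P : pred I) (F : I -> A -> B) :
  (forall i, lin (F i)) -> lin (fun x => \sum_(i <- r | P i) F i x).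
Proof.
move=> lF a x y; rewrite scaler_sumr -big_split; apply: eq_bigr => i _.
exact: lF.
Qed.

Lemma lin_scale A B (c : k) (f : A -> B) : lin f -> lin (fun x => c *: f x).
Proof. by move=> lf a x y; rewrite lf scalerDr !scalerA mulrC. Qed.

Lemma lin_scalel A B (f : A -> k) (v : B) :
  lin (f : A -> k^o) -> lin (fun x => f x *: v).
Proof. by move=> lf a x y; rewrite lf scalerDl scalerA. Qed.

Lemma lin_mull A (f : A -> k) (c : k) :
  lin (f : A -> k^o) -> lin (fun x => f x * c : k^o).
Proof. by move=> lf a x y; rewrite lf mulrDl /GRing.scale /= mulrA. Qed.

Lemma lin_mulr A (f : A -> k) (c : k) :
  lin (f : A -> k^o) -> lin (fun x => c * f x : k^o).
Proof. by move=> lf a x y; rewrite lf mulrDr /GRing.scale /= mulrCA. Qed.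

Lemma lin_if A B (b : bool) (f g : A -> B) :
  lin f -> lin g -> lin (fun x => if b then f x else g x).
Proof. by case: b. Qed.

Lemma lin_malg (K : choiceType) W (f : K -> W) :
  lin (malg_lin f : {malg k[K]} -> W).
Proof. by move=> a x y; rewrite malg_linP. Qed.

Lemma bilinI A B W (f : A -> B -> W) :
  (forall y, lin (fun x => f x y)) -> (forall x, lin (f x)) -> bilin f.
Proof. by move=> fl fr; split=> *; [apply: fl | apply: fr]. Qed.

Lemma bilin_l A B W (f : A -> B -> W) y : bilin f -> lin (fun x => f x y).
Proof. by case=> fl _ a x x'; apply: fl. Qed.

Lemma bilin_r A B W (f : A -> B -> W) x : bilin f -> lin (f x).
Proof. by case=> _ fr a y y'; apply: fr. Qed.

Section Bilinear.
Variables (A B W : lmodType k) (f : A -> B -> W).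
Hypothesis bf : bilin f.

Lemma bilinDl x x' y : f (x + x') y = f x y + f x' y.
Proof. exact: linD (bilin_l y bf) x x'. Qed.
Lemma bilinDr x y y' : f x (y + y') = f x y + f x y'.
Proof. exact: linD (bilin_r x bf) y y'. Qed.
Lemma bilinZl a x y : f (a *: x) y = a *: f x y.
Proof. exact: linZ (bilin_l y bf) a x. Qed.
Lemma bilinZr a x y : f x (a *: y) = a *: f x y.
Proof. exact: linZ (bilin_r x bf) a y. Qed.
Lemma bilinNl x y : f (- x) y = - f x y.
Proof. exact: linN (bilin_l y bf) x. Qed.
Lemma bilinNr x y : f x (- y) = - f x y.
Proof. exact: linN (bilin_r x bf) y. Qed.
Lemma bilinBl x x' y : f (x - x') y = f x y - f x' y.
Proof. exact: linB (bilin_l y bf) x x'. Qed.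
Lemma bilinBr x y y' : f x (y - y') = f x y - f x y'.
Proof. exact: linB (bilin_r x bf) y y'. Qed.
Lemma bilin0l y : f 0 y = 0.
Proof. exact: lin0 (bilin_l y bf). Qed.
Lemma bilin0r x : f x 0 = 0.
Proof. exact: lin0 (bilin_r x bf). Qed.
End Bilinear.

Lemma malg_ind (K : choiceType) (P : {malg k[K]} -> Prop) :
  P 0 -> (forall a u v, P u -> P v -> P (a *: u + v)) ->
  (forall w, P << w >>) -> forall u, P u.
Proof.
move=> P0 PD PU u; rewrite [u]monalgE.
elim: (enum_fset (msupp u)) => [|w s IH]; first by rewrite big_nil.
rewrite big_cons (_ : << _ *g w >> = u@_w *: << w >>); first exact: PD.
by apply/malgP => v; rewrite mcoeffZ !mcoeffU; case: eqP; rewrite ?mulr1 ?mulr0.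
Qed.

Lemma malg_lin_eq (K : choiceType) W (f g : {malg k[K]} -> W) :
  lin f -> lin g -> (forall w, f << w >> = g << w >>) -> f =1 g.
Proof.
move=> lf lg fg; apply: malg_ind => [|a u v IHu IHv|//].
  by rewrite !lin0.
by rewrite lf lg IHu IHv.
Qed.

Lemma vpi_lin W (S : set W) : lin (vpi S).
Proof. by move=> a x y; rewrite vpiD -vscale_pi. Qed.

Lemma tens_linl A B (y : B) : lin (fun x : A => x \ox y).
Proof.
move=> a x x'; apply/eqP; rewrite -subr_eq0 /tens -(linZ (@vpi_lin _ _)).
rewrite -vpiD -(linB (@vpi_lin _ _)); apply/eqP.
rewrite -(lin0 (@vpi_lin _ _)); apply/vpiP.
rewrite subr0; apply: span_sub; left; exists a, x, x', y.
by rewrite opprD addrA.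
Qed.

Lemma tens_linr A B (x : A) : lin (fun y : B => x \ox y).
Proof.
move=> a y y'; apply/eqP; rewrite -subr_eq0 /tens -(linZ (@vpi_lin _ _)).
rewrite -vpiD -(linB (@vpi_lin _ _)); apply/eqP.
rewrite -(lin0 (@vpi_lin _ _)); apply/vpiP.
rewrite subr0; apply: span_sub; right; exists a, x, y, y'.
by rewrite opprD addrA.
Qed.

Lemma tens_bilin A B : bilin (@tens k A B).
Proof. by apply: bilinI => ?; [apply: tens_linl | apply: tens_linr]. Qed.

Lemma tens_ind A B (P : tensor A B -> Prop) :
  P 0 -> (forall a u v, P u -> P v -> P (a *: u + v)) ->
  (forall x y, P (x \ox y)) -> forall t, P t.
Proof.
move=> P0 PD PT t; rewrite -[t]vreprK.
elim/malg_ind: (vrepr t) => [|a u v Pu Pv|[x y]].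
- by rewrite (lin0 (@vpi_lin _ _)).
- by rewrite vpi_lin; apply: PD.
- exact: PT.
Qed.

Lemma tens_eq A B W (f g : tensor A B -> W) :
  lin f -> lin g -> (forall x y, f (x \ox y) = g (x \ox y)) -> f =1 g.
Proof.
move=> lf lg fg; apply: tens_ind => [|a u v IHu IHv|//].
  by rewrite !lin0.
by rewrite lf lg IHu IHv.
Qed.

(** Functions on a quotient are computed on chosen representatives; this is how
   their values on classes become available. *)
Lemma vquot_lin W W' (S : set W) (f : W -> W') u :
  lin f -> (forall v, S v -> f v = 0) -> f (vrepr (vpi S u)) = f u.
Proof.
move=> lf fS; apply/eqP; rewrite -subr_eq0 -linB //.
have /vpiP : vpi S (vrepr (vpi S u)) = vpi S u by rewrite vreprK.
elim=> [|a v w /fS fv _ /eqP fw]; first by rewrite lin0.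
by rewrite lf fv fw scaler0 addr0.
Qed.

Lemma vquot_lift_lin W W' (S : set W) (f : W -> W') :
  lin f -> (forall v, S v -> f v = 0) ->
  lin (fun x : vquot S => f (vrepr x)).
Proof.
move=> lf fS a x y; rewrite -[x]vreprK -[y]vreprK -vpi_lin.
by rewrite !vquot_lin.
Qed.

Lemma tlift_lin A B W (f : A -> B -> W) : bilin f -> lin (tlift f).
Proof.
move=> bf; have [fl fr] := bf.
have L := @lin_malg (A * B)%type W (fun p => f p.1 p.2).
apply: vquot_lift_lin => //.
by move=> v [] [a [x [x' [y ->]]]];
  rewrite (linB L) (linB L) (linZ L) !malg_linU /= (fl, fr) addrAC addrK subrr.
Qed.

Lemma lin_tlift A B C W (F : C -> A -> B -> W) t :
  (forall a b, lin (fun x => F x a b)) -> lin (fun x => tlift (F x) t).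
Proof.
move=> lF; apply: lin_sum => w; apply: lin_scale; exact: lF.
Qed.

Lemma tlift_comp A B W W' (g : W -> W') (f : A -> B -> W) t :
  lin g -> g (tlift f t) = tlift (fun a b => g (f a b)) t.
Proof.
by move=> lg; rewrite lin_big //; apply: eq_bigr => w _; rewrite linZ.
Qed.

Lemma eq_tlift A B W (f g : A -> B -> W) t :
  (forall a b, f a b = g a b) -> tlift f t = tlift g t.
Proof. by move=> fg; apply: eq_bigr => w _; rewrite fg. Qed.

Lemma tlift_exch A B C D W (F : A -> B -> C -> D -> W) s t :
  \tsum_(a, b <- s) \tsum_(c, d <- t) F a b c d =
  \tsum_(c, d <- t) \tsum_(a, b <- s) F a b c d.
Proof.
rewrite /tlift /malg_lin; under eq_bigr do rewrite scaler_sumr.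
rewrite exchange_big; apply: eq_bigr => w _; rewrite scaler_sumr.
by apply: eq_bigr => v _; rewrite !scalerA mulrC.
Qed.

Lemma tliftDf A B W (f g : A -> B -> W) t :
  \tsum_(a, b <- t) (f a b + g a b) =
  \tsum_(a, b <- t) f a b + \tsum_(a, b <- t) g a b.
Proof.
by rewrite /tlift /malg_lin -big_split; apply: eq_bigr => w _; rewrite scalerDr.
Qed.

Lemma tliftNf A B W (f : A -> B -> W) t :
  \tsum_(a, b <- t) (- f a b) = - \tsum_(a, b <- t) f a b.
Proof. by rewrite [RHS](@tlift_comp _ _ _ _ -%R) // => a x y; rewrite opprD scalerN. Qed.

Lemma tliftZf A B W (f : A -> B -> W) c t :
  \tsum_(a, b <- t) (c *: f a b) = c *: \tsum_(a, b <- t) f a b.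
Proof.
by rewrite [RHS](@tlift_comp _ _ _ _ ( *:%R c)) //; apply: lin_scale.
Qed.

Lemma tlift0f A B W (t : tensor A B) : \tsum_(a, b <- t) (0 : W) = 0.
Proof. by rewrite /tlift /malg_lin big1 // => w _; rewrite scaler0. Qed.

End Linear.

Ltac bilin_split := apply: bilinI => ?; cbv beta.

(** Linearity in one variable is proved by descending through the head symbols;
   the base facts come from the context and the hint database [lin]. *)
Create HintDb lin.

Ltac lin_base := solve [assumption | auto 4 with lin nocore].

Ltac lin_step :=
  cbv beta;
  lazymatch goal with
  | |- forall _, _ => intro
  | |- bilin _ => apply: bilinI
  | |- lin (fun x => x) => exact: lin_id
  | |- lin _ => first [ lin_base |
    match goal with
    | |- lin (fun x => 0) => exact: lin_zero
    | |- lin (fun x => tlift ?F (@?t x)) =>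
        refine (@lin_comp _ _ _ _ t (tlift F) _ _);
        [| apply: tlift_lin; apply: bilinI]
    | |- lin (fun x => tlift (@?F x) ?t) =>
        refine (@lin_tlift _ _ _ _ _ F t _)
    | |- lin (fun x => @GRing.add _ (@?f x) (@?g x)) =>
        refine (@lin_add _ _ _ f g _ _)
    | |- lin (fun x => @GRing.opp _ (@?f x)) => refine (@lin_opp _ _ _ f _)
    | |- lin (fun x => @GRing.scale _ _ ?c (@?f x)) =>
        refine (@lin_scale _ _ _ c f _)
    | |- lin (fun x => @GRing.scale _ _ (@?f x) ?c) =>
        refine (@lin_scalel _ _ _ f c _)
    | |- lin (fun x => @GRing.mul _ (@?f x) ?c) =>
        refine (@lin_mull _ _ f c _)
    | |- lin (fun x => @GRing.mul _ ?c (@?f x)) =>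
        refine (@lin_mulr _ _ f c _)
    | |- lin (fun x => \sum_(i <- _ | _) _) => apply: lin_sum
    | |- lin (fun x => if _ then _ else _) => apply: lin_if
    | |- lin (fun x => ?h (@?f x) ?c ?d) =>
        lazymatch f with (fun x => x) => fail | _ => idtac end;
        refine (@lin_comp _ _ _ _ f (fun z => h z c d) _ _)
    | |- lin (fun x => ?h (@?f x) ?c) =>
        lazymatch f with (fun x => x) => fail | _ => idtac end;
        refine (@lin_comp _ _ _ _ f (fun z => h z c) _ _)
    | |- lin (fun x => ?h (@?f x)) =>
        lazymatch f with (fun x => x) => fail | _ => idtac end;
        refine (@lin_comp _ _ _ _ f h _ _)
    end ]
  end.

Ltac lin := repeat lin_step.

#[global] Hint Resolve lin_id tens_linl tens_linr : lin.
#[global] Hint Extern 1 (lin (fun x => ?f x ?y)) =>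
  match goal with H : bilin f |- _ => exact (bilin_l y H) end : lin.
#[global] Hint Extern 1 (lin (?f ?x)) =>
  match goal with H : bilin f |- _ => exact (bilin_r x H) end : lin.
#[global] Hint Extern 1 (lin (fun y => ?f ?x y)) =>
  match goal with H : bilin f |- _ => exact (bilin_r x H) end : lin.

Section TensorAlgebra.
Variables (k : fieldType) (A B : lmodType k).
Implicit Types A B W : lmodType k.

Lemma tmap_lin A' B' (f : A -> A') (g : B -> B') :
  lin f -> lin g -> lin (tmap f g).
Proof. by move=> lf lg; apply: tlift_lin; lin. Qed.

Lemma tmapE A' B' (f : A -> A') (g : B -> B') x y :
  lin f -> lin g -> tmap f g (x \ox y) = f x \ox g y.
Proof. by move=> lf lg; rewrite /tmap tliftE //; lin. Qed.

Lemma tlift_tmap A' B' W (f : A -> A') (g : B -> B') (F : A' -> B' -> W) t :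
  lin f -> lin g -> bilin F ->
  tlift F (tmap f g t) = \tsum_(a, b <- t) F (f a) (g b).
Proof.
move=> lf lg bF; rewrite /tmap (tlift_comp _ _ (tlift_lin bF)).
by apply: eq_tlift => a b; rewrite tliftE.
Qed.

Lemma tlift_id (t : tensor A B) : \tsum_(a, b <- t) (a \ox b) = t.
Proof.
apply: (@tens_eq _ _ _ _ (tlift (@tens k A B)) id) => // [|x y].
  exact/tlift_lin/tens_bilin.
by rewrite tliftE //; apply: tens_bilin.
Qed.

Variable mul : A -> A -> A.
Hypothesis bmul : bilin mul.

Lemma tmul_bilin : bilin (tmul mul).
Proof.
apply: bilinI => [t|s]; last by rewrite /tmul; lin.
by apply: tlift_lin; lin.
Qed.

Lemma tmulE a b c d : tmul mul (a \ox b) (c \ox d) = mul a c \ox mul b d.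
Proof.
rewrite /tmul tliftE; last by lin.
by rewrite tliftE //; lin.
Qed.

Lemma tmul_tmul W (F : A -> A -> W) s t : bilin F ->
  tlift F (tmul mul s t) =
  \tsum_(a, b <- s) \tsum_(c, d <- t) F (mul a c) (mul b d).
Proof.
move=> bF; rewrite /tmul (tlift_comp _ _ (tlift_lin bF)).
apply: eq_tlift => a b; rewrite (tlift_comp _ _ (tlift_lin bF)).
by apply: eq_tlift => c d; rewrite tliftE.
Qed.

Lemma tmulA : associative mul -> associative (tmul mul).
Proof.
move=> mulA; have bt := tmul_bilin; move: (tmul mul) bt tmulE => m bt mE.
move=> s t u; move: s.
apply: (@tens_eq _ _ _ _ (fun s => m s (m t u)) (fun s => m (m s t) u)).
- exact: bilin_l bt.
- by apply: (lin_comp (f := m^~ t) (g := m^~ u)); apply: bilin_l bt.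
move=> a b; move: t.
apply: (@tens_eq _ _ _ _ (fun t => m (a \ox b) (m t u)) (fun t => m (m (a \ox b) t) u)).
- by apply: (lin_comp (f := m^~ u)); [apply: bilin_l bt | apply: bilin_r bt].
- by apply: (lin_comp (g := m^~ u)); [apply: bilin_r bt | apply: bilin_l bt].
move=> c d; move: u.
apply: (@tens_eq _ _ _ _ (fun u => m (a \ox b) (m (c \ox d) u))
                          (fun u => m (m (a \ox b) (c \ox d)) u)).
- by apply: (lin_comp (f := m (c \ox d))); apply: bilin_r bt.
- exact: bilin_r bt.
by move=> e f; rewrite !mE !mulA.
Qed.

Lemma tmul1 e : left_id e mul -> left_id (e \ox e) (tmul mul).
Proof.
move=> e1; apply: tens_eq => [||x y]; [exact/bilin_r/tmul_bilin|by []|].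
by rewrite tmulE !e1.
Qed.

Lemma tmulr1 e : right_id e mul -> right_id (e \ox e) (tmul mul).
Proof.
move=> e1; apply: (@tens_eq _ _ _ _ ((tmul mul)^~ (e \ox e)) id) => // [|x y].
  exact: (bilin_l (e \ox e) tmul_bilin).
by rewrite tmulE !e1.
Qed.

End TensorAlgebra.

Lemma tmap_tmul (k : fieldType) (A B : lmodType k) (mA : A -> A -> A)
    (mB : B -> B -> B) (f : A -> B) : bilin mA -> bilin mB -> lin f ->
  (forall x y, f (mA x y) = mB (f x) (f y)) ->
  forall s t, tmap f f (tmul mA s t) = tmul mB (tmap f f s) (tmap f f t).
Proof.
move=> bA bB lf fM s t; have ltm := tmap_lin lf lf.
have tA := tmul_bilin bA; have tB := tmul_bilin bB; move: s.
apply: (@tens_eq _ _ _ _ (fun s => tmap f f (tmul mA s t))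
   (fun s => tmul mB (tmap f f s) (tmap f f t))).
- exact: lin_comp (bilin_l t tA) ltm.
- exact: lin_comp ltm (bilin_l _ tB).
move=> a b; move: t; apply: tens_eq.
- exact: lin_comp (bilin_r _ tA) ltm.
- exact: lin_comp ltm (bilin_r _ tB).
by move=> c d; rewrite !tmulE // !tmapE // tmulE // !fM.
Qed.

Section Bialgebra.
Variables (k : fieldType) (A : hopf k).
Hypothesis hA : is_bialgebra A.
Implicit Types (x y z : A) (B W : lmodType k) (s t : A -> A -> k).

Local Notation Delta := (@hcomul k A).
Local Notation eps := (@hcounit k A).
Local Notation "x ** y" := (@hmul k A x y) (at level 40, left associativity).
Local Notation h1 := (hone A).

Lemma hmul_bilin : bilin (@hmul k A).
Proof. by case: hA => -[]. Qed.

Lemma hmul_linl y : lin (fun x => x ** y).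
Proof. exact: bilin_l hmul_bilin. Qed.

Lemma hmul_linr x : lin (fun y => x ** y).
Proof. exact: bilin_r hmul_bilin. Qed.

Lemma hmulA x y z : x ** (y ** z) = x ** y ** z.
Proof. by case: hA => -[_ + _ _] _ _ _ _; apply. Qed.

Lemma hmul1 x : h1 ** x = x.
Proof. by case: hA => -[_ _ + _] _ _ _ _; apply. Qed.

Lemma hmulr1 x : x ** h1 = x.
Proof. by case: hA => -[_ _ _ +] _ _ _ _; apply. Qed.

Lemma hcomul_lin : lin Delta.
Proof. by case: hA => _ [l _ _ _ _] _ _ _ a x y; apply: l. Qed.

Lemma hcounit_lin : lin (eps : A -> k^o).
Proof. by case: hA => _ [_ l _ _ _] _ _ _ a x y; apply: l. Qed.

Lemma hcounitM x y : eps (x ** y) = eps x * eps y.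
Proof. by case: hA => _ _ _ _ []. Qed.

Lemma hcounit1 : eps h1 = 1.
Proof. by case: hA => _ _ _ _ []. Qed.

Lemma hcomul1 : Delta h1 = h1 \ox h1.
Proof. by case: hA. Qed.

Lemma hcomulM x y : Delta (x ** y) = tmul (@hmul k A) (Delta x) (Delta y).
Proof. by case: hA. Qed.

#[local] Hint Resolve hmul_linl hmul_linr hcomul_lin hcounit_lin : lin.

Definition trilin (B C D W : lmodType k) (F : B -> C -> D -> W) :=
  [/\ forall c d, lin (fun b => F b c d),
      forall b d, lin (fun c => F b c d) &
      forall b c, lin (F b c)].

(** Coassociativity in the form in which it is used: any trilinear expression in
   the three factors may be evaluated in either order. *)
Lemma hcoassoc W (F : A -> A -> A -> W) x : trilin F ->
  \tsum_(a, b <- Delta x) \tsum_(a1, a2 <- Delta a) F a1 a2 b =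
  \tsum_(a, b <- Delta x) \tsum_(b1, b2 <- Delta b) F a b1 b2.
Proof.
case=> F1 F2 F3; pose G := tlift (fun a (t : tensor A A) => tlift (F a) t).
have lG : lin G by apply: tlift_lin; lin; apply: tlift_lin; lin.
have GE a (t : tensor A A) : G (a \ox t) = tlift (F a) t.
  by rewrite /G tliftE //; lin; apply: tlift_lin; lin.
have FE a b c : tlift (F a) (b \ox c) = F a b c by rewrite tliftE //; lin.
clearbody G; have [_ [_ _ co _ _] _ _ _] := hA.
have /(congr1 G) := co x; rewrite (tlift_comp _ _ lG) [RHS](tlift_comp _ _ lG).
move=> e; transitivity (\tsum_(a, b <- Delta x)
    G (\tsum_(a1, a2 <- Delta a) a1 \ox (a2 \ox b))).
  apply: eq_tlift => a b; rewrite (tlift_comp _ _ lG).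
  by apply: eq_tlift => c d; rewrite GE FE.
by rewrite e; apply: eq_tlift => a b; rewrite GE.
Qed.

Lemma hcounitl W (f : A -> W) x : lin f ->
  \tsum_(a, b <- Delta x) (eps a *: f b) = f x.
Proof.
move=> lf; have [_ [_ _ _ /(_ x) e _] _ _ _] := hA.
rewrite -[in RHS]e (tlift_comp _ _ lf); apply: eq_tlift => a b.
by rewrite (linZ lf).
Qed.

Lemma hcounitr W (f : A -> W) x : lin f ->
  \tsum_(a, b <- Delta x) (eps b *: f a) = f x.
Proof.
move=> lf; have [_ [_ _ _ _ /(_ x) e] _ _ _] := hA.
rewrite -[in RHS]e (tlift_comp _ _ lf); apply: eq_tlift => a b.
by rewrite (linZ lf).
Qed.

Lemma tlift_comulM W (F : A -> A -> W) x y : bilin F ->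
  tlift F (Delta (x ** y)) =
  \tsum_(a, b <- Delta x) \tsum_(c, d <- Delta y) F (a ** c) (b ** d).
Proof. by move=> bF; rewrite hcomulM tmul_tmul. Qed.

(** The left and right actions of a form on bilinear maps; both restrict to the
   convolution product on forms. *)
Definition ltwist W (s : A -> A -> k) (F : A -> A -> W) x y : W :=
  \tsum_(x1, x2 <- Delta x) \tsum_(y1, y2 <- Delta y) (s x1 y1 *: F x2 y2).
Definition rtwist W (F : A -> A -> W) (s : A -> A -> k) x y : W :=
  \tsum_(x1, x2 <- Delta x) \tsum_(y1, y2 <- Delta y) (s x2 y2 *: F x1 y1).

Lemma form_l s y : is_form s -> lin (fun x : A => s x y : k^o).
Proof. by case=> h _ a x x'; apply: h. Qed.

Lemma form_r s x : is_form s -> lin (fun y : A => s x y : k^o).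
Proof. by case=> _ h a y y'; apply: h. Qed.

#[local] Hint Extern 1 (lin _) =>
  match goal with H : is_form _ |- _ => first [exact: (form_l _ H) | exact: (form_r _ H)] end : lin.

Lemma ltwist_bilin W s (F : A -> A -> W) : is_form s -> bilin F -> bilin (ltwist s F).
Proof. by move=> fs bF; rewrite /ltwist; lin. Qed.

Lemma rtwist_bilin W s (F : A -> A -> W) : is_form s -> bilin F -> bilin (rtwist F s).
Proof. by move=> fs bF; rewrite /rtwist; lin. Qed.

Lemma conv_ltwist s t : conv s t = @ltwist k^o s t.
Proof. by []. Qed.

Lemma conv_rtwist s t : conv s t = @rtwist k^o s t.
Proof.
apply/funext => x; apply/funext => y; rewrite /conv /rtwist.
apply: (@eq_tlift k A A k^o) => a b; apply: (@eq_tlift k A A k^o) => c d.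
by rewrite /GRing.scale /= mulrC.
Qed.

Lemma conv_form s t : is_form s -> is_form t -> is_form (conv s t).
Proof. by move=> fs ft; rewrite conv_ltwist; apply: ltwist_bilin. Qed.

Lemma conv1_form : is_form (@conv1 k A).
Proof. by rewrite /is_form /conv1; lin. Qed.

(** Threefold Sweedler sums, the common value of the two iterated coproducts. *)
Definition sw3 W (F : A -> A -> A -> W) x : W :=
  \tsum_(a, b <- Delta x) \tsum_(b1, b2 <- Delta b) F a b1 b2.

Lemma eq_sw3 W (F G : A -> A -> A -> W) x :
  (forall a b c, F a b c = G a b c) -> sw3 F x = sw3 G x.
Proof. by move=> FG; apply: eq_tlift => a b; apply: eq_tlift => *. Qed.

Lemma lin_sw3 B W (F : B -> A -> A -> A -> W) x :
  (forall a b c, lin (fun v => F v a b c)) -> lin (fun v => sw3 (F v) x).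
Proof. by move=> lF; rewrite /sw3; lin. Qed.

Lemma sw3E W (F : A -> A -> A -> W) x : trilin F ->
  \tsum_(a, b <- Delta x) \tsum_(a1, a2 <- Delta a) F a1 a2 b = sw3 F x.
Proof. exact: hcoassoc. Qed.

Lemma ltwist2E W s t (F : A -> A -> W) x y :
  ltwist s (ltwist t F) x y =
  sw3 (fun a b c => sw3 (fun p q r => (s a p * t b q) *: F c r) y) x.
Proof.
apply: eq_tlift => a b; rewrite -[RHS]tlift_exch; apply: eq_tlift => p q.
rewrite -[LHS]tliftZf; apply: eq_tlift => c d.
by rewrite -[LHS]tliftZf; apply: eq_tlift => r u; rewrite scalerA.
Qed.

Lemma ltwist_convE W s t (F : A -> A -> W) x y :
  is_form s -> is_form t -> bilin F ->
  ltwist (conv s t) F x y =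
  sw3 (fun a b c => sw3 (fun p q r => (s a p * t b q) *: F c r) y) x.
Proof.
move=> fs ft bF.
transitivity (\tsum_(a, b <- Delta x) \tsum_(a1, a2 <- Delta a)
  \tsum_(c, d <- Delta y) \tsum_(c1, c2 <- Delta c)
     ((s a1 c1 * t a2 c2) *: F b d)).
  apply: eq_tlift => a b; rewrite [RHS]tlift_exch; apply: eq_tlift => c d.
  rewrite /conv (tlift_comp _ _ (lin_scalel (F b d) (@lin_id _ k^o))).
  apply: eq_tlift => a1 a2.
  by rewrite (tlift_comp _ _ (lin_scalel (F b d) (@lin_id _ k^o))).
rewrite sw3E; last by split=> *; lin.
by apply: eq_sw3 => a b c; rewrite sw3E //; split=> *; lin.
Qed.

Lemma ltwist_conv W s t (F : A -> A -> W) :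
  is_form s -> is_form t -> bilin F ->
  ltwist s (ltwist t F) = ltwist (conv s t) F.
Proof.
move=> fs ft bF; apply/funext => x; apply/funext => y.
by rewrite ltwist2E ltwist_convE.
Qed.

Lemma rtwist2E W t (H : A -> A -> A -> A -> W) x y :
  is_form t -> (forall p q, bilin (fun a b => H a b p q)) ->
  (forall a b, bilin (H a b)) ->
  rtwist (fun a p => \tsum_(a1, a2 <- Delta a) \tsum_(p1, p2 <- Delta p)
                     H a1 a2 p1 p2) t x y =
  sw3 (fun a b c => sw3 (fun p q r => t c r *: H a b p q) y) x.
Proof.
move=> ft b1 b2.
have Hl p q b : lin (fun a => H a b p q) by exact: bilin_l (b1 p q).
have Hl2 p q a : lin (fun b => H a b p q) by exact: bilin_r (b1 p q).
have Hl3 a b q : lin (fun p => H a b p q) by exact: bilin_l (b2 a b).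
have Hl4 a b p : lin (H a b p) by exact: bilin_r (b2 a b).
rewrite -[RHS]sw3E; last by split=> *; apply: lin_sw3 => *; lin.
apply: eq_tlift => a b.
transitivity (\tsum_(a1, a2 <- Delta a) \tsum_(p, q <- Delta y)
  \tsum_(p1, p2 <- Delta p) (t b q *: H a1 a2 p1 p2)).
  rewrite -[RHS]tlift_exch; apply: eq_tlift => p q.
  rewrite -[LHS]tliftZf; apply: eq_tlift => a1 a2.
  by rewrite -[LHS]tliftZf.
by apply: eq_tlift => a1 a2; rewrite sw3E //; split=> *; lin.
Qed.

Lemma rtwist_conv W s t (F : A -> A -> W) :
  is_form s -> is_form t -> bilin F ->
  rtwist (rtwist F s) t = rtwist F (conv s t).
Proof.
move=> fs ft bF; apply/funext => x; apply/funext => y.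
rewrite rtwist2E //; try by move=> *; lin.
apply: eq_tlift => a b; rewrite -[LHS]tlift_exch; apply: eq_tlift => p q.
rewrite /conv (tlift_comp _ _ (lin_scalel (F a p) (@lin_id _ k^o))).
apply: eq_tlift => b1 b2.
rewrite (tlift_comp _ _ (lin_scalel (F a p) (@lin_id _ k^o))).
by apply: eq_tlift => q1 q2; rewrite scalerA mulrC.
Qed.

Lemma ltwist_rtwist W s t (F : A -> A -> W) :
  is_form s -> is_form t -> bilin F ->
  ltwist s (rtwist F t) = rtwist (ltwist s F) t.
Proof.
move=> fs ft bF; apply/funext => x; apply/funext => y.
rewrite rtwist2E //; try by move=> *; lin.
apply: eq_tlift => a b; rewrite -[RHS]tlift_exch; apply: eq_tlift => p q.
rewrite -[LHS]tliftZf; apply: eq_tlift => b1 b2.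
by rewrite -[LHS]tliftZf; apply: eq_tlift => q1 q2; rewrite !scalerA mulrC.
Qed.

Lemma ltwist_conv1 W (F : A -> A -> W) : bilin F -> ltwist (@conv1 k A) F = F.
Proof.
move=> bF; apply/funext => x; apply/funext => y.
transitivity (\tsum_(a, b <- Delta x) (eps a *: F b y)); last first.
  by rewrite hcounitl //; lin.
apply: eq_tlift => a b; rewrite -(hcounitl y (bilin_r b bF)) -tliftZf.
by apply: eq_tlift => c d; rewrite scalerA.
Qed.

Lemma rtwist_conv1 W (F : A -> A -> W) : bilin F -> rtwist F (@conv1 k A) = F.
Proof.
move=> bF; apply/funext => x; apply/funext => y.
transitivity (\tsum_(a, b <- Delta x) (eps b *: F a y)); last first.
  by rewrite hcounitr //; lin.
apply: eq_tlift => a b; rewrite -(hcounitr y (bilin_r a bF)) -tliftZf.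
by apply: eq_tlift => c d; rewrite scalerA.
Qed.

(** Convolution is associative, so that a two-sided inverse is unique and the
   chosen one is any known one. *)
Lemma conv_invE s t : is_form s -> is_conv_inv s t -> conv_inv s = t.
Proof.
move=> fs st; rewrite /conv_inv; case: xgetP => [u _ [fu su]|/(_ t)//].
have [ft tst] := st.
have E1 : conv u s = @conv1 k A.
  by apply/funext => x; apply/funext => y; case: (su x y).
have E2 : conv s t = @conv1 k A.
  by apply/funext => x; apply/funext => y; case: (tst x y).
have <- : @rtwist k^o u (@conv1 k A) = u by exact: rtwist_conv1.
have <- : @ltwist k^o (@conv1 k A) t = t by exact: ltwist_conv1.
rewrite -{1}E2 -(@rtwist_conv k^o) // -[X in @rtwist k^o X t]conv_rtwist E1.
by rewrite -conv_rtwist.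
Qed.

(** The deformed product is the product twisted by the cocycle on the left and by
   its inverse on the right; the two twists commute. *)
Lemma deform_mulE s t : is_form s -> is_conv_inv s t ->
  deform_mul s = rtwist (ltwist s (@hmul k A)) t.
Proof.
move=> fs st; have [ft _] := st; rewrite -ltwist_rtwist //; last exact: hmul_bilin.
apply/funext => x; apply/funext => y; rewrite /deform_mul (conv_invE fs st).
apply: eq_tlift => a b; apply: eq_tlift => p q.
rewrite -[RHS]tliftZf; apply: eq_tlift => b1 b2.
by rewrite -[RHS]tliftZf; apply: eq_tlift => q1 q2; rewrite scalerA.
Qed.

End Bialgebra.

(** * Bialgebras from generators *)

Section Generators.
Variables (k : fieldType) (A : hopf k).
Implicit Types (x y z : A) (W : lmodType k).

Local Notation Delta := (@hcomul k A).
Local Notation eps := (@hcounit k A).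
Local Notation "x ** y" := (@hmul k A x y) (at level 40, left associativity).
Local Notation h1 := (hone A).

(** Generation as an algebra, phrased as the induction that it provides. *)
Definition alg_generated (G : A -> Prop) :=
  forall P : A -> Prop, lin_closed P -> P h1 ->
    (forall g u, G g -> P u -> P (g ** u)) -> forall u, P u.

Variable G : A -> Prop.
Hypothesis (algA : is_algebra A) (genA : alg_generated G).
Hypothesis (lD : lin Delta) (le : lin (eps : A -> k^o)).
Hypothesis DM : forall x y, Delta (x ** y) = tmul (@hmul k A) (Delta x) (Delta y).
Hypothesis D1 : Delta h1 = h1 \ox h1.
Hypothesis eM : forall x y, eps (x ** y) = eps x * eps y.
Hypothesis e1 : eps h1 = 1.

Let bmul : bilin (@hmul k A). Proof. by case: algA. Qed.
Let mulA x y z : x ** (y ** z) = x ** y ** z. Proof. by case: algA => _ + _ _; apply. Qed.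
Let mul1 x : h1 ** x = x. Proof. by case: algA => _ _ + _; apply. Qed.
Let mulr1 x : x ** h1 = x. Proof. by case: algA => _ _ _ +; apply. Qed.
Let mul_linl y : lin (fun x => x ** y). Proof. exact: bilin_l. Qed.
Let mul_linr x : lin (fun y => x ** y). Proof. exact: bilin_r. Qed.
#[local] Hint Resolve mul_linl mul_linr lD le : lin.

Let DME W (F : A -> A -> W) x y : bilin F ->
  tlift F (Delta (x ** y)) =
  \tsum_(a, b <- Delta x) \tsum_(c, d <- Delta y) F (a ** c) (b ** d).
Proof. by move=> bF; rewrite DM tmul_tmul. Qed.

Definition coassoc_at x := forall W (F : A -> A -> A -> W), trilin F ->
  \tsum_(a, b <- Delta x) \tsum_(a1, a2 <- Delta a) F a1 a2 b =
  \tsum_(a, b <- Delta x) \tsum_(b1, b2 <- Delta b) F a b1 b2.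

Definition counit_at x :=
  \tsum_(a, b <- Delta x) (eps a *: b) = x /\
  \tsum_(a, b <- Delta x) (eps b *: a) = x.

Lemma coassoc_atM x y : coassoc_at x -> coassoc_at y -> coassoc_at (x ** y).
Proof.
move=> cx cy W F [F1 F2 F3].
have Fx a b c : trilin (fun x1 x2 x3 => F (x1 ** a) (x2 ** b) (x3 ** c)).
  by split=> *; lin.
have Fy a b c : trilin (fun x1 x2 x3 => F (a ** x1) (b ** x2) (c ** x3)).
  by split=> *; lin.
have bl b : bilin (fun a1 a2 => F a1 a2 b) by lin.
rewrite DME; last by lin.
rewrite DME; last by lin.
transitivity (\tsum_(a, b <- Delta x) \tsum_(a1, a2 <- Delta a)
  \tsum_(c, d <- Delta y) \tsum_(c1, c2 <- Delta c)
    F (a1 ** c1) (a2 ** c2) (b ** d)).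
  apply: eq_tlift => a b; rewrite [RHS]tlift_exch; apply: eq_tlift => c d.
  by rewrite DME.
transitivity (\tsum_(a, b <- Delta x) \tsum_(b1, b2 <- Delta b)
  \tsum_(c, d <- Delta y) \tsum_(d1, d2 <- Delta d)
    F (a ** c) (b1 ** d1) (b2 ** d2)); last first.
  apply: eq_tlift => a b; rewrite [LHS]tlift_exch; apply: eq_tlift => c d.
  by rewrite DME //; lin.
rewrite (cx _ (fun a1 a2 b => \tsum_(c, d <- Delta y) \tsum_(c1, c2 <- Delta c)
    F (a1 ** c1) (a2 ** c2) (b ** d))); last by split=> *; lin.
by apply: eq_tlift => a b; apply: eq_tlift => b1 b2; apply: cy.
Qed.

Lemma coassoc_at_lin : lin_closed coassoc_at.
Proof.
have L W (F : A -> A -> A -> W) : trilin F ->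
  lin (fun x => \tsum_(a, b <- Delta x) \tsum_(a1, a2 <- Delta a) F a1 a2 b) /\
  lin (fun x => \tsum_(a, b <- Delta x) \tsum_(b1, b2 <- Delta b) F a b1 b2).
  by case=> F1 F2 F3; split; lin.
split=> [W F /L[L1 L2]|a x y cx cy W F tF]; first by rewrite (lin0 L1) (lin0 L2).
by have [L1 L2] := L _ _ tF; rewrite L1 L2 cx // cy.
Qed.

Lemma coassoc_at1 : coassoc_at h1.
Proof. by move=> W F [F1 F2 F3]; rewrite D1 !tliftE ?D1 ?tliftE //; lin. Qed.

Lemma counit_atM x y : counit_at x -> counit_at y -> counit_at (x ** y).
Proof.
move=> [l1 r1] [l2 r2]; split.
  rewrite DME; last by lin.
  rewrite -[in RHS]l1 -[in RHS]l2 (tlift_comp _ _ (mul_linl _)).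
  apply: eq_tlift => a b; rewrite (tlift_comp _ _ (mul_linr _)).
  apply: eq_tlift => c d.
  by rewrite (linZ (mul_linr _)) (linZ (mul_linl _)) scalerA eM mulrC.
rewrite DME; last by lin.
rewrite -[in RHS]r1 -[in RHS]r2 (tlift_comp _ _ (mul_linl _)).
apply: eq_tlift => a b; rewrite (tlift_comp _ _ (mul_linr _)).
apply: eq_tlift => c d.
by rewrite (linZ (mul_linr _)) (linZ (mul_linl _)) scalerA eM mulrC.
Qed.

Lemma counit_at_lin : lin_closed counit_at.
Proof.
have L1 : lin (fun x => \tsum_(a, b <- Delta x) (eps a *: b)) by lin.
have L2 : lin (fun x => \tsum_(a, b <- Delta x) (eps b *: a)) by lin.
split=> [|a x y [lx rx] [ly ry]]; first by rewrite /counit_at (lin0 L1) (lin0 L2).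
by rewrite /counit_at L1 L2 lx rx ly ry.
Qed.

Lemma counit_at1 : counit_at h1.
Proof. by rewrite /counit_at D1 !tliftE ?e1 ?scale1r //; lin. Qed.

Hypothesis coG : forall x, G x -> coassoc_at x.
Hypothesis eG : forall x, G x -> counit_at x.

(** Both sides of the coalgebra axioms are multiplicative, so that the axioms need
   only be checked on generators. *)
Lemma bialgebra_of_generators : is_bialgebra A.
Proof.
have co : forall x, coassoc_at x.
  apply: genA; [exact: coassoc_at_lin|exact: coassoc_at1|].
  by move=> g u /coG cg cu; apply: coassoc_atM.
have ce : forall x, counit_at x.
  apply: genA; [exact: counit_at_lin|exact: counit_at1|].
  by move=> g u /eG cg cu; apply: counit_atM.
split; [exact: algA | | exact: DM | exact: D1 | by split].
split=> [||x|x|x]; [exact: lD | exact: le | | by case: (ce x)..].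
rewrite (co _ _ (fun a b c => a \ox (b \ox c))); last by split=> *; lin.
apply: eq_tlift => a b; rewrite -[in RHS](tlift_id (Delta b)).
by rewrite (tlift_comp _ _ (tens_linr a)).
Qed.

Variable S : A -> A.
Hypothesis (lS : lin S) (S1 : S h1 = h1).
Hypothesis SM : forall x y, S (x ** y) = S y ** S x.

Definition antipode_at x :=
  \tsum_(a, b <- Delta x) (S a ** b) = eps x *: h1 /\
  \tsum_(a, b <- Delta x) (a ** S b) = eps x *: h1.

Hypothesis SG : forall x, G x -> antipode_at x.

(** Here the two sides are not multiplicative, but the antipode identity for a
   product follows from those of its factors by cancelling the inner one. *)
Lemma antipode_of_generators : is_antipode S.
Proof.
have L1 : lin (fun x => \tsum_(a, b <- Delta x) (S a ** b)) by lin.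
have L2 : lin (fun x => \tsum_(a, b <- Delta x) (a ** S b)) by lin.
split=> [a x y|]; first exact: lS.
have le1 : lin (fun x => eps x *: h1) by lin.
apply: genA => [||g u /SG [g1 g2] [u1 u2]].
- split=> [|a x y [lx rx] [ly ry]].
    by rewrite (lin0 L1) (lin0 L2) (lin0 le1).
  by rewrite L1 L2 lx rx ly ry le1.
- by rewrite D1 !tliftE ?e1 ?S1 ?mul1 ?scale1r //; lin.
split.
  rewrite DME; last by lin.
  rewrite tlift_exch eM.
  transitivity (\tsum_(c, d <- Delta u) (S c ** (eps g *: h1) ** d)).
    apply: eq_tlift => c d.
    rewrite -g1 (tlift_comp _ _ (mul_linr _)) (tlift_comp _ _ (mul_linl _)).
    by apply: eq_tlift => a b; rewrite SM !mulA.
  rewrite -scalerA -u1 -tliftZf.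
  by apply: eq_tlift => c d; rewrite (linZ (mul_linr _)) (linZ (mul_linl _)) mulr1.
rewrite DME; last by lin.
rewrite eM mulrC -scalerA -g2 -tliftZf.
apply: eq_tlift => a b.
transitivity (a ** (eps u *: h1) ** S b); last first.
  by rewrite (linZ (mul_linr _)) (linZ (mul_linl _)) mulr1.
rewrite -u2 (tlift_comp _ _ (mul_linr _)) (tlift_comp _ _ (mul_linl _)).
by apply: eq_tlift => c d; rewrite SM !mulA.
Qed.

End Generators.

(** * Presented bialgebras *)

(** Stated in an abstract ring, where rewriting does not unfold the product. *)
Section RingIdentities.
Variables (R : nzRingType).
Implicit Types a b c u v w x : R.

Lemma mulr5A a b c u v : a * (b * c * u) * v = (a * b) * c * (u * v).
Proof. by rewrite !mulrA. Qed.

Lemma mulr_sub_split u v a b : u * v - a * b = 1 * (u - a) * v + a * (v - b) * 1.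
Proof. by rewrite mul1r mulr1 mulrBl mulrBr addrA subrK. Qed.

Lemma mulr1_both u : u = 1 * u * 1.
Proof. by rewrite mul1r mulr1. Qed.

Lemma mulr_conjD a b x y : a * (x + y) * b = a * x * b + a * y * b.
Proof. by rewrite mulrDr mulrDl. Qed.

End RingIdentities.

Section FreeAlgebra.
Variable k : fieldType.

Lemma malgUU (K : monomType) (a b : K) :
  << a >> * << b >> = << mmul a b >> :> {malg k[K]}.
Proof. by rewrite malgM_def fgmulUU mulr1. Qed.

Lemma fmulZr (K : monomType) c (u v : {malg k[K]}) : u * (c *: v) = c *: (u * v).
Proof.
have cE (w : {malg k[K]}) : w * c%:MP = c *: w.
  rewrite {1}[w]monalgE mulr_suml [in RHS](monalgE w) scaler_sumr.
  apply: eq_bigr => i _; rewrite malgM_def fgmulUU mulm1.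
  by apply/malgP => j; rewrite mcoeffZ !mcoeffU mulrnAr mulrC.
by rewrite -[c *: v]mul_malgC mulrA cE -scalerAl.
Qed.

Lemma fmul_bilin (K : monomType) : bilin (@GRing.mul {malg k[K]}).
Proof.
apply: bilinI => [v a x x'|u a x x']; first by rewrite mulrDl scalerAl.
by rewrite mulrDr fmulZr.
Qed.

Variable gen : choiceType.
Notation F := {malg k[{fmonom gen}]}.

Lemma fmonom_cons x (w : seq gen) :
  << FMonom (x :: w) >> = << fmu x >> * << FMonom w >> :> F.
Proof. by rewrite malgUU; congr << _ >>; apply/eqP; rewrite fmP fmM fmU. Qed.

Lemma fmonom_nil : << FMonom [::] >> = 1 :> F.
Proof. by rewrite -fmoneE. Qed.

Lemma free_ind (P : F -> Prop) :
  P 0 -> (forall a u v, P u -> P v -> P (a *: u + v)) -> P 1 ->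
  (forall x u, P u -> P (<< fmu x >> * u)) -> forall u, P u.
Proof.
move=> P0 PD P1 PX; apply: malg_ind => // -[]; elim=> [|x w IH].
  by rewrite fmonom_nil.
by rewrite fmonom_cons; apply: PX.
Qed.

Lemma free_eq (W : lmodType k) (f g : F -> W) : lin f -> lin g ->
  f 1 = g 1 -> (forall x u, f u = g u -> f (<< fmu x >> * u) = g (<< fmu x >> * u)) ->
  f =1 g.
Proof.
move=> lf lg fg1 fgX; apply: free_ind => [|a u v|//|x u]; last exact: fgX.
  by rewrite (lin0 lf) (lin0 lg).
by rewrite lf lg => -> ->.
Qed.

Section Action.
Variables (W : lmodType k) (op : gen -> W -> W).
Hypothesis lop : forall x, lin (op x).

(** The module over the free algebra in which the generators act by [op]. *)
Definition fact (u : F) (v : W) : W := malg_lin (fun w : {fmonom gen} => foldr op v w) u.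

Lemma fact_linl v : lin (fun u => fact u v).
Proof. exact: lin_malg. Qed.

Lemma factDl a x y v : fact (a *: x + y) v = a *: fact x v + fact y v.
Proof. exact: fact_linl. Qed.

Lemma fact0l v : fact 0 v = 0.
Proof. exact: lin0 (fact_linl v). Qed.

Lemma fact_word w v : fact << FMonom w >> v = foldr op v w.
Proof. exact: malg_linU. Qed.

Lemma fact1 v : fact 1 v = v.
Proof. by rewrite -fmonom_nil fact_word. Qed.

Lemma fact_cons x u v : fact (<< fmu x >> * u) v = op x (fact u v).
Proof.
elim/malg_ind: u => [|a u u' IH IH'|[w]].
- by rewrite mulr0 fact0l (lin0 (lop x)).
- by rewrite mulrDr fmulZr !factDl lop; congr (_ *: _ + _).
- by rewrite -fmonom_cons !fact_word.
Qed.

Lemma fact_gen x v : fact << fmu x >> v = op x v.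
Proof. by rewrite -[<< _ >>]mulr1 fact_cons fact1. Qed.

Lemma fact_linr u : lin (fact u).
Proof.
elim/free_ind: u => [|a u u' IH IH'||x u IH] b v v'.
- by rewrite !fact0l scaler0 addr0.
- by rewrite !factDl IH IH' !scalerDr addrACA !scalerA mulrC.
- by rewrite !fact1.
- by rewrite [LHS]fact_cons (fact_cons x u v) (fact_cons x u v') IH lop.
Qed.

Lemma factM u u' v : fact (u * u') v = fact u (fact u' v).
Proof.
elim/free_ind: u => [|a u1 u2 IH1 IH2||x u IH].
- by rewrite mul0r !fact0l.
- by rewrite mulrDl -scalerAl !factDl; congr (_ *: _ + _).
- by rewrite mul1r fact1.
- by rewrite -mulrA [LHS]fact_cons [RHS]fact_cons; congr (op x _).
Qed.

Lemma fact_genE x : fact << fmu x >> = op x.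
Proof. by apply/funext => v; apply: fact_gen. Qed.

Lemma factX u n v : fact (u ^+ n) v = iter n (fact u) v.
Proof. by elim: n => [|n IH]; [rewrite expr0 fact1 | rewrite exprS factM IH]. Qed.

Lemma factD u u' v : fact (u + u') v = fact u v + fact u' v.
Proof. exact: linD (fact_linl v) u u'. Qed.

Lemma factB u u' v : fact (u - u') v = fact u v - fact u' v.
Proof. exact: linB (fact_linl v) u u'. Qed.

Lemma factZ a u v : fact (a *: u) v = a *: fact u v.
Proof. exact: linZ (fact_linl v) a u. Qed.

End Action.
End FreeAlgebra.

Section Presented.
Variables (k : fieldType) (gen : choiceType).
Notation F := {malg k[{fmonom gen}]}.
Variables (rel : F -> F -> Prop).
Variables (Delta : gen -> tensor F F) (eps : gen -> k).

Notation A := (presented rel Delta eps).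

Definition ppi (u : F) : A := vpi (relators rel) u.

Lemma ppi_lin : lin ppi.
Proof. exact: vpi_lin. Qed.

Lemma ppi_repr (x : A) : ppi (vrepr x) = x.
Proof. exact: vreprK. Qed.

Lemma relators_mul a u b : relators rel u -> relators rel (a * u * b).
Proof.
case=> a' [x [y [b' [rxy ->]]]]; exists (a * a'), x, y, (b' * b).
by split; [exact: rxy | exact: mulr5A].
Qed.

Lemma span_relators_mul a u b :
  Defs.span (relators rel) u -> Defs.span (relators rel) (a * u * b).
Proof.
elim=> [|c x y rx _ IH]; first by rewrite mulr0 mul0r; apply: span0.
rewrite mulr_conjD fmulZr -scalerAl; apply: span_lin; last exact: IH.
exact: relators_mul.
Qed.

Lemma ppiE u : Defs.span (relators rel) (vrepr (ppi u) - u).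
Proof. by apply/vpiP; rewrite vreprK. Qed.

Lemma ppiM u v : hmul (ppi u) (ppi v) = ppi (u * v).
Proof.
apply/vpiP; set u' := vrepr _; set v' := vrepr _.
rewrite mulr_sub_split; apply: spanD; apply: span_relators_mul; apply: ppiE.
Qed.

Lemma ppi_rel x y : rel x y -> ppi x = ppi y.
Proof.
move=> rxy; apply/vpiP/span_sub; exists 1, x, y, 1.
by split; [exact: rxy | exact: mulr1_both].
Qed.

Lemma presented_ind (P : A -> Prop) : (forall u, P (ppi u)) -> forall x, P x.
Proof. by move=> Pu x; rewrite -[x]ppi_repr. Qed.

Lemma presented_algebra : is_algebra A.
Proof.
split.
- apply: bilinI => z a x y.
    elim/presented_ind: x; elim/presented_ind: y; elim/presented_ind: z => z y x.
    rewrite -[X in hmul X _ = _](ppi_lin a x y).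
    rewrite (ppiM x z) (ppiM y z) (ppiM (a *: x + y) z) -(ppi_lin a (x * z)).
    exact: (congr1 ppi ((fmul_bilin _ _).1 _ _ _ _)).
  elim/presented_ind: x; elim/presented_ind: y; elim/presented_ind: z => z y x.
  rewrite -[X in hmul _ X = _](ppi_lin a x y).
  rewrite (ppiM z x) (ppiM z y) (ppiM z (a *: x + y)) -(ppi_lin a (z * x)).
  exact: (congr1 ppi ((fmul_bilin _ _).2 _ _ _ _)).
- elim/presented_ind=> x; elim/presented_ind=> y; elim/presented_ind=> z.
  rewrite (ppiM y z) (ppiM x y) (ppiM x (y * z)) (ppiM (x * y) z).
  exact: (congr1 ppi (mulrA x y z)).
- by elim/presented_ind=> x; rewrite ppiM mul1r.
- by elim/presented_ind=> x; rewrite ppiM mulr1.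
Qed.

Section PAction.
Variables (W : lmodType k) (op : gen -> W -> W).
Hypothesis lop : forall x, lin (op x).
Hypothesis op_rel : forall x y, rel x y -> forall v, fact op x v = fact op y v.

Definition pact (x : A) (v : W) : W := fact op (vrepr x) v.

Lemma pactE u v : pact (ppi u) v = fact op u v.
Proof.
apply: (vquot_lin (f := fun u => fact op u v)); first exact: fact_linl.
move=> _ [a [x [y [b [rxy ->]]]]].
rewrite !factM // (linB (fact_linl op _)) (op_rel rxy) subrr.
by rewrite (lin0 (fact_linr _ _)).
Qed.

Lemma pact_bilin : bilin pact.
Proof.
apply: bilinI => [v a x y|x]; last exact: fact_linr.
elim/presented_ind: x => x; elim/presented_ind: y => y.
by rewrite -ppi_lin !pactE factDl.
Qed.

Lemma pactM x y v : pact (hmul x y) v = pact x (pact y v).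
Proof.
elim/presented_ind: x => x; elim/presented_ind: y => y.
by rewrite ppiM !pactE factM.
Qed.

Lemma pact1 v : pact (hone A) v = v.
Proof. by rewrite [hone A]/(ppi 1) pactE fact1. Qed.

Lemma pact_gen x v : pact (ppi << fmu x >>) v = op x v.
Proof. by rewrite pactE fact_gen. Qed.

End PAction.

Definition pgen (a : A) := exists x, a = ppi << fmu x >>.

Lemma presented_generated : alg_generated pgen.
Proof.
move=> P [P0 PD] P1 PX; elim/presented_ind => u; elim/free_ind: u => //.
- by rewrite (lin0 ppi_lin).
- by move=> a u v Pu Pv; rewrite ppi_lin; apply: PD.
- by move=> x u Pu; rewrite -ppiM; apply: PX => //; exists x.
Qed.

Definition gcomul (x : gen) : tensor A A := tmap ppi ppi (Delta x).

Hypothesis comul_rel : forall x y, rel x y -> forall t : tensor A A,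
  fact (fun x => tmul (@hmul k A) (gcomul x)) x t =
  fact (fun x => tmul (@hmul k A) (gcomul x)) y t.
Hypothesis counit_rel : forall x y, rel x y -> forall c : k^o,
  fact (fun x (c : k^o) => eps x *: c) x c =
  fact (fun x (c : k^o) => eps x *: c) y c.

Let bmul : bilin (@hmul k A).
Proof. by have [] := presented_algebra. Qed.

Let opD x : lin (tmul (@hmul k A) (gcomul x)).
Proof. exact/bilin_r/tmul_bilin. Qed.

Let opE x : lin (fun c : k^o => eps x *: c).
Proof. by apply: lin_scale; apply: lin_id. Qed.

Lemma tmap_ppiM s t : tmap ppi ppi (tmul *%R s t) =
  tmul (@hmul k A) (tmap ppi ppi s) (tmap ppi ppi t).
Proof.
apply: tmap_tmul; [exact: fmul_bilin | exact: bmul | exact: ppi_lin |].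
by move=> x y; rewrite ppiM.
Qed.

Lemma tmap_free_comul u : tmap ppi ppi (free_comul Delta u) =
  fact (fun x => tmul (@hmul k A) (gcomul x)) u (hone A \ox hone A).
Proof.
have lp := ppi_lin; have lt : lin (tmap ppi ppi) by apply: tmap_lin.
have bf := tmul_bilin (@fmul_bilin k {fmonom gen}).
move: u; apply: (free_eq (f := fun u => tmap ppi ppi (free_comul Delta u))
  (g := fun u => fact (fun x => tmul (@hmul k A) (gcomul x)) u (hone A \ox hone A))).
- exact: lin_comp (@lin_malg _ _ _ _) lt.
- exact: fact_linl.
- rewrite (fact1 _ _ : free_comul Delta 1 = _) fact1.
  exact: (tmapE 1 1 lp lp).
move=> x u IH; rewrite [RHS](fact_cons opD) -IH -tmap_ppiM; congr tmap.
exact: (fact_cons (op := fun x => tmul *%R (Delta x)) (fun y => bilin_r _ bf)).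
Qed.

(** The coproduct is the action on [1 \ox 1] that lets each generator act by
   multiplication by its coproduct: linearity and multiplicativity follow. *)
Lemma pcomulE x : hcomul x =
  pact (fun x => tmul (@hmul k A) (gcomul x)) x (hone A \ox hone A).
Proof. exact: tmap_free_comul. Qed.

Lemma pcounitE (x : A) : hcounit x = pact (fun x (c : k^o) => eps x *: c) x 1.
Proof.
have E : (fun w : {fmonom gen} => \prod_(x <- w) eps x) =
         (fun w : {fmonom gen} => foldr (fun x (c : k^o) => eps x *: c) 1 w).
  by apply/funext => w; rewrite unlock; elim: (w : seq _) => //= y s ->.
by rewrite /hcounit /= /free_counit E.
Qed.

Lemma pcomul1 : hcomul (hone A) = hone A \ox hone A.
Proof. by rewrite pcomulE pact1. Qed.

Lemma pcounit1 : hcounit (hone A) = 1.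
Proof. by rewrite pcounitE pact1. Qed.

Lemma pcomul_lin : lin (@hcomul k A).
Proof. by move=> a x y; rewrite !pcomulE; apply: (pact_bilin opD comul_rel).1. Qed.

Lemma pcounit_lin : lin (@hcounit k A : A -> k^o).
Proof. by move=> a x y; rewrite !pcounitE; apply: (pact_bilin opE counit_rel).1. Qed.

Lemma pcomulM x y : hcomul (hmul x y) = tmul (@hmul k A) (hcomul x) (hcomul y).
Proof.
rewrite [LHS]pcomulE pactM // -pcomulE.
have [_ mA m1 _] := presented_algebra.
have tb := tmul_bilin bmul; elim/presented_ind: x => u.
move: (hcomul y) => t; rewrite pactE // pcomulE pactE //.
move: u; apply: (free_eq
  (f := fun u => fact (fun x => tmul (@hmul k A) (gcomul x)) u t)
  (g := fun u => tmul (@hmul k A)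
     (fact (fun x => tmul (@hmul k A) (gcomul x)) u (hone A \ox hone A)) t)).
- exact: fact_linl.
- exact: lin_comp (fact_linl _ _) (bilin_l t tb).
- by rewrite !fact1 tmul1.
move=> x u IH; rewrite [LHS](fact_cons opD) IH.
rewrite [X in _ = tmul _ X _](fact_cons opD).
exact: (tmulA bmul mA).
Qed.

Lemma pcounitM (x y : A) : hcounit (hmul x y) = hcounit x * hcounit y.
Proof.
rewrite [LHS]pcounitE pactM // -pcounitE.
elim/presented_ind: x => u.
move: (hcounit y) => c; rewrite pactE // pcounitE pactE //.
move: u; apply: (free_eq
  (f := fun u => fact (fun x (c : k^o) => eps x *: c) u c)
  (g := fun u => fact (fun x (c : k^o) => eps x *: c) u 1 * c : k^o)).
- exact: fact_linl.
- by apply: lin_mull; apply: fact_linl.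
- by rewrite !fact1 mul1r.
move=> x u IH; rewrite [LHS](fact_cons opE) IH.
by rewrite [X in _ = X * _](fact_cons opE) scalerAl.
Qed.

Lemma presented_bialgebra :
  (forall x, coassoc_at (ppi << fmu x >>)) ->
  (forall x, counit_at (ppi << fmu x >>)) -> is_bialgebra A.
Proof.
move=> co ce; apply: (bialgebra_of_generators (G := pgen)).
- exact: presented_algebra.
- exact: presented_generated.
- exact: pcomul_lin.
- exact: pcounit_lin.
- exact: pcomulM.
- exact: pcomul1.
- exact: pcounitM.
- exact: pcounit1.
- by move=> _ [x ->].
- by move=> _ [x ->].
Qed.

Variable S : gen -> A.
Hypothesis S_rel : forall x y, rel x y -> forall v : A,
  fact (fun x v => hmul v (S x)) x v = fact (fun x v => hmul v (S x)) y v.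

Let opS x : lin (fun v => hmul v (S x)).
Proof. exact: bilin_l bmul. Qed.

Definition pantipode (x : A) : A := pact (fun x v => hmul v (S x)) x (hone A).

(** The antipode is the action on the unit in which generators multiply on the
   right by their antipodes. *)
Lemma presented_hopf : is_bialgebra A ->
  (forall x, antipode_at pantipode (ppi << fmu x >>)) -> is_hopf A.
Proof.
move=> bA aA; split=> //; exists pantipode.
have [_ mA m1 mr1] := presented_algebra.
have SE x v : pact (fun x v => hmul v (S x)) x v = hmul v (pantipode x).
  elim/presented_ind: x => u; rewrite /pantipode !pactE //.
  move: u; apply: (free_eq
    (f := fun u => fact (fun x v => hmul v (S x)) u v)
    (g := fun u => hmul v (fact (fun x v => hmul v (S x)) u (hone A)))).
  - exact: fact_linl.
  - exact: lin_comp (fact_linl _ _) (bilin_r v bmul).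
  - by rewrite !fact1 mr1.
  move=> x u IH; rewrite [LHS](fact_cons opS) IH.
  by rewrite [X in _ = hmul _ X](fact_cons opS); exact/esym/mA.
apply: (antipode_of_generators (G := pgen)).
- exact: presented_algebra.
- exact: presented_generated.
- exact: pcomul_lin.
- exact: pcounit_lin.
- exact: pcomulM.
- exact: pcomul1.
- exact: pcounitM.
- exact: pcounit1.
- by move=> a x y; apply: (pact_bilin opS S_rel).1.
- exact: pact1.
- by move=> x y; rewrite {1}/pantipode pactM // SE.
- by move=> _ [x ->].
Qed.

End Presented.

(** * The dihedral Yetter-Drinfeld module and the relations of A_I *)

Section Dihedral.
Variables (k : fieldType) (m : nat) (omega : k) (r : nat).
Variable (I : r.-tuple (nat * nat)).

Local Notation p := (fst_at I).
Local Notation q := (snd_at I).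
Local Notation X := ('I_r * bool)%type.
Local Notation G := (dihedral m).
Local Notation V := (MI m omega I).

Definition dact (u : G) (x : X) : X := (x.1, u.2 (+) x.2).
Definition dsgn (b : bool) : k := if b then omega^-1 else omega.
Definition dcoef (u : G) (x : X) : k := dsgn (u.2 (+) x.2) ^+ (q x.1 * u.1).
Definition ddeg (x : X) : G := yddeg (y := V) x.

Hypothesis (m1 : (1 < m)%N) (om : omega ^+ m = 1).
Hypothesis key : forall s t, omega ^+ (p s * q t) = -1.

Lemma omega_neq0 : omega != 0.
Proof.
apply/eqP => o0; have/eqP := om.
by rewrite o0 expr0n eqn0Ngt (ltnW m1) eq_sym oner_eq0.
Qed.

Lemma dsgnX b : dsgn b ^+ m = 1.
Proof. by case: b; rewrite /dsgn ?exprVn om ?invr1. Qed.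

Lemma dsgn_neq0 b : dsgn b != 0.
Proof. by case: b; rewrite /dsgn ?invr_eq0 omega_neq0. Qed.

Lemma dsgnN b : dsgn (~~ b) = (dsgn b)^-1.
Proof. by case: b; rewrite /= ?invrK. Qed.

Lemma dsgnD b (a c : 'Z_m) n :
  dsgn b ^+ (n * (a + c)%R) = dsgn b ^+ (n * a) * dsgn b ^+ (n * c).
Proof.
rewrite -exprD -mulnDr ![(n * _)%N]mulnC !exprM; congr (_ ^+ n).
rewrite -[RHS](expr_mod _ (dsgnX b)) /=; congr (_ ^+ (_ %% _)); exact: Zp_cast.
Qed.

Lemma dsgnNe b (a : 'Z_m) n : dsgn (~~ b) ^+ (n * a) = dsgn b ^+ (n * (- a)%R).
Proof.
have /eqP := dsgnD b a (- a) n; rewrite subrr muln0 expr0 eq_sym => /eqP h.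
by rewrite dsgnN exprVn -[LHS]mulr1 -h mulrA mulVf ?mul1r // expf_neq0 // dsgn_neq0.
Qed.

Lemma dact1 x : dact 1%g x = x.
Proof. by case: x. Qed.

Lemma dactM u v x : dact (u * v)%g x = dact u (dact v x).
Proof. by rewrite /dact /= addbA. Qed.

Lemma dcoef1 x : dcoef 1%g x = 1.
Proof. by rewrite /dcoef muln0. Qed.

Lemma dcoefM u v x : dcoef (u * v)%g x = dcoef u (dact v x) * dcoef v x.
Proof.
rewrite /dcoef /= dsgnD -addbA; congr (_ * _).
by case: u => a []; rewrite /fst /snd ?addTb ?addFb // dsgnNe opprK.
Qed.

Lemma dcoef_neq0 u x : dcoef u x != 0.
Proof. by rewrite expf_neq0 // dsgn_neq0. Qed.

Lemma MI_actE u x : MI_act omega I u x = dcoef u x *: vbase (V := V) (dact u x).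
Proof.
apply/ffunP => z; rewrite !ffunE; case: eqP => _ /=.
  by rewrite /GRing.scale /= mulr1.
by rewrite /GRing.scale /= mulr0.
Qed.

Lemma dih_hm : (dih_h m ^+ m)%g = 1%g.
Proof. by rewrite dih_hX pchar_Zp. Qed.

Lemma ddegE s b : (p s <= m)%N ->
  ddeg (s, b) = (dih_h m ^+ (if b then (m - p s)%N else p s))%g.
Proof.
move=> le; case: b => //=; rewrite /ddeg /=.
by apply: (mulIg (dih_h m ^+ p s)%g); rewrite mulVg -expgD subnK // dih_hm.
Qed.

Lemma ddegC x y : (ddeg x * ddeg y)%g = (ddeg y * ddeg x)%g.
Proof.
have cX n l : commute (dih_h m ^+ n)%g (dih_h m ^+ l)%g.
  exact/commuteX/commute_sym/commuteX.
case: x y => s [] [t []]; rewrite /ddeg /=; try exact: cX.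
- by apply: commuteV; apply: commute_sym; apply: commuteV; apply: cX.
- by apply: commute_sym; apply: commuteV; apply: cX.
- by apply: commuteV; apply: cX.
Qed.

Lemma ddeg_act u x : ddeg (dact u x) = (u * ddeg x * u^-1)%g.
Proof.
have [_ _ h] := MI_ydmod I m1 om; apply: h.
rewrite [ydact _ _]MI_actE !ffunE eqxx /GRing.scale /= mulr1.
exact: dcoef_neq0.
Qed.

Lemma dact_deg y x : dact (ddeg y) x = x.
Proof. by case: x y => s b [t []]; rewrite /ddeg /= ?dih_hX /dact. Qed.

(** The degree of every basis vector acts by -1: the braiding of M_I is the
   opposite of the flip. *)
Lemma dcoef_deg y x : dcoef (ddeg y) x = -1.
Proof.
have E n s b : dsgn b ^+ (q s * (n%:R : 'Z_m)) = dsgn b ^+ (q s * n).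
  rewrite Zp_nat /= Zp_cast // ![(q s * _)%N]mulnC !exprM.
  by rewrite -(expr_mod n (dsgnX b)).
have N1 t s b : dsgn b ^+ (q s * p t) = -1.
  by case: b; rewrite /dsgn ?exprVn mulnC key ?invrN1.
case: x y => s b [t []]; rewrite /dcoef /ddeg /= dih_hX /=; last by rewrite E N1.
by rewrite -dsgnNe E N1.
Qed.

Variables lam gam : 'I_r -> 'I_r -> k.

(** One table for both kinds of anticommutation relations of A_I. *)
Definition Lam (x y : X) : k :=
  if x.2 == y.2 then (q x.1 == m - q y.1)%N%:R * lam x.1 y.1
  else (q x.1 == q y.1)%:R * gam x.1 y.1.

End Dihedral.

Section Uniform.
Variables (k : fieldType) (m : nat) (omega : k) (r : nat).
Variable (I : r.-tuple (nat * nat)).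
Local Notation X := ('I_r * bool)%type.
Local Notation G := (dihedral m).

(** The relations of A_I made uniform in the group element and in the generator.
   They are imposed on operators, so as to describe all modules over A_I. *)
Record uniform (Lam : X -> X -> k) (W : lmodType k)
    (L : G -> W -> W) (Z : X -> W -> W) : Prop := Uniform {
  uni_linL : forall u, lin (L u);
  uni_linZ : forall x, lin (Z x);
  uni_1 : forall w, L 1%g w = w;
  uni_M : forall u v w, L (u * v)%g w = L u (L v w);
  uni_LZ : forall u x w, L u (Z x w) = dcoef omega I u x *: Z (dact u x) (L u w);
  uni_ZZ : forall x y w, Z x (Z y w) + Z y (Z x w) =
     Lam x y *: (w - L (ddeg m omega I x * ddeg m omega I y)%g w)
}.

Definition gen_op (W : lmodType k) (L : G -> W -> W) (Z : X -> W -> W)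
    (a : AI_gen r) : W -> W :=
  match a with
  | inl true => L (dih_g m)
  | inl false => L (dih_h m)
  | inr x => Z x
  end.

Hypothesis (m1 : (1 < m)%N) (om : omega ^+ m = 1).
Hypothesis pm : forall s, (fst_at I s <= m)%N.
Variables (lam gam : 'I_r -> 'I_r -> k).

Local Notation p := (fst_at I).
Local Notation q := (snd_at I).
Local Notation rel := (AI_rel m omega I lam gam).
Local Notation uni := (uniform (Lam m I lam gam)).

Section Op.
Variables (W : lmodType k) (op : AI_gen r -> W -> W).
Hypothesis lop : forall x, lin (op x).
Local Notation g := (op (inl true)).
Local Notation h := (op (inl false)).
Local Notation a b s := (op (inr (s, b))).

Record gen_rel : Prop := GenRel {
  gr_gg : forall v, g (g v) = v;
  gr_hm : forall v, iter m h v = v;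
  gr_ghg : forall v, g (h (g v)) = iter (m - 1) h v;
  gr_ga : forall s v, g (a false s v) = a true s (g v);
  gr_ha1 : forall s v, h (a false s v) = omega ^+ q s *: a false s (h v);
  gr_ha2 : forall s v, h (a true s v) = omega ^- q s *: a true s (h v);
  gr_a1a1 : forall s t v, a false s (a false t v) + a false t (a false s v) =
    ((q s == m - q t)%N%:R * lam s t) *: (v - iter (p s + p t) h v);
  gr_a1a2 : forall s t v, a false s (a true t v) + a true t (a false s v) =
    ((q s == q t)%:R * gam s t) *: (v - iter (p s + (m - p t)) h v)
}.

Let fg x : fact op << fmu x >> = op x. Proof. exact: fact_genE. Qed.
Let fh n v : fact op (gen_h k r ^+ n) v = iter n h v.
Proof. by rewrite factX // [fact op _]fg. Qed.
Let f2 x y v : fact op (<< fmu x >> * << fmu y >>) v = op x (op y v).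
Proof. by rewrite factM // !fg. Qed.
Let f3 x y z v : fact op (<< fmu x >> * << fmu y >> * << fmu z >>) v =
  op x (op y (op z v)).
Proof. by rewrite factM // f2 fg. Qed.
Let fgg v : fact op (gen_g k r ^+ 2) v = g (g v).
Proof. by rewrite factX // [fact op _]fg. Qed.
Let fsuml x y v : fact op (<< fmu x >> * << fmu y >> + << fmu y >> * << fmu x >>) v =
  op x (op y v) + op y (op x v).
Proof. exact: etrans (factD _ _ _ _) (congr2 +%R (f2 x y v) (f2 y x v)). Qed.
Let fsumr c n v : fact op (c *: (1 - gen_h k r ^+ n)) v = c *: (v - iter n h v).
Proof. by rewrite factZ factB fact1 fh. Qed.

Lemma gen_relP : gen_rel <->
  (forall x y, rel x y -> forall v, fact op x v = fact op y v).
Proof.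
split=> [[h1 h2 h3 h4 h5 h6 h7 h8] x y rxy v|R].
  case: rxy => [|||s|s|s|s t|s t].
  - by rewrite fgg fact1.
  - by rewrite fh fact1.
  - by rewrite f3 fh.
  - exact: etrans (f2 _ _ v) (etrans (h4 s v) (esym (f2 _ _ v))).
  - by apply: etrans (f2 _ _ v) _; rewrite factZ f2.
  - by apply: etrans (f2 _ _ v) _; rewrite factZ f2.
  - exact: etrans (fsuml _ _ v) (etrans (h7 s t v) (esym (fsumr _ _ v))).
  - exact: etrans (fsuml _ _ v) (etrans (h8 s t v) (esym (fsumr _ _ v))).
split=> [v|v|v|s v|s v|s v|s t v|s t v].
- by have := R _ _ (AI_gg _ _ _ _ _) v; rewrite fgg fact1.
- by have := R _ _ (AI_hm _ _ _ _ _) v; rewrite fh fact1.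
- by have := R _ _ (AI_ghg _ _ _ _ _) v; rewrite f3 fh.
- exact: etrans (esym (f2 _ _ v)) (etrans (R _ _ (AI_ga _ _ _ _ _ s) v) (f2 _ _ v)).
- apply: etrans (esym (f2 _ _ v)) (etrans (R _ _ (AI_ha1 _ _ _ _ _ s) v) _).
  by rewrite factZ f2.
- apply: etrans (esym (f2 _ _ v)) (etrans (R _ _ (AI_ha2 _ _ _ _ _ s) v) _).
  by rewrite factZ f2.
- exact: etrans (esym (fsuml _ _ v))
    (etrans (R _ _ (AI_a1a1 _ _ _ _ _ s t) v) (fsumr _ _ v)).
- exact: etrans (esym (fsuml _ _ v))
    (etrans (R _ _ (AI_a1a2 _ _ _ _ _ s t) v) (fsumr _ _ v)).
Qed.

End Op.
End Uniform.

Section UniformGen.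
Variables (k : fieldType) (m : nat) (omega : k) (r : nat).
Variable (I : r.-tuple (nat * nat)).
Local Notation X := ('I_r * bool)%type.
Local Notation G := (dihedral m).
Hypothesis (m1 : (1 < m)%N) (om : omega ^+ m = 1).
Hypothesis pm : forall s, (fst_at I s <= m)%N.
Variables (lam gam : 'I_r -> 'I_r -> k).
Local Notation p := (fst_at I).
Local Notation q := (snd_at I).
Local Notation dg := (dih_g m).
Local Notation dh := (dih_h m).
Hypothesis gsym : forall s t, q s = q t -> gam s t = gam t s.

Variable W : lmodType k.

Lemma dih_gg : (dg * dg)%g = 1%g.
Proof. by congr (_, _); rewrite /= oppr0 addr0. Qed.

Lemma dih_ghg : (dg * (dh * dg))%g = (dh ^+ (m - 1))%g.
Proof.
rewrite dih_hX natrB ?(ltnW m1) // pchar_Zp // sub0r.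
by congr (_, _); rewrite /= !add0r addr0.
Qed.

Lemma dihE (u : G) : u = (dh ^+ u.1 * (if u.2 then dg else 1))%g.
Proof.
case: u => a b; rewrite dih_hX Zp_nat; have -> : inZp a = a by apply: valZpK.
by case: b; congr (_, _); rewrite /= addr0.
Qed.

Lemma dcoef_g x : dcoef omega I dg x = 1.
Proof. by rewrite /dcoef muln0. Qed.

Lemma dcoef_hX n x : dcoef omega I (dh ^+ n)%g x = dsgn omega x.2 ^+ (q x.1 * n).
Proof.
rewrite dih_hX /dcoef addFb Zp_nat /= Zp_cast // ![(q _ * _)%N]mulnC !exprM.
by rewrite -(expr_mod n (dsgnX om _)).
Qed.

Lemma iterL (L : G -> W -> W) n w : (forall w, L 1%g w = w) ->
  (forall u v w, L (u * v)%g w = L u (L v w)) ->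
  iter n (L dh) w = L (dh ^+ n)%g w.
Proof. by move=> L1 LM; elim: n => [|n IH]; rewrite ?expgS ?LM -?IH // expg0 L1. Qed.

(** The defining relations are instances of the uniform ones at g and h. *)
Lemma uniform_gen_rel (L : G -> W -> W) (Z : X -> W -> W) :
  uniform omega I (Lam m I lam gam) L Z -> gen_rel m omega I lam gam (gen_op L Z).
Proof.
case=> lL lZ L1 LM LZ ZZ; have it n v := iterL n v L1 LM.
have d1 s : ddeg m omega I (s, false) = (dh ^+ p s)%g by rewrite ddegE.
have d2 s : ddeg m omega I (s, true) = (dh ^+ (m - p s))%g by rewrite ddegE.
split=> [v|v|v|s v|s v|s v|s t v|s t v] /=.
- by rewrite -LM dih_gg L1.
- by rewrite it dih_hm // L1.
- by rewrite it -(LM dh dg) -(LM dg) dih_ghg.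
- by rewrite LZ dcoef_g scale1r.
- by rewrite LZ -[dh]expg1 dcoef_hX muln1.
- by rewrite LZ -[dh]expg1 dcoef_hX muln1 /= exprVn.
- by rewrite it expgD -!d1; apply: ZZ.
- by rewrite it expgD -d1 -d2; apply: ZZ.
Qed.

Section Converse.
Variable op : AI_gen r -> W -> W.
Hypothesis lop : forall x, lin (op x).
Hypothesis R : gen_rel m omega I lam gam op.
Local Notation g := (op (inl true)).
Local Notation h := (op (inl false)).

Definition opL (u : G) (w : W) : W := iter u.1 h (if u.2 then g w else w).
Definition opZ (x : X) : W -> W := op (inr x).

Let lith n : lin (iter n h).
Proof. by elim: n => [//|n IH] a x y; rewrite /= IH lop. Qed.

Let it_mod n v : iter (n %% m) h v = iter n h v.
Proof.
rewrite [in RHS](divn_eq n m) addnC iterD; congr iter.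
elim: (n %/ m)%N => [//|d IH]; by rewrite mulSn iterD -IH (gr_hm R).
Qed.

Let it_Zp n v : iter (n%:R : 'Z_m) h v = iter n h v.
Proof. by rewrite Zp_nat /= Zp_cast // it_mod. Qed.

Let g_it n v : g (iter n h v) = iter ((m - 1) * n) h (g v).
Proof.
elim: n v => [|n IH] v; first by rewrite muln0.
rewrite mulnS iterD -IH -(gr_ghg R) (gr_gg R); first by [].
Qed.

Lemma opL_hX n v : opL (dh ^+ n)%g v = iter n h v.
Proof. by rewrite /opL dih_hX it_Zp. Qed.

Lemma opL_1 w : opL 1%g w = w. Proof. by []. Qed.

Lemma opL_M u v w : opL (u * v)%g w = opL u (opL v w).
Proof.
case: u v => [a b] [c d]; case: b.
  change (iter (a - c : 'Z_m)%R h (if ~~ d then g w else w) =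
          iter a h (g (iter c h (if d then g w else w)))).
  have -> : a - c = (a + (m - 1) * c)%N%:R.
    rewrite natrD natrM natrB ?(ltnW m1) // pchar_Zp // sub0r mulN1r.
    by rewrite !Zp_nat; congr (_ - _); apply/esym/valZpK.
  rewrite it_Zp iterD g_it; congr (iter _ _ (iter _ _ _)).
  by case: d => //=; rewrite (gr_gg R).
change (iter (a + c : 'Z_m)%R h (if d then g w else w) =
        iter a h (iter c h (if d then g w else w))).
rewrite -[in LHS](valZpK a) -[in LHS](valZpK c) -!Zp_nat -natrD it_Zp iterD.
by [].
Qed.

Lemma opL_Z u x w : opL u (opZ x w) = dcoef omega I u x *: opZ (dact u x) (opL u w).
Proof.
have hZ n y v : iter n h (opZ y v) = dsgn omega y.2 ^+ (q y.1 * n) *: opZ y (iter n h v).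
  case: y => s b; elim: n => [|n IH]; first by rewrite muln0 scale1r.
  rewrite /= IH (linZ (lop _)) mulnS exprD mulrC -scalerA; congr (_ *: _).
  by case: b {IH} => /=; rewrite ((gr_ha1 R), (gr_ha2 R)) // exprVn.
have gZ y v : g (opZ y v) = opZ (dact dg y) (g v).
  case: y => s []; rewrite /dact /=; last exact: (gr_ga R).
  apply: (can_inj (gr_gg R)).
  exact: etrans (gr_gg R _) (esym (etrans (gr_ga R _ _) (congr1 _ (gr_gg R _)))).
case: u => a b; rewrite /opL /=.
have E : dcoef omega I (a, b) x = dsgn omega (b (+) x.2) ^+ (q x.1 * a) by [].
rewrite E; case: b {E}.
  by rewrite gZ hZ.
by rewrite hZ; case: x.
Qed.

Lemma opZ_Z x y w : opZ x (opZ y w) + opZ y (opZ x w) =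
  Lam m I lam gam x y *: (w - opL (ddeg m omega I x * ddeg m omega I y)%g w).
Proof.
have d1 s : ddeg m omega I (s, false) = (dh ^+ p s)%g by rewrite ddegE.
have d2 s : ddeg m omega I (s, true) = (dh ^+ (m - p s))%g by rewrite ddegE.
have ggL v : opL dg (opL dg v) = v by rewrite -opL_M dih_gg.
have Zt s v : opZ (s, true) v = opL dg (opZ (s, false) (opL dg v)).
  by rewrite opL_Z dcoef_g scale1r ggL.
have H s t v := gr_a1a1 R s t v; have K s t v := gr_a1a2 R s t v.
case: x y => s [] [t []].
- rewrite !Zt !ggL -(linD (lop (inl true) : lin (opL dg))).
  rewrite [X in opL dg X](H s t) (linZ (lop (inl true) : lin (opL dg))).
  rewrite (linB (lop (inl true) : lin (opL dg))) ggL -opL_hX -!opL_M.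
  have dgV : (dg^-1)%g = dg by [].
  have E u : ddeg m omega I (u, true) = (dg * ddeg m omega I (u, false) * dg^-1)%g.
    by rewrite -ddeg_act.
  by rewrite !E !mulgA mulgKV !d1 dgV expgD !mulgA.
- rewrite addrC [LHS](K t s) /Lam /= ddegC d1 d2 -expgD -opL_hX.
  by rewrite eq_sym; case: eqP => [/gsym->|]; rewrite ?mul0r ?scale0r.
- rewrite /Lam /= d1 d2 -expgD opL_hX; exact: K.
- rewrite /Lam /= !d1 -expgD opL_hX; exact: H.
Qed.

(** Conversely, operators for the generators extend to all group elements through
   the normal form h^a g^b, and the uniform relations follow from the defining
   ones by moving powers of h and g across. *)
Lemma gen_rel_uniform : uniform omega I (Lam m I lam gam) opL opZ.
Proof.
split=> [[a b]|x|w|u v w|u x w|x y w]; last exact: opZ_Z.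
- by case: b; rewrite /opL /= => c x y; rewrite ?lop lith.
- exact: lop.
- exact: opL_1.
- exact: opL_M.
- exact: opL_Z.
Qed.

End Converse.
End UniformGen.

(** * The Hopf algebra A_I *)

Section UniformAlgebra.
Variables (k : fieldType) (m : nat) (omega : k) (r : nat).
Variable (I : r.-tuple (nat * nat)).
Local Notation X := ('I_r * bool)%type.
Local Notation G := (dihedral m).
Local Notation c := (dcoef omega I).
Local Notation deg := (ddeg m omega I).

Section Urel.
Variables (Lam : X -> X -> k) (B : lmodType k) (mul : B -> B -> B) (one : B).
Variables (el : G -> B) (ax : X -> B).

(** The same relations for elements of an algebra. The algebra is a parameter, so
   that they can also be stated in its tensor square and in its opposite. *)
Record urel : Prop := Urel {
  ur_1 : el 1%g = one;
  ur_M : forall u v, el (u * v)%g = mul (el u) (el v);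
  ur_LZ : forall u x, mul (el u) (ax x) = c u x *: mul (ax (dact u x)) (el u);
  ur_ZZ : forall x y, mul (ax x) (ax y) + mul (ax y) (ax x) =
     Lam x y *: (one - el (deg x * deg y)%g)
}.

Hypothesis (bm : bilin mul) (mA : associative mul).
Hypothesis (m1l : left_id one mul) (m1r : right_id one mul).

Lemma urel_uniform : urel ->
  uniform omega I Lam (fun u => mul (el u)) (fun x => mul (ax x)).
Proof.
have lm z := bilin_l z bm; have rm z := bilin_r z bm.
case=> e1 eM LZ ZZ; split=> [u|x|w|u v w|u x w|x y w].
- exact: rm.
- exact: rm.
- by rewrite e1 m1l.
- by rewrite eM mA.
- by rewrite mA LZ (linZ (lm w)) mA.
- rewrite !mA -(linD (lm w)) ZZ (linZ (lm w)) (linB (lm w)) m1l.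
  by [].
Qed.

Lemma uniform_urel :
  uniform omega I Lam (fun u => mul (el u)) (fun x => mul (ax x)) -> urel.
Proof.
case=> _ _ e1 eM LZ ZZ; split=> [|u v|u x|x y].
- by rewrite -[LHS]m1r e1.
- by rewrite -[LHS]m1r eM m1r.
- by have := LZ u x one; rewrite !m1r.
- by have := ZZ x y one; rewrite !m1r.
Qed.

End Urel.

Hypothesis (m1 : (1 < m)%N) (om : omega ^+ m = 1).
Hypothesis key : forall s t, omega ^+ (fst_at I s * snd_at I t) = -1.
Variables (Lam : X -> X -> k) (B : lmodType k) (mul : B -> B -> B) (one : B).
Variables (el : G -> B) (ax : X -> B).
Hypothesis (bm : bilin mul) (mA : associative mul).
Hypothesis (m1l : left_id one mul) (m1r : right_id one mul).
Hypothesis rel : urel Lam mul one el ax.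

Lemma urel_degX x y : mul (el (deg x)) (ax y) = - mul (ax y) (el (deg x)).
Proof. by rewrite (ur_LZ rel) dcoef_deg // dact_deg scaleN1r. Qed.

(** In the anticommutator of the coproducts the mixed terms cancel, because the
   degrees anticommute with the generators ([urel_degX]). *)
Lemma urel_comul : urel Lam (tmul mul) (one \ox one) (fun u => el u \ox el u)
  (fun x => ax x \ox one + el (deg x) \ox ax x).
Proof.
have bt := tmul_bilin bm; have tE := tmulE bm; have bT := @tens_bilin k B B.
split=> [|u v|u x|x y].
- by rewrite (ur_1 rel).
- by rewrite tE (ur_M rel).
- rewrite (bilinDr bt) (bilinDl bt) !tE m1l m1r (ur_LZ rel) scalerDr.
  rewrite (bilinZl bT) (bilinZr bT) -(ur_M rel u) -(ur_M rel _ u).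
  by rewrite (ddeg_act I m1 om) -mulgA mulVg mulg1.
have TT a b : tmul mul (ax a \ox one + el (deg a) \ox ax a)
                       (ax b \ox one + el (deg b) \ox ax b) =
  mul (ax a) (ax b) \ox one + mul (ax a) (el (deg b)) \ox ax b +
  (mul (el (deg a)) (ax b) \ox ax a + el (deg a * deg b)%g \ox mul (ax a) (ax b)).
  by rewrite (bilinDr bt) !(bilinDl bt) !tE !(m1l, m1r) (ur_M rel) addrACA.
have sw (M : zmodType) (a a' b b' d d' : M) :
    a + b + (- b' + d) + (a' + b' + (- b + d')) = a + a' + (d + d').
  rewrite addrACA [X in X + _]addrACA [X in _ + X]addrACA -opprD [b' + b]addrC.
  by rewrite addrA addrK.
rewrite !TT (ddegC m omega I y x) !urel_degX !(bilinNl bT) sw.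
rewrite -(bilinDl bT) -(bilinDr bT) (ur_ZZ rel) (bilinZl bT) (bilinZr bT).
by rewrite -scalerDr (bilinBl bT) (bilinBr bT) addrA subrK.
Qed.

(** For g the product of the two degrees, moving a degree past a generator produces
   the sign that turns 1 - g into 1 - g^-1 after multiplication by g^-1. *)
Lemma urel_antipode : urel Lam (fun a b => mul b a) one (fun u => el u^-1%g)
  (fun x => - mul (el (deg x)^-1%g) (ax x)).
Proof.
have E := ur_M rel.
have XL u x : mul (ax x) (el u^-1%g) = c u x *: mul (el u^-1%g) (ax (dact u x)).
  have -> : mul (ax x) (el u^-1%g) =
      mul (el u^-1%g) (mul (mul (el u) (ax x)) (el u^-1%g)).
    by rewrite !mA -E mulVg (ur_1 rel) m1l.
  by rewrite (ur_LZ rel) (bilinZl bm) (bilinZr bm) -mA -E mulgV (ur_1 rel) m1r.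
split=> [|u v|u x|x y].
- by rewrite invg1 (ur_1 rel).
- by rewrite invMg E.
- rewrite (bilinNl bm) (bilinNr bm) scalerN -mA XL (bilinZr bm) !mA -!E.
  by rewrite (ddeg_act I m1 om) !invMg invgK !mulgA mulVg mul1g.
have S a b : mul (- mul (el (deg a)^-1%g) (ax a)) (- mul (el (deg b)^-1%g) (ax b)) =
  - mul (el (deg a * deg b)^-1%g) (mul (ax a) (ax b)).
  rewrite (bilinNl bm) (bilinNr bm) opprK -mA (mA (ax a)) XL dcoef_deg // dact_deg.
  by rewrite scaleN1r (bilinNl bm) (bilinNr bm) -mA mA -E -invMg ddegC.
rewrite !S ddegC -opprD -(bilinDr bm) addrC (ur_ZZ rel) (bilinZr bm).
rewrite (bilinBr bm) m1r -E mulVg (ur_1 rel) -scalerN opprB.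
by rewrite ddegC.
Qed.

End UniformAlgebra.

Section GenElements.
Variables (k : fieldType) (m : nat) (omega : k) (r : nat).
Variable (I : r.-tuple (nat * nat)).
Hypothesis (m1 : (1 < m)%N) (om : omega ^+ m = 1).
Hypothesis pm : forall s, (fst_at I s <= m)%N.
Variables (lam gam : 'I_r -> 'I_r -> k).
Hypothesis gsym : forall s t, snd_at I s = snd_at I t -> gam s t = gam t s.
Variables (B : lmodType k) (mul : B -> B -> B) (one : B) (e : AI_gen r -> B).
Hypothesis (bm : bilin mul) (mA : associative mul).
Hypothesis (m1l : left_id one mul) (m1r : right_id one mul).
Local Notation op := (fun x => mul (e x)).
Hypothesis R : gen_rel m omega I lam gam op.

Definition gen_el (u : dihedral m) : B := opL op u one.

Lemma gen_elE u v : mul (gen_el u) v = opL op u v.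
Proof.
have it n w : mul (iter n (op (inl false)) w) v = iter n (op (inl false)) (mul w v).
  by elim: n => //= n IH; rewrite -mA IH.
by rewrite /gen_el /opL it; congr iter; case: (u.2); rewrite -?mA m1l.
Qed.

Lemma gen_urel :
  urel omega I (Lam m I lam gam) mul one gen_el (fun x => e (inr x)).
Proof.
apply: uniform_urel => //.
have -> : (fun u => mul (gen_el u)) = opL op.
  by apply/funext => u; apply/funext => v; apply: gen_elE.
by apply: (gen_rel_uniform m1 om pm gsym _ R) => x; apply: bilin_r bm.
Qed.

Lemma gen_el_g : gen_el (dih_g m) = e (inl true).
Proof. exact: m1r. Qed.

Lemma gen_el_hX n : gen_el (dih_h m ^+ n)%g = iter n (op (inl false)) one.
Proof. exact: (opL_hX m1 R). Qed.

Lemma gen_el_h : gen_el (dih_h m) = e (inl false).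
Proof. by rewrite -[dih_h m]expg1 gen_el_hX /= m1r. Qed.

End GenElements.

Section Interface.
Variables (k : fieldType) (m : nat) (omega : k) (r : nat).
Variable (I : r.-tuple (nat * nat)).
Local Notation X := ('I_r * bool)%type.
Local Notation G := (dihedral m).
Local Notation V := (MI m omega I).
Local Notation deg := (ddeg m omega I).

(** The common interface of the bosonization and of the algebras A_I; only the
   scalars [Lam] differ. The map [D] plays the role of the projection on degree 1,
   with the group elements sent to 1. *)
Record dalg (Lam : X -> X -> k) (A : hopf k) (el : G -> A) (ax : X -> A)
    (D : A -> {ffun X -> k^o}) : Prop := Dalg {
  da_bialg : is_bialgebra A;
  da_rel : urel omega I Lam (@hmul k A) (hone A) el ax;
  da_ind : forall P : A -> Prop, lin_closed P -> P (hone A) ->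
     (forall u a, P a -> P (hmul (el u) a)) ->
     (forall x a, P a -> P (hmul (ax x) a)) -> forall a, P a;
  da_Del : forall u, hcomul (el u) = el u \ox el u;
  da_Dax : forall x, hcomul (ax x) = ax x \ox hone A + el (deg x) \ox ax x;
  da_eel : forall u, hcounit (el u) = 1;
  da_eax : forall x, hcounit (ax x) = 0;
  da_linD : lin D;
  da_D1 : D (hone A) = 0;
  da_Del1 : forall u a, D (hmul (el u) a) = vact (V := V) u (D a);
  da_Dax1 : forall x a, D (hmul (ax x) a) = hcounit a *: vbase (V := V) x
}.

End Interface.

Section AIHopf.
Variables (k : fieldType) (m : nat) (omega : k) (r : nat).
Variable (I : r.-tuple (nat * nat)).
Local Notation X := ('I_r * bool)%type.
Local Notation G := (dihedral m).
Local Notation V := (MI m omega I).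
Local Notation c := (dcoef omega I).
Local Notation deg := (ddeg m omega I).
Local Notation p := (fst_at I).
Local Notation q := (snd_at I).
Hypothesis (m1 : (1 < m)%N) (om : omega ^+ m = 1).
Hypothesis key : forall s t, omega ^+ (p s * q t) = -1.
Hypothesis pm : forall s, (p s <= m)%N.
Variables (lam gam : 'I_r -> 'I_r -> k).
Hypothesis gsym : forall s t, q s = q t -> gam s t = gam t s.
Local Notation Lam := (Lam m I lam gam).
Local Notation A := (AI m omega I lam gam).
Local Notation ppi := (@ppi k (AI_gen r) (AI_rel m omega I lam gam)
  (AI_comul k m I) (@AI_counit k r)).
Local Notation dg := (dih_g m).
Local Notation dh := (dih_h m).

Let algA : is_algebra A. Proof. exact: presented_algebra. Qed.
Let bm : bilin (@hmul k A). Proof. by case: algA. Qed.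
Let mA : associative (@hmul k A). Proof. by case: algA. Qed.
Let m1l : left_id (hone A) (@hmul k A). Proof. by case: algA. Qed.
Let m1r : right_id (hone A) (@hmul k A). Proof. by case: algA. Qed.
Let lml z : lin (fun x : A => hmul x z). Proof. exact: bilin_l bm. Qed.
Let lmr z : lin (fun x : A => hmul z x). Proof. exact: bilin_r bm. Qed.

Definition AIop (x : AI_gen r) : A -> A := hmul (ppi << fmu x >>).

Lemma AIop_lin x : lin (AIop x). Proof. exact: lmr. Qed.

Lemma AIop_fact u v : fact AIop u v = hmul (ppi u) v.
Proof.
move: u; apply: (free_eq (f := fun u => fact AIop u v) (g := fun u => hmul (ppi u) v)).
- exact: fact_linl.
- exact: lin_comp (@ppi_lin _ _ _ _ _) (lml v).
- by rewrite fact1; apply/esym/m1l.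
move=> x u IH; rewrite [LHS](fact_cons AIop_lin) IH.
by rewrite -[X in _ = hmul X _]ppiM; apply: mA.
Qed.

Lemma AI_gen_rel : gen_rel m omega I lam gam AIop.
Proof.
apply/(gen_relP m omega I lam gam AIop_lin) => x y rxy v.
by rewrite !AIop_fact (ppi_rel _ _ rxy).
Qed.

Definition AIel (u : G) : A :=
  gen_el (@hmul k A) (hone A) (fun x : AI_gen r => ppi << fmu x >>) u.
Definition AIax (x : X) : A := ppi << fmu (inr x : AI_gen r) >>.

Lemma AI_urel : urel omega I Lam (@hmul k A) (hone A) AIel AIax.
Proof. exact: (gen_urel m1 om pm gsym bm mA m1l m1r AI_gen_rel). Qed.

Lemma AIel_g : AIel dg = ppi (gen_g k r).
Proof. by rewrite /AIel gen_el_g. Qed.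

Lemma AIel_hX n : AIel (dh ^+ n)%g = ppi (gen_h k r ^+ n).
Proof.
rewrite /AIel (gen_el_hX m1 _ AI_gen_rel).
rewrite -[RHS]m1r -AIop_fact factX; last exact: AIop_lin.
by rewrite (fact_genE AIop_lin).
Qed.

Lemma AIel_h : AIel dh = ppi (gen_h k r).
Proof. by rewrite /AIel (gen_el_h m1 m1r AI_gen_rel). Qed.

Lemma AI_ind (P : A -> Prop) : lin_closed P -> P (hone A) ->
  (forall u a, P a -> P (hmul (AIel u) a)) ->
  (forall x a, P a -> P (hmul (AIax x) a)) -> forall a, P a.
Proof.
move=> Pl P1 Pe Px; apply: (presented_generated Pl P1) => _ u [[[|]|x] ->] Pu.
- by have := Pe dg u Pu; rewrite AIel_g.
- by have := Pe dh u Pu; rewrite AIel_h.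
- exact: Px.
Qed.

(** The universal property of the presentation, for uniform operators. *)
Section AIAct.
Variables (W : lmodType k) (L : G -> W -> W) (Z : X -> W -> W).
Hypothesis LZ : uniform omega I Lam L Z.

Definition AIact : A -> W -> W := pact (gen_op L Z).

Let lop x : lin (gen_op L Z x).
Proof. by case: x => [[|]|x]; [apply: uni_linL LZ _..|apply: uni_linZ LZ _]. Qed.

Lemma AIact_rel x y : AI_rel m omega I lam gam x y ->
  forall v, fact (gen_op L Z) x v = fact (gen_op L Z) y v.
Proof.
have [h _] := gen_relP m omega I lam gam lop.
exact: h (uniform_gen_rel m1 om pm LZ) x y.
Qed.

Let op_rel := AIact_rel.

Lemma AIact_bilin : bilin AIact.
Proof. exact: pact_bilin. Qed.

Lemma AIactM x y v : AIact (hmul x y) v = AIact x (AIact y v).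
Proof. exact: pactM. Qed.

Lemma AIact1 v : AIact (hone A) v = v.
Proof. exact: pact1. Qed.

Lemma AIact_ax x v : AIact (AIax x) v = Z x v.
Proof. exact: pact_gen. Qed.

Lemma AIact_el u v : AIact (AIel u) v = L u v.
Proof.
have g v' : AIact (AIel dg) v' = L dg v' by rewrite AIel_g; apply: pact_gen.
have h v' : AIact (AIel dh) v' = L dh v' by rewrite AIel_h; apply: pact_gen.
have [e1 eM _ _] := AI_urel; have L1 := uni_1 LZ; have LM := uni_M LZ.
rewrite {1}[u]dihE eM AIactM [in RHS](dihE u) LM.
have -> w : AIact (AIel (dh ^+ u.1)%g) w = L (dh ^+ u.1)%g w.
  elim: (u.1 : nat) => [|n IH]; first by rewrite expg0 e1 AIact1 L1.
  by rewrite expgS eM AIactM IH h LM.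
by case: (u.2); rewrite ?g // e1 AIact1 L1.
Qed.

End AIAct.

End AIHopf.

Section GroupLike.
Variables (k : fieldType) (A : hopf k).
Local Notation h1 := (hone A).
Hypothesis (D1 : hcomul h1 = h1 \ox h1) (e1 : hcounit h1 = 1).
Hypothesis (lD : lin (@hcomul k A)) (le : lin (@hcounit k A : A -> k^o)).
#[local] Hint Resolve lD le : lin.

Lemma grouplike_coassoc (a : A) : hcomul a = a \ox a -> coassoc_at a.
Proof. by move=> Da W F [F1 F2 F3]; rewrite Da !tliftE ?Da ?tliftE //; lin. Qed.

Lemma grouplike_counit (a : A) : hcomul a = a \ox a -> hcounit a = 1 -> counit_at a.
Proof. by move=> Da ea; rewrite /counit_at Da !tliftE ?ea ?scale1r //; lin. Qed.

Lemma skewprim_coassoc (a e : A) : hcomul e = e \ox e ->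
  hcomul a = a \ox h1 + e \ox a -> coassoc_at a.
Proof.
move=> De Da W F [F1 F2 F3].
have T U (f : A -> A -> U : lmodType k) : bilin f ->
    tlift f (a \ox h1 + e \ox a) = f a h1 + f e a.
  by move=> bf; rewrite (linD (tlift_lin bf)) !tliftE.
have T1 U (f : A -> A -> U : lmodType k) : bilin f -> tlift f (h1 \ox h1) = f h1 h1.
  by move=> bf; rewrite tliftE.
have T2 U (f : A -> A -> U : lmodType k) : bilin f -> tlift f (e \ox e) = f e e.
  by move=> bf; rewrite tliftE.
rewrite Da !T; try by lin.
by rewrite Da De D1 !T ?T1 ?T2 ?addrA //; lin.
Qed.

Lemma skewprim_counit (a e : A) : hcounit e = 1 -> hcounit a = 0 ->
  hcomul a = a \ox h1 + e \ox a -> counit_at a.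
Proof.
move=> ee ea Da.
have T U (f : A -> A -> U : lmodType k) : bilin f ->
    tlift f (a \ox h1 + e \ox a) = f a h1 + f e a.
  by move=> bf; rewrite (linD (tlift_lin bf)) !tliftE.
rewrite /counit_at Da !T; try by lin.
by rewrite ea ee e1 !scale1r !scale0r addr0 add0r.
Qed.

Hypothesis algA : is_algebra A.
Variable S : A -> A.
Hypothesis (lS : lin S) (S1 : S h1 = h1).

Lemma grouplike_antipode (a b : A) : hcomul a = a \ox a -> hcounit a = 1 ->
  S a = b -> hmul a b = h1 -> hmul b a = h1 -> antipode_at S a.
Proof.
have [bm _ _ _] := algA.
by move=> Da ea Sa ab ba; rewrite /antipode_at Da !tliftE ?Sa ?ab ?ba ?ea ?scale1r //; lin.
Qed.

Lemma skewprim_antipode (a e e' : A) : hcomul a = a \ox h1 + e \ox a ->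
  hcounit a = 0 -> S e = e' -> hmul e e' = h1 ->
  S a = - hmul e' a -> antipode_at S a.
Proof.
have [bm mA m1 m1r] := algA.
move=> Da ea Se ee' Sa.
have T U (f : A -> A -> U : lmodType k) : bilin f ->
    tlift f (a \ox h1 + e \ox a) = f a h1 + f e a.
  by move=> bf; rewrite (linD (tlift_lin bf)) !tliftE.
rewrite /antipode_at Da !T; try by lin.
rewrite Sa Se S1 ea scale0r (bilinNr bm) m1r mA ee' m1 m1r subrr.
by rewrite addNr.
Qed.

End GroupLike.

Section AIHopf.
Variables (k : fieldType) (m : nat) (omega : k) (r : nat).
Variable (I : r.-tuple (nat * nat)).
Local Notation X := ('I_r * bool)%type.
Local Notation G := (dihedral m).
Local Notation V := (MI m omega I).
Local Notation c := (dcoef omega I).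
Local Notation deg := (ddeg m omega I).
Local Notation p := (fst_at I).
Local Notation q := (snd_at I).
Hypothesis (m1 : (1 < m)%N) (om : omega ^+ m = 1).
Hypothesis key : forall s t, omega ^+ (p s * q t) = -1.
Hypothesis pm : forall s, (p s <= m)%N.
Variables (lam gam : 'I_r -> 'I_r -> k).
Hypothesis gsym : forall s t, q s = q t -> gam s t = gam t s.
Local Notation Lam := (Lam m I lam gam).
Local Notation A := (AI m omega I lam gam).
Local Notation rel := (AI_rel m omega I lam gam).
Local Notation ppi := (@ppi k (AI_gen r) (AI_rel m omega I lam gam)
  (AI_comul k m I) (@AI_counit k r)).
Local Notation dg := (dih_g m).
Local Notation dh := (dih_h m).

Let algA : is_algebra A. Proof. exact: presented_algebra. Qed.
Let bm : bilin (@hmul k A). Proof. by case: algA. Qed.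
Let mA : associative (@hmul k A). Proof. by case: algA. Qed.
Let m1l : left_id (hone A) (@hmul k A). Proof. by case: algA. Qed.
Let m1r : right_id (hone A) (@hmul k A). Proof. by case: algA. Qed.
Let bt : bilin (tmul (@hmul k A)). Proof. exact: tmul_bilin. Qed.
Local Notation el := (@AIel k m omega r I lam gam).
Local Notation ax := (@AIax k m omega r I lam gam).
Let Arel := AI_urel m1 om pm lam gsym.
Local Notation act := (@AIact k m omega r I lam gam _).

Let LD (u : G) := tmul (@hmul k A) (el u \ox el u).
Let ZD (x : X) := tmul (@hmul k A) (ax x \ox hone A + el (deg x) \ox ax x).

Let uniD : uniform omega I Lam LD ZD.
Proof.
have rD := urel_comul m1 om key bm m1l m1r Arel.
exact: (urel_uniform (tmul_bilin bm) (tmulA bm mA) (tmul1 bm m1l) rD).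
Qed.

Let gcomul_op :
  (fun a => tmul (@hmul k A) (gcomul rel (AI_comul k m I) (@AI_counit k r) a)) =
  gen_op LD ZD.
Proof.
have lp := @ppi_lin k (AI_gen r) rel (AI_comul k m I) (@AI_counit k r).
have lt := tmap_lin lp lp.
have Eg : gcomul rel (AI_comul k m I) (@AI_counit k r) (inl true) = el dg \ox el dg.
  by rewrite (AIel_g m omega I lam gam); apply: (tmapE _ _ lp lp).
have Eh : gcomul rel (AI_comul k m I) (@AI_counit k r) (inl false) = el dh \ox el dh.
  by rewrite (AIel_h omega I m1 lam gam); apply: (tmapE _ _ lp lp).
have Ex x : gcomul rel (AI_comul k m I) (@AI_counit k r) (inr x) =
    ax x \ox hone A + el (deg x) \ox ax x.
  case: x => s b; rewrite ddegE // (AIel_hX omega I m1).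
  by case: b; apply: etrans (linD lt _ _) _; apply: congr2 (tmapE _ _ lp lp) (tmapE _ _ lp lp).
by apply/funext => -[[|]|x]; rewrite (Eg, Eh, Ex).
Qed.

Let LE (u : G) (w : k^o) := w.
Let ZE (x : X) (w : k^o) : k^o := 0.

Let uniE : uniform omega I Lam LE ZE.
Proof.
split=> // [x|u x w|x y w]; first exact: lin_zero.
  by rewrite /LE /ZE scaler0.
by rewrite /LE /ZE subrr scaler0 addr0.
Qed.

Let counit_op : (fun x (c : k^o) => @AI_counit k r x *: c) = gen_op LE ZE.
Proof.
by apply/funext => -[[]|x]; apply/funext => w /=; rewrite ?scale1r ?scale0r.
Qed.

Let comul_rel x y : rel x y -> forall t : tensor A A,
  fact (fun a => tmul (@hmul k A) (gcomul rel (AI_comul k m I) (@AI_counit k r) a)) x t =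
  fact (fun a => tmul (@hmul k A) (gcomul rel (AI_comul k m I) (@AI_counit k r) a)) y t.
Proof.
by rewrite gcomul_op; apply: (AIact_rel m1 om pm uniD).
Qed.

Let counit_rel x y : rel x y -> forall c : k^o,
  fact (fun x (c : k^o) => @AI_counit k r x *: c) x c =
  fact (fun x (c : k^o) => @AI_counit k r x *: c) y c.
Proof.
by rewrite counit_op; apply: (AIact_rel m1 om pm uniE).
Qed.

Let comulE (x : A) : hcomul x = AIact LD ZD x (hone A \ox hone A).
Proof. by rewrite /AIact -gcomul_op; apply: pcomulE. Qed.

Let counitE (x : A) : hcounit x = AIact LE ZE x 1.
Proof. by rewrite /AIact -counit_op; apply: pcounitE. Qed.

Lemma AI_Del u : hcomul (el u) = el u \ox el u.
Proof.
rewrite comulE (AIact_el m1 om pm gsym uniD) /LD (tmulE bm) m1r.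
by [].
Qed.

Lemma AI_Dax x : hcomul (ax x) = ax x \ox hone A + el (deg x) \ox ax x.
Proof. by rewrite comulE (AIact_ax m1 om pm uniD) /ZD (tmulr1 bm m1r). Qed.

Lemma AI_eel u : hcounit (el u) = 1.
Proof. by rewrite counitE (AIact_el m1 om pm gsym uniE). Qed.

Lemma AI_eax x : hcounit (ax x) = 0.
Proof. by rewrite counitE (AIact_ax m1 om pm uniE). Qed.

Let D1 : hcomul (hone A) = hone A \ox hone A.
Proof. exact: pcomul1. Qed.
Let e1 : hcounit (hone A) = 1. Proof. exact: pcounit1. Qed.
Let lD : lin (@hcomul k A). Proof. exact: pcomul_lin comul_rel. Qed.
Let le : lin (@hcounit k A : A -> k^o). Proof. exact: pcounit_lin counit_rel. Qed.

Let gens (P : A -> Prop) : (forall u, P (el u)) -> (forall x, P (ax x)) ->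
  forall a : AI_gen r, P (ppi << fmu a >>).
Proof.
move=> Pe Px [[|]|x]; last exact: Px.
  by have := Pe dg; rewrite AIel_g.
by have := Pe dh; rewrite AIel_h.
Qed.

(** The coproduct and the counit are well defined because the elements
   el u \ox el u and ax x \ox 1 + el (deg x) \ox ax x satisfy the relations
   ([urel_comul]); the coalgebra axioms hold on group-like and on skew-primitive
   generators. *)
Lemma AI_bialgebra : is_bialgebra A.
Proof.
apply: (presented_bialgebra comul_rel counit_rel); apply: gens.
- by move=> u; apply: grouplike_coassoc (AI_Del u).
- by move=> x; apply: skewprim_coassoc (AI_Del _) (AI_Dax x).
- by move=> u; apply: grouplike_counit (AI_Del u) (AI_eel u).
- by move=> x; apply: skewprim_counit (AI_eel _) (AI_eax x) (AI_Dax x).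
Qed.

Let mop : A -> A -> A := fun a b => hmul b a.
Let LS (u : G) := mop (el u^-1%g).
Let ZS (x : X) := mop (- hmul (el (deg x)^-1%g) (ax x)).

Let bmop : bilin mop.
Proof. by apply: bilinI => y; [apply: bilin_r bm | apply: bilin_l bm]. Qed.

Let uniS : uniform omega I Lam LS ZS.
Proof.
apply: (urel_uniform bmop (one := hone A)) => [x y z|x|].
- exact/esym/mA.
- exact: m1r.
- exact: (urel_antipode m1 om key bm mA m1l m1r Arel).
Qed.

Definition AI_S (a : AI_gen r) : A :=
  match a with
  | inl true => el dg^-1%g
  | inl false => el dh^-1%g
  | inr x => - hmul (el (deg x)^-1%g) (ax x)
  end.

Let S_op : (fun x v => hmul v (AI_S x)) = gen_op LS ZS.
Proof. by apply/funext => -[[]|x]. Qed.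

Let S_rel x y : rel x y -> forall v : A,
  fact (fun x v => hmul v (AI_S x)) x v = fact (fun x v => hmul v (AI_S x)) y v.
Proof.
by rewrite S_op; apply: (AIact_rel m1 om pm uniS).
Qed.

Lemma AI_hopf : is_hopf A.
Proof.
have SE (a : A) : pantipode AI_S a = AIact LS ZS a (hone A).
  by rewrite /AIact -S_op.
have Sel u : pantipode AI_S (el u) = el u^-1%g.
  by rewrite SE (AIact_el m1 om pm gsym uniS); apply: m1l.
have Sax x : pantipode AI_S (ax x) = - hmul (el (deg x)^-1%g) (ax x).
  by rewrite SE (AIact_ax m1 om pm uniS); apply: m1l.
have S1 : pantipode AI_S (hone A) = hone A.
  by rewrite SE (AIact1 m1 om pm uniS).
have lS : lin (pantipode AI_S : A -> A).
  by move=> a x y; rewrite !SE; apply: (AIact_bilin m1 om pm uniS).1.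
have [a1 aM _ _] := Arel.
have eV u : hmul (el u) (el u^-1%g) = hone A by rewrite -aM mulgV.
have Ve u : hmul (el u^-1%g) (el u) = hone A by rewrite -aM mulVg.
apply: (presented_hopf comul_rel counit_rel S_rel AI_bialgebra); apply: gens.
- move=> u; apply: grouplike_antipode (AI_Del u) (AI_eel u) (Sel u) (eV u) (Ve u) => //.
- by move=> x; apply: skewprim_antipode (AI_Dax x) (AI_eax x) (Sel _) (eV _) (Sax x).
Qed.

Local Notation vect := {ffun X -> k^o}.
Let LV (u : G) (w : (k^o * vect)%type) := (w.1, vact (V := V) u w.2).
Let ZV (x : X) (w : (k^o * vect)%type) : (k^o * vect)%type :=
  (0, w.1 *: vbase (V := V) x).

Lemma vact_lin u : lin (vact (V := V) u).
Proof.
move=> a v w; rewrite /vact scaler_sumr -big_split; apply: eq_bigr => x _ /=.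
by rewrite !ffunE scalerDl scalerA.
Qed.

Lemma vact_base u x : vact (V := V) u (vbase x) = c u x *: vbase (V := V) (dact u x).
Proof.
rewrite /vact (bigD1 x) //= big1 ?addr0 => [|y yx].
  by rewrite ffunE eqxx scale1r MI_actE.
by rewrite ffunE (negbTE yx) scale0r.
Qed.

Lemma vbase_sum (v : vect) : v = \sum_x v x *: vbase (V := V) x.
Proof.
apply/ffunP => z; rewrite sum_ffunE (bigD1 z) //= big1 => [|x xz].
  by rewrite addr0 !ffunE eqxx /GRing.scale /= mulr1.
by rewrite !ffunE eq_sym (negbTE xz) /GRing.scale /= mulr0.
Qed.

Lemma vact_deg y v : vact (V := V) (deg y) v = - v.
Proof.
have E x : ydact (y := V) (deg y) x = - vbase (V := V) x.
  by rewrite [LHS]MI_actE dcoef_deg // dact_deg scaleN1r.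
rewrite /vact; under eq_bigr do rewrite E scalerN.
rewrite sumrN -vbase_sum; first by [].
Qed.

Let uniV : uniform omega I Lam LV ZV.
Proof.
have [v1 vM _] := MI_ydmod I m1 om.
split=> [u|x|[a v]|u w [a v]|u x [a v]|x y [a v]].
- by move=> b [a v] [a' v']; congr (_, _); apply: vact_lin.
- by move=> b [a v] [a' v']; congr (_, _); rewrite /= ?scaler0 ?addr0 // scalerDl scalerA.
- by rewrite /LV v1.
- by rewrite /LV vM.
- rewrite /LV /ZV /= (linZ (vact_lin u)) vact_base; congr (_, _).
    by rewrite /= scaler0.
  by rewrite /= !scalerA mulrC.
- rewrite /LV /ZV /= !vM !vact_deg opprK; congr (_, _) => /=.
    by rewrite subrr scaler0 addr0.
  by rewrite !scale0r subrr scaler0 addr0.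
Qed.

(** The component of degree 1 comes from the extension of V by the trivial module
   in which the generator x maps 1 to the basis vector x. *)
Definition AI_D (a : A) : vect := (AIact LV ZV a (1, 0)).2.

Lemma AI_D1 (a : A) : (AIact LV ZV a (1, 0)).1 = hcounit a.
Proof.
have bV := AIact_bilin m1 om pm uniV; have e0 := lin0 le.
have eM := pcounitM counit_rel.
move: a; apply: (AI_ind m1 (P := fun a => (AIact LV ZV a (1, 0)).1 = hcounit a)) => //.
- split=> [|a x y IHx IHy]; first by rewrite (bilin0l bV) e0.
  by rewrite (bV.1 a x y) le -IHx -IHy.
- by rewrite (AIact1 m1 om pm uniV) e1.
- move=> u a IH; rewrite (AIactM m1 om pm uniV) (AIact_el m1 om pm gsym uniV).
  by rewrite eM AI_eel mul1r -IH.
- move=> x a IH; rewrite (AIactM m1 om pm uniV) (AIact_ax m1 om pm uniV).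
  by rewrite eM AI_eax mul0r.
Qed.

Lemma AI_dalg : dalg omega I Lam el ax AI_D.
Proof.
have bV := AIact_bilin m1 om pm uniV.
split.
- exact: AI_bialgebra.
- exact: Arel.
- by move=> P; apply: (AI_ind m1).
- exact: AI_Del.
- exact: AI_Dax.
- exact: AI_eel.
- exact: AI_eax.
- by move=> a x y; rewrite /AI_D (bV.1 a x y).
- by rewrite /AI_D (AIact1 m1 om pm uniV).
- by move=> u a; rewrite /AI_D (AIactM m1 om pm uniV) (AIact_el m1 om pm gsym uniV).
- move=> x a; rewrite /AI_D (AIactM m1 om pm uniV) (AIact_ax m1 om pm uniV).
  by rewrite /ZV -AI_D1.
Qed.

End AIHopf.

(** * Contractions by an invariant form *)

Section ZmodIdentities.
Variable M : zmodType.
Implicit Types (a b c d e p q t u : M).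

Lemma zmod_cancel_cross p q t u : p + (t - q) + (q + (u - p)) = t + u.
Proof. by rewrite [p + (t - q)]addrA subrKA [LHS]addrC subrKA addrC. Qed.

Lemma zmod_anticomm a b c d e p q u :
  q + u = 0 -> a + b + (e - c + q) + (d + c + (p - b + u)) = a + d + (e + p).
Proof.
move=> qu; rewrite addrACA [X in X + _]addrACA [X in _ + X]addrACA qu addr0.
by rewrite [X in _ + X]addrACA -opprD [c + b]addrC addrACA subrr addr0.
Qed.

End ZmodIdentities.

Section Contraction.
Variables (k : fieldType) (m : nat) (omega : k) (r : nat).
Variable (I : r.-tuple (nat * nat)).
Local Notation X := ('I_r * bool)%type.
Local Notation G := (dihedral m).
Local Notation V := (MI m omega I).
Local Notation vect := {ffun X -> k^o}.
Local Notation c := (dcoef omega I).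
Local Notation deg := (ddeg m omega I).
Local Notation vb := (vbase (V := V)).
Local Notation va := (vact (V := V)).
Hypothesis (m1 : (1 < m)%N) (om : omega ^+ m = 1).
Hypothesis key : forall s t, omega ^+ (fst_at I s * snd_at I t) = -1.
Variables (Lam : X -> X -> k) (A : hopf k) (el : G -> A) (ax : X -> A).
Variable (D : A -> vect).
Hypothesis dA : dalg omega I Lam el ax D.
Local Notation Delta := (@hcomul k A).
Local Notation eps := (@hcounit k A).
Local Notation "x ** y" := (@hmul k A x y) (at level 40, left associativity).
Local Notation h1 := (hone A).

Let bA : is_bialgebra A := da_bialg dA.
Let bm := hmul_bilin bA.
Let lml y : lin (fun x => x ** y). Proof. exact: hmul_linl. Qed.
Let lmr x : lin (fun y => x ** y). Proof. exact: hmul_linr. Qed.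
Let lD : lin Delta. Proof. exact: hcomul_lin. Qed.
Let le : lin (eps : A -> k^o). Proof. exact: hcounit_lin. Qed.
Let lDD : lin D := da_linD dA.
Let lva u : lin (va u). Proof. exact: vact_lin. Qed.
Let mA := hmulA bA.
#[local] Hint Resolve lml lmr lD le lDD lva : lin.

Lemma swL W (F : A -> A -> W : lmodType k) u a : bilin F ->
  tlift F (Delta (el u ** a)) = \tsum_(a1, a2 <- Delta a) F (el u ** a1) (el u ** a2).
Proof.
move=> bF; rewrite tlift_comulM // (da_Del dA) tliftE //; lin.
Qed.

Lemma swX W (F : A -> A -> W : lmodType k) x a : bilin F ->
  tlift F (Delta (ax x ** a)) = \tsum_(a1, a2 <- Delta a) F (ax x ** a1) a2 +
    \tsum_(a1, a2 <- Delta a) F (el (deg x) ** a1) (ax x ** a2).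
Proof.
move=> bF; rewrite tlift_comulM // (da_Dax dA).
set H := fun a1 b1 => tlift _ _; have bH : bilin H by rewrite /H; lin.
rewrite (linD (tlift_lin bH)) !tliftE // /H; congr (_ + _).
by apply: eq_tlift => a1 a2; rewrite hmul1.
Qed.

Lemma sw1 W (F : A -> A -> W : lmodType k) : bilin F -> tlift F (Delta h1) = F h1 h1.
Proof. by move=> bF; rewrite hcomul1 // tliftE. Qed.

Lemma D_deg y a : D (el (deg y) ** a) = - D a.
Proof. by rewrite (da_Del1 dA) vact_deg. Qed.

Lemma LX u x a : el u ** (ax x ** a) = c u x *: (ax (dact u x) ** (el u ** a)).
Proof. by rewrite mA (ur_LZ (da_rel dA)) (bilinZl bm) mA. Qed.

Lemma LM u v a : el (u * v)%g ** a = el u ** (el v ** a).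
Proof. by rewrite (ur_M (da_rel dA)) mA. Qed.

Lemma L1 a : el 1%g ** a = a.
Proof. by rewrite (ur_1 (da_rel dA)) hmul1. Qed.

Lemma degX y x a : el (deg y) ** (ax x ** a) = - (ax x ** (el (deg y) ** a)).
Proof. by rewrite LX dcoef_deg // dact_deg scaleN1r. Qed.

Lemma XX x y a : ax x ** (ax y ** a) + ax y ** (ax x ** a) =
  Lam x y *: (a - el (deg x * deg y)%g ** a).
Proof.
by rewrite !mA -(bilinDl bm) (ur_ZZ (da_rel dA)) (bilinZl bm) (bilinBl bm) hmul1.
Qed.

Variable eta : vect -> vect -> k^o.
Hypothesis be : bilin eta.
Hypothesis einv : forall u v w, eta (va u v) (va u w) = eta v w.

(** Contraction of the first and of the last tensor factor of the coproduct
   against v. The combinations [Kop] and [Zop] below are shaped so that [Zop x]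
   will be left multiplication by the generator x after deformation: the left
   contraction comes from the cocycle, the right one from its inverse. *)
Definition Il (v : vect) (a : A) : A := \tsum_(a1, a2 <- Delta a) (eta v (D a1) *: a2).
Definition Ir (v : vect) (a : A) : A := \tsum_(a1, a2 <- Delta a) (eta v (D a2) *: a1).
Definition Jr (x : X) (a : A) : A := el (deg x) ** Ir (vb x) a.
Definition Kop (x : X) (a : A) : A := Il (vb x) a - Jr x a.
Definition Zop (x : X) (a : A) : A := ax x ** a + Kop x a.

Let bil_l v : bilin (fun a1 a2 : A => eta v (D a1) *: a2). Proof. by lin. Qed.
Let bil_r v : bilin (fun a1 a2 : A => eta v (D a2) *: a1). Proof. by lin. Qed.

Lemma Il_lin v : lin (Il v).
Proof. by rewrite /Il; lin. Qed.
Lemma Ir_lin v : lin (Ir v).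
Proof. by rewrite /Ir; lin. Qed.
Lemma Il_linv a : lin (Il^~ a).
Proof. by rewrite /Il; lin. Qed.
Lemma Ir_linv a : lin (Ir^~ a).
Proof. by rewrite /Ir; lin. Qed.
#[local] Hint Resolve Il_lin Ir_lin Il_linv Ir_linv : lin.
Lemma Jr_lin x : lin (Jr x).
Proof. by rewrite /Jr; lin. Qed.
#[local] Hint Resolve Jr_lin : lin.
Lemma Kop_lin x : lin (Kop x).
Proof. by rewrite /Kop; lin. Qed.
#[local] Hint Resolve Kop_lin : lin.
Lemma Zop_lin x : lin (Zop x).
Proof. by rewrite /Zop; lin. Qed.

Lemma Il_1 v : Il v h1 = 0.
Proof. by rewrite /Il sw1 // (da_D1 dA) (bilin0r be) scale0r. Qed.

Lemma Ir_1 v : Ir v h1 = 0.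
Proof. by rewrite /Ir sw1 // (da_D1 dA) (bilin0r be) scale0r. Qed.

Lemma Il_L v u a : el u ** Il v a = Il (va u v) (el u ** a).
Proof.
rewrite /Il swL // (tlift_comp _ _ (lmr _)); apply: eq_tlift => a1 a2.
by rewrite (da_Del1 dA) einv (bilinZr bm).
Qed.

Lemma Ir_L v u a : el u ** Ir v a = Ir (va u v) (el u ** a).
Proof.
rewrite /Ir swL // (tlift_comp _ _ (lmr _)); apply: eq_tlift => a1 a2.
by rewrite (da_Del1 dA) einv (bilinZr bm).
Qed.

(** A left contraction is a skew derivation: the sign arises because the degree
   of y acts by -1 on V. *)
Lemma Il_X v y a : Il v (ax y ** a) = eta v (vb y) *: a - ax y ** Il v a.
Proof.
rewrite /Il swX //; congr (_ + _).
  rewrite -[RHS](hcounitl bA (f := fun a => eta v (vb y) *: a)); last by lin.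
  by apply: eq_tlift => a1 a2; rewrite (da_Dax1 dA) (bilinZr be) scalerA.
rewrite (tlift_comp _ _ (lmr _)) -tliftNf; apply: eq_tlift => a1 a2.
by rewrite D_deg (bilinNr be) (bilinZr bm) scaleNr.
Qed.

Lemma Ir_X v y a : Ir v (ax y ** a) = ax y ** Ir v a + eta v (vb y) *: (el (deg y) ** a).
Proof.
rewrite /Ir swX //; congr (_ + _).
  by rewrite (tlift_comp _ _ (lmr _)); apply: eq_tlift => a1 a2; rewrite (bilinZr bm).
rewrite -[RHS](hcounitr bA (f := fun a => eta v (vb y) *: (el (deg y) ** a))).
  by apply: eq_tlift => a1 a2; rewrite (da_Dax1 dA) (bilinZr be) scalerA.
by lin.
Qed.

Lemma sw_Il W (F : A -> A -> W : lmodType k) v a : bilin F ->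
  tlift F (Delta (Il v a)) = \tsum_(a1, a2 <- Delta a) F (Il v a1) a2.
Proof.
move=> bF; pose H a b1 b2 := eta v (D a) *: F b1 b2.
transitivity (\tsum_(a, b <- Delta a) \tsum_(b1, b2 <- Delta b) H a b1 b2).
  rewrite /Il (tlift_comp _ _ (lin_comp lD (tlift_lin bF))); apply: eq_tlift => a1 a2.
  by rewrite (linZ lD) (linZ (tlift_lin bF)) tliftZf.
rewrite -hcoassoc //; last by rewrite /H; split=> *; lin.
apply: eq_tlift => a1 a2; rewrite /Il (tlift_comp _ _ (bilin_l a2 bF)).
by apply: eq_tlift => b1 b2; rewrite (bilinZl bF).
Qed.

Lemma sw_Ir W (F : A -> A -> W : lmodType k) v a : bilin F ->
  tlift F (Delta (Ir v a)) = \tsum_(a1, a2 <- Delta a) F a1 (Ir v a2).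
Proof.
move=> bF; pose H a b1 b2 := eta v (D b2) *: F a b1.
transitivity (\tsum_(a, b <- Delta a) \tsum_(a1, a2 <- Delta a) H a1 a2 b).
  rewrite /Ir (tlift_comp _ _ (lin_comp lD (tlift_lin bF))); apply: eq_tlift => a1 a2.
  by rewrite (linZ lD) (linZ (tlift_lin bF)) tliftZf.
rewrite hcoassoc //; last by rewrite /H; split=> *; lin.
apply: eq_tlift => a1 a2; rewrite /Ir (tlift_comp _ _ (bilin_r a1 bF)).
by apply: eq_tlift => b1 b2; rewrite (bilinZr bF).
Qed.

(** Coassociativity: the middle factor of an iterated coproduct can be contracted
   from either side. *)
Lemma sw_slide W (F : A -> A -> W : lmodType k) v a : bilin F ->
  \tsum_(a1, a2 <- Delta a) F (Ir v a1) a2 = \tsum_(a1, a2 <- Delta a) F a1 (Il v a2).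
Proof.
move=> bF; pose H a b1 b2 := eta v (D b1) *: F a b2.
transitivity (\tsum_(a, b <- Delta a) \tsum_(a1, a2 <- Delta a) H a1 a2 b).
  apply: eq_tlift => a1 a2; rewrite /Ir (tlift_comp _ _ (bilin_l a2 bF)).
  by apply: eq_tlift => b1 b2; rewrite (bilinZl bF).
rewrite hcoassoc //; last by rewrite /H; split=> *; lin.
apply: eq_tlift => a1 a2; rewrite /Il (tlift_comp _ _ (bilin_r a1 bF)).
by apply: eq_tlift => b1 b2; rewrite (bilinZr bF).
Qed.

Lemma eps_Il v a : eps (Il v a) = eta v (D a).
Proof.
rewrite /Il (tlift_comp _ _ le) -[RHS](hcounitr bA (f := fun a => eta v (D a))).
  apply: (@eq_tlift k A A k^o) => a1 a2.
  by rewrite (linZ le) /GRing.scale /= mulrC.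
by lin.
Qed.

Lemma eps_Ir v a : eps (Ir v a) = eta v (D a).
Proof.
rewrite /Ir (tlift_comp _ _ le) -[RHS](hcounitl bA (f := fun a => eta v (D a))).
  apply: (@eq_tlift k A A k^o) => a1 a2.
  by rewrite (linZ le) /GRing.scale /= mulrC.
by lin.
Qed.

Lemma Il_Ir v w a : Il v (Ir w a) = Ir w (Il v a).
Proof.
rewrite {1}/Il sw_Ir // [in RHS]/Il (tlift_comp _ _ (Ir_lin w)).
by apply: eq_tlift => a1 a2; rewrite (linZ (Ir_lin w)).
Qed.

Lemma vaK u v : va u (va u^-1%g v) = v.
Proof.
by have [v1 vM _] := MI_ydmod I m1 om; rewrite -vM mulgV v1.
Qed.

Lemma Il_Nv v a : Il (- v) a = - Il v a.
Proof. exact: linN (Il_linv a) v. Qed.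

Lemma Ir_Nv v a : Ir (- v) a = - Ir v a.
Proof. exact: linN (Ir_linv a) v. Qed.

Lemma Il_deg v y a : Il v (el (deg y) ** a) = - (el (deg y) ** Il v a).
Proof. by rewrite Il_L vact_deg // Il_Nv opprK. Qed.

Lemma Ir_deg v y a : Ir v (el (deg y) ** a) = - (el (deg y) ** Ir v a).
Proof. by rewrite Ir_L vact_deg // Ir_Nv opprK. Qed.

(** Contractions on the same side anticommute, like the derivations of an
   exterior algebra. *)
Lemma Il_Il v w a : Il v (Il w a) + Il w (Il v a) = 0.
Proof.
have lI v' := Il_lin v'.
move: a v w; apply: (da_ind dA (P := fun a => forall v w, Il v (Il w a) + Il w (Il v a) = 0)).
- split=> [v w|b x y IHx IHy v w]; first by rewrite !(lin0 (lI _)) addr0.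
  by rewrite !(lI _ b) addrACA -scalerDr IHx IHy scaler0 addr0.
- by move=> v w; rewrite !Il_1 !(lin0 (lI _)) addr0.
- move=> u a IH v w; rewrite -(vaK u v) -(vaK u w) -!Il_L.
  by rewrite -(bilinDr bm) IH (bilin0r bm).
- move=> x a IH v w; rewrite !Il_X !(linB (lI _)) !(linZ (lI _)) !Il_X !opprB.
  by rewrite zmod_cancel_cross -(bilinDr bm) IH (bilin0r bm).
Qed.

Lemma Ir_Ir v w a : Ir v (Ir w a) + Ir w (Ir v a) = 0.
Proof.
have lI v' := Ir_lin v'.
move: a v w; apply: (da_ind dA (P := fun a => forall v w, Ir v (Ir w a) + Ir w (Ir v a) = 0)).
- split=> [v w|b x y IHx IHy v w]; first by rewrite !(lin0 (lI _)) addr0.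
  by rewrite !(lI _ b) addrACA -scalerDr IHx IHy scaler0 addr0.
- by move=> v w; rewrite !Ir_1 !(lin0 (lI _)) addr0.
- move=> u a IH v w; rewrite -(vaK u v) -(vaK u w) -!Ir_L.
  by rewrite -(bilinDr bm) IH (bilin0r bm).
- move=> x a IH v w; rewrite !Ir_X !(linD (lI _)) !(linZ (lI _)) !Ir_X !Ir_deg.
  rewrite !scalerN addrACA [X in X + _]addrACA -opprD [X in - X]addrC addrK.
  by rewrite -(bilinDr bm) IH (bilin0r bm).
Qed.

Lemma Jr_X x y a : Jr x (ax y ** a) =
  eta (vb x) (vb y) *: (el (deg x * deg y)%g ** a) - ax y ** Jr x a.
Proof.
rewrite /Jr Ir_X (bilinDr bm) (bilinZr bm) degX -LM addrC.
by [].
Qed.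

Lemma Kop_X x y a : Kop x (ax y ** a) =
  eta (vb x) (vb y) *: (a - el (deg x * deg y)%g ** a) - ax y ** Kop x a.
Proof.
rewrite /Kop Il_X Jr_X scalerBr (bilinBr bm) !opprB addrACA [RHS]addrACA.
by congr (_ + _); apply: addrC.
Qed.

Lemma Kop_L u x a : el u ** Kop x a = c u x *: Kop (dact u x) (el u ** a).
Proof.
rewrite /Kop /Jr (bilinBr bm) Il_L vact_base scalerBr; congr (_ - _).
  exact: linZ (Il_linv _) _ _.
rewrite -LM (ddeg_act I m1 om) -[RHS](bilinZr bm) -[c u x *: _](linZ (Ir_linv _)).
by rewrite -vact_base -Ir_L -LM -mulgA mulVg mulg1 LM.
Qed.

Lemma Kop_K x y a : Kop x (Kop y a) + Kop y (Kop x a) = 0.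
Proof.
have lI v := Il_lin v; have lJ z := Jr_lin z.
have IJ z w : Jr z (Il (vb w) a) = - Il (vb w) (Jr z a).
  by rewrite /Jr Il_deg opprK Il_Ir.
have JJ : Jr x (Jr y a) + Jr y (Jr x a) = 0.
  rewrite /Jr !Ir_deg !(bilinNr bm) -!LM (ddegC m omega I y x) -opprD.
  by rewrite -(bilinDr bm) Ir_Ir (bilin0r bm) oppr0.
have KK z w : Kop (z : X) (Kop w a) =
    (Il (vb z) (Il (vb w) a) + Jr z (Jr w a)) +
    (Il (vb w) (Jr z a) - Il (vb z) (Jr w a)).
  rewrite /Kop (linB (lI _)) (linB (lJ _)) IJ opprD !opprK.
  by rewrite [X in _ + X]addrC addrACA [X in _ + X]addrC.
rewrite !KK addrACA [X in X + _]addrACA Il_Il JJ addr0 add0r.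
by rewrite addrA subrK subrr.
Qed.

(** The operators [Kop] anticommute with each other ([Kop_K]), and each has a
   scalar anticommutator with the left multiplications, up to a group element
   ([Kop_X]); this adds the symmetrization of the form to the relations. *)
Lemma Zop_uniform : uniform omega I
  (fun x y => Lam x y + (eta (vb x) (vb y) + eta (vb y) (vb x)))
  (fun u a => el u ** a) Zop.
Proof.
split=> [u|x|a|u v a|u x a|x y a].
- exact: lmr.
- exact: Zop_lin.
- exact: L1.
- exact: LM.
- by rewrite /Zop (bilinDr bm) LX Kop_L -scalerDr.
rewrite /Zop (bilinDr bm (ax x) _ (Kop y a)) (bilinDr bm (ax y) _ (Kop x a)).
rewrite (linD (Kop_lin x) _ (Kop y a)) (linD (Kop_lin y) _ (Kop x a)) !Kop_X.
rewrite (ddegC m omega I y x) (zmod_anticomm _ _ _ _ _ _ (Kop_K x y a)) XX.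
by rewrite -!scalerDl.
Qed.

(** [Zop x] has the coproduct of a skew-primitive element: the contractions of the
   middle factor, one from [Il] and one from [Ir], cancel by [sw_slide]. *)
Lemma sw_Zop W (F : A -> A -> W : lmodType k) x a : bilin F ->
  tlift F (Delta (Zop x a)) = \tsum_(a1, a2 <- Delta a) F (Zop x a1) a2 +
    \tsum_(a1, a2 <- Delta a) F (el (deg x) ** a1) (Zop x a2).
Proof.
move=> bF; have lF := lin_comp lD (tlift_lin bF).
have bFd : bilin (fun a b => F (el (deg x) ** a) b) by lin.
have bFdd : bilin (fun a b => F (el (deg x) ** a) (el (deg x) ** b)) by lin.
have E1 : \tsum_(a1, a2 <- Delta a) F (Zop x a1) a2 =
    \tsum_(a1, a2 <- Delta a) F (ax x ** a1) a2 +
    (\tsum_(a1, a2 <- Delta a) F (Il (vb x) a1) a2 -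
     \tsum_(a1, a2 <- Delta a) F (Jr x a1) a2).
  rewrite -tliftNf -!tliftDf; apply: eq_tlift => a1 a2.
  by rewrite /Zop /Kop (bilinDl bF) (bilinBl bF).
have E2 : \tsum_(a1, a2 <- Delta a) F (el (deg x) ** a1) (Zop x a2) =
    \tsum_(a1, a2 <- Delta a) F (el (deg x) ** a1) (ax x ** a2) +
    (\tsum_(a1, a2 <- Delta a) F (el (deg x) ** a1) (Il (vb x) a2) -
     \tsum_(a1, a2 <- Delta a) F (el (deg x) ** a1) (Jr x a2)).
  rewrite -tliftNf -!tliftDf; apply: eq_tlift => a1 a2.
  by rewrite /Zop /Kop (bilinDr bF) (bilinBr bF).
rewrite E1 E2 {1}/Zop (linD lF) swX // /Kop (linB lF) sw_Il // /Jr swL // (sw_Ir _ _ bFdd).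
rewrite (sw_slide (vb x) a bFd) [RHS]addrACA; congr (_ + _).
by rewrite addrA subrK.
Qed.

Lemma eps_Zop x a : eps (Zop x a) = 0.
Proof.
rewrite /Zop /Kop (linD le) (linB le) eps_Il /Jr !(hcounitM bA) eps_Ir.
by rewrite (da_eax dA) (da_eel dA) mul0r mul1r subrr addr0.
Qed.

(** The component of bidegree (1, 1) of the coproduct is alternating, as in an
   exterior algebra. *)
Lemma D_alt W (F : vect -> vect -> W : lmodType k) a : bilin F ->
  \tsum_(a1, a2 <- Delta a) F (D a1) (D a2) +
  \tsum_(a1, a2 <- Delta a) F (D a2) (D a1) = 0.
Proof.
move=> bF; pose T := fun a => \tsum_(a1, a2 <- Delta a) F (D a1) (D a2) +
  \tsum_(a1, a2 <- Delta a) F (D a2) (D a1).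
have b1 G : bilin G -> bilin (fun a1 a2 : A => G (D a1) (D a2) : W) by move=> bG; lin.
have b2 G : bilin G -> bilin (fun a1 a2 : A => G (D a2) (D a1) : W) by move=> bG; lin.
move: a F bF {T}; apply: (da_ind dA (P := fun a => forall F : vect -> vect -> W, bilin F ->
  \tsum_(a1, a2 <- Delta a) F (D a1) (D a2) +
  \tsum_(a1, a2 <- Delta a) F (D a2) (D a1) = 0)).
- have L F : bilin F -> lin (fun a => \tsum_(a1, a2 <- Delta a) F (D a1) (D a2) +
    \tsum_(a1, a2 <- Delta a) F (D a2) (D a1) : W) by move=> bF; lin.
  split=> [F bF|b x y IHx IHy F bF]; first exact: (lin0 (L F bF)).
  by rewrite (L F bF) IHx // IHy // scaler0 addr0.
- move=> F bF; rewrite (sw1 (b1 _ bF)) (sw1 (b2 _ bF)) (da_D1 dA) (bilin0l bF) addr0.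
  by [].
- move=> u a IH F bF; rewrite (swL _ _ (b1 _ bF)) (swL _ _ (b2 _ bF)).
  have bFu : bilin (fun v w => F (va u v) (va u w)) by lin.
  rewrite -[RHS](IH _ bFu); congr (_ + _); apply: eq_tlift => a1 a2;
    by rewrite !(da_Del1 dA).
- move=> x a IH F bF; rewrite (swX _ _ (b1 _ bF)) (swX _ _ (b2 _ bF)).
  have e1 : \tsum_(a1, a2 <- Delta a) F (D (ax x ** a1)) (D a2) = F (vb x) (D a).
    rewrite -[RHS](hcounitl bA (f := fun a => F (vb x) (D a))); last by lin.
    by apply: eq_tlift => a1 a2; rewrite (da_Dax1 dA) (bilinZl bF).
  have e2 : \tsum_(a1, a2 <- Delta a) F (D (el (deg x) ** a1)) (D (ax x ** a2)) = - F (D a) (vb x).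
    rewrite -[RHS](hcounitr bA (f := fun a => - F (D a) (vb x))); last by lin.
    by apply: eq_tlift => a1 a2; rewrite (da_Dax1 dA) D_deg (bilinZr bF) (bilinNl bF).
  have e3 : \tsum_(a1, a2 <- Delta a) F (D a2) (D (ax x ** a1)) = F (D a) (vb x).
    rewrite -[RHS](hcounitl bA (f := fun a => F (D a) (vb x))); last by lin.
    by apply: eq_tlift => a1 a2; rewrite (da_Dax1 dA) (bilinZr bF).
  have e4 : \tsum_(a1, a2 <- Delta a) F (D (ax x ** a2)) (D (el (deg x) ** a1)) = - F (vb x) (D a).
    rewrite -[RHS](hcounitr bA (f := fun a => - F (vb x) (D a))); last by lin.
    by apply: eq_tlift => a1 a2; rewrite (da_Dax1 dA) D_deg (bilinZl bF) (bilinNr bF).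
  by rewrite e1 e2 e3 e4 addrA subrK subrr.
Qed.

(** The two contractions contribute opposite terms, by [D_alt]. *)
Lemma D_Zop x a : D (Zop x a) = eps a *: vb x.
Proof.
rewrite /Zop /Kop (linD lDD) (linB lDD) (da_Dax1 dA) /Jr D_deg opprK.
rewrite /Il /Ir !(tlift_comp _ _ lDD).
have bF : bilin (fun v w : vect => eta (vb x) v *: w) by lin.
rewrite -[RHS]addr0 -(D_alt a bF); congr (_ + (_ + _)).
  by apply: eq_tlift => a1 a2; rewrite (linZ lDD).
by apply: eq_tlift => a1 a2; rewrite (linZ lDD).
Qed.

End Contraction.

Section OppositeForm.
Variables (k : fieldType) (A : hopf k) (r : nat).
Local Notation vect := {ffun 'I_r * bool -> k^o}.
Variables (D : A -> vect) (eta eta' : vect -> vect -> k^o).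
Hypothesis etaN : forall v w, eta' v w = - eta v w.

Lemma Il_opp v a : Il D eta' v a = - Il D eta v a.
Proof. by rewrite /Il -tliftNf; apply: eq_tlift => a1 a2; rewrite etaN scaleNr. Qed.

Lemma Ir_opp v a : Ir D eta' v a = - Ir D eta v a.
Proof. by rewrite /Ir -tliftNf; apply: eq_tlift => a1 a2; rewrite etaN scaleNr. Qed.

End OppositeForm.

(** * Changing the relations by a form *)

Section Universal.
Variables (k : fieldType) (m : nat) (omega : k) (r : nat).
Variable (I : r.-tuple (nat * nat)).
Local Notation X := ('I_r * bool)%type.
Local Notation G := (dihedral m).

(** Operators satisfying the relations of A make any vector space a module, on
   which A acts freely from a chosen vector. *)
Definition universal (Lam : X -> X -> k) (A : hopf k) (el : G -> A) (ax : X -> A) :=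
  forall (W : lmodType k) (L : G -> W -> W) (Z : X -> W -> W) (w : W),
    uniform omega I Lam L Z ->
    exists f : A -> W, [/\ lin f, f (hone A) = w,
      forall u a, f (hmul (el u) a) = L u (f a) &
      forall x a, f (hmul (ax x) a) = Z x (f a)].

Hypothesis (m1 : (1 < m)%N) (om : omega ^+ m = 1).

Lemma AI_universal lam gam : (forall s, (fst_at I s <= m)%N) ->
  (forall s t, snd_at I s = snd_at I t -> gam s t = gam t s) ->
  universal (Lam m I lam gam) (@AIel k m omega r I lam gam) (@AIax k m omega r I lam gam).
Proof.
move=> pm gsym W L Z w uLZ; exists (fun a => AIact L Z a w); split.
- by move=> a x y; apply: (AIact_bilin m1 om pm uLZ).1.
- exact: (AIact1 m1 om pm uLZ).
- by move=> u a; rewrite (AIactM m1 om pm uLZ) (AIact_el m1 om pm gsym uLZ).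
- by move=> x a; rewrite (AIactM m1 om pm uLZ) (AIact_ax m1 om pm uLZ).
Qed.

End Universal.

Section Morphism.
Variables (k : fieldType) (m : nat) (omega : k) (r : nat).
Variable (I : r.-tuple (nat * nat)).
Local Notation X := ('I_r * bool)%type.
Local Notation G := (dihedral m).
Local Notation V := (MI m omega I).
Local Notation vect := {ffun X -> k^o}.
Local Notation vb := (vbase (V := V)).
Local Notation va := (vact (V := V)).
Local Notation deg := (ddeg m omega I).
Hypothesis (m1 : (1 < m)%N) (om : omega ^+ m = 1).
Hypothesis key : forall s t, omega ^+ (fst_at I s * snd_at I t) = -1.

Variables (LamA LamB : X -> X -> k).
Variables (A : hopf k) (elA : G -> A) (axA : X -> A) (DA : A -> vect).
Variables (B : hopf k) (elB : G -> B) (axB : X -> B) (DB : B -> vect).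
Hypothesis dA : dalg omega I LamA elA axA DA.
Hypothesis dB : dalg omega I LamB elB axB DB.
Variable eta : vect -> vect -> k^o.
Hypothesis be : bilin eta.

(** By [sw_Zop], a linear map that intertwines the multiplications by generators
   with the operators [Zop] is a morphism of coalgebras, and by [D_Zop] it
   preserves the projection on degree 1; so it also intertwines contractions. *)
Variable f : B -> A.
Hypothesis (lf : lin f) (f1 : f (hone B) = hone A).
Hypothesis fel : forall u b, f (hmul (elB u) b) = hmul (elA u) (f b).
Hypothesis fax : forall x b,
  f (hmul (axB x) b) = Zop omega I elA axA DA eta x (f b).

Let leA : lin (@hcounit k A : A -> k^o). Proof. exact: hcounit_lin (da_bialg dA). Qed.
Let leB : lin (@hcounit k B : B -> k^o). Proof. exact: hcounit_lin (da_bialg dB). Qed.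
Let lDA : lin (@hcomul k A). Proof. exact: hcomul_lin (da_bialg dA). Qed.
Let lDB : lin (@hcomul k B). Proof. exact: hcomul_lin (da_bialg dB). Qed.
Let bmA : bilin (@hmul k A). Proof. exact: hmul_bilin (da_bialg dA). Qed.
Let bmB : bilin (@hmul k B). Proof. exact: hmul_bilin (da_bialg dB). Qed.
Let lddA := da_linD dA.
Let lddB := da_linD dB.
#[local] Hint Resolve leA leB lDA lDB lddA lddB lf : lin.

Lemma zmorph_counit b : hcounit (f b) = hcounit b.
Proof.
move: b; apply: (da_ind dB (P := fun b => hcounit (f b) = hcounit b)).
- split=> [|a x y IHx IHy]; first by rewrite (lin0 lf) (lin0 leA) (lin0 leB).
  by rewrite lf leA leB IHx IHy.
- by rewrite f1 (hcounit1 (da_bialg dA)) (hcounit1 (da_bialg dB)).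
- move=> u b IH; rewrite fel (hcounitM (da_bialg dA)) (hcounitM (da_bialg dB)) IH.
  by rewrite (da_eel dA) (da_eel dB).
- move=> x b IH; rewrite fax (eps_Zop dA be) (hcounitM (da_bialg dB)) (da_eax dB).
  by rewrite mul0r.
Qed.

Lemma zmorph_D b : DA (f b) = DB b.
Proof.
move: b; apply: (da_ind dB (P := fun b => DA (f b) = DB b)).
- split=> [|a x y IHx IHy]; first by rewrite (lin0 lf) (lin0 lddA) (lin0 lddB).
  by rewrite lf lddA lddB IHx IHy.
- by rewrite f1 (da_D1 dA) (da_D1 dB).
- by move=> u b IH; rewrite fel (da_Del1 dA) (da_Del1 dB) IH.
- by move=> x b IH; rewrite fax (D_Zop m1 om key dA be) (da_Dax1 dB) zmorph_counit.
Qed.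

Lemma zmorph_sw W (F : A -> A -> W : lmodType k) b : bilin F ->
  tlift F (hcomul (f b)) = \tsum_(b1, b2 <- hcomul b) F (f b1) (f b2).
Proof.
have bff (F' : A -> A -> W) : bilin F' -> bilin (fun b1 b2 => F' (f b1) (f b2)).
  by move=> bF; lin.
move: b F; apply: (da_ind dB (P := fun b => forall F : A -> A -> W, bilin F ->
  tlift F (hcomul (f b)) = \tsum_(b1, b2 <- hcomul b) F (f b1) (f b2))).
- have LA F : bilin F -> lin (fun b => tlift F (hcomul (f b)) : W).
    by move=> bF; lin.
  have LB F : bilin F -> lin (fun b => \tsum_(b1, b2 <- hcomul b) F (f b1) (f b2) : W).
    by move=> bF; lin.
  split=> [F bF|a x y IHx IHy F bF]; first by rewrite (lin0 (LA _ bF)) (lin0 (LB _ bF)).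
  by rewrite (LA _ bF a) (LB _ bF a) IHx // IHy.
- by move=> F bF; rewrite f1 (sw1 dA bF) (sw1 dB (bff _ bF)) f1.
- move=> u b IH F bF; rewrite fel (swL dA u _ bF) (swL dB u b (bff _ bF)).
  rewrite (IH (fun a b => F (hmul (elA u) a) (hmul (elA u) b))); last by lin.
  by apply: eq_tlift => b1 b2; rewrite !fel.
- move=> x b IH F bF; rewrite fax (sw_Zop dA be x _ bF) (swX dB x b (bff _ bF)).
  have lZ := Zop_lin dA be x.
  rewrite (IH (fun a b => F (Zop omega I elA axA DA eta x a) b)); last by lin.
  rewrite (IH (fun a b => F (hmul (elA (deg x)) a) (Zop omega I elA axA DA eta x b))).
    by congr (_ + _); apply: eq_tlift => b1 b2; rewrite !fax ?fel.
  by lin.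
Qed.

Lemma zmorph_comul b : hcomul (f b) = tmap f f (hcomul b).
Proof.
by rewrite -[LHS]tlift_id zmorph_sw; last exact: tens_bilin.
Qed.

Lemma zmorph_Kop theta x b : bilin theta ->
  f (Kop omega I elB DB theta x b) = Kop omega I elA DA theta x (f b).
Proof.
move=> bt; rewrite /Kop (linB lf) /Jr fel /Il /Ir; congr (_ - hmul _ _).
  rewrite (tlift_comp _ _ lf) zmorph_sw; last by lin.
  by apply: eq_tlift => b1 b2; rewrite (linZ lf) zmorph_D.
rewrite (tlift_comp _ _ lf) zmorph_sw; last by lin.
by apply: eq_tlift => b1 b2; rewrite (linZ lf) zmorph_D.
Qed.

End Morphism.

Section Iso.
Variables (k : fieldType) (m : nat) (omega : k) (r : nat).
Variable (I : r.-tuple (nat * nat)).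
Local Notation X := ('I_r * bool)%type.
Local Notation G := (dihedral m).
Local Notation V := (MI m omega I).
Local Notation vect := {ffun X -> k^o}.
Local Notation vb := (vbase (V := V)).
Local Notation va := (vact (V := V)).
Hypothesis (m1 : (1 < m)%N) (om : omega ^+ m = 1).
Hypothesis key : forall s t, omega ^+ (fst_at I s * snd_at I t) = -1.
Variables (LamA LamB : X -> X -> k).
Variables (A : hopf k) (elA : G -> A) (axA : X -> A) (DA : A -> vect).
Variables (B : hopf k) (elB : G -> B) (axB : X -> B) (DB : B -> vect).
Hypothesis dA : dalg omega I LamA elA axA DA.
Hypothesis dB : dalg omega I LamB elB axB DB.
Hypothesis uA : universal omega I LamA elA axA.
Hypothesis uB : universal omega I LamB elB axB.
Variable eta : vect -> vect -> k^o.
Hypothesis be : bilin eta.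
Hypothesis einv : forall u v w, eta (va u v) (va u w) = eta v w.
Hypothesis LamE : forall x y,
  LamB x y = LamA x y + (eta (vb x) (vb y) + eta (vb y) (vb x)).

Let neta v w : k^o := - eta v w.

Lemma Kop_neg (C : hopf k) (elC : G -> C) (DC : C -> vect) x c :
  bilin (@hmul k C) ->
  Kop omega I elC DC neta x c = - Kop omega I elC DC eta x c.
Proof.
move=> bC.
have nE v w : neta v w = - eta v w by [].
by rewrite /Kop /Jr (Il_opp DC nE) (Ir_opp DC nE) (bilinNr bC) opprK opprB addrC.
Qed.

(** Universality turns the operators [Zop] into a map from the algebra with the
   changed relations. Starting from the opposite form gives its inverse, because
   the maps commute with contractions ([zmorph_Kop]). *)
Lemma zop_iso : exists f : B -> A, exists g : A -> B,
  [/\ lin f, cancel f g, cancel g f & f (hone B) = hone A] /\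
  [/\ forall u b, f (hmul (elB u) b) = hmul (elA u) (f b),
      forall x b, f (hmul (axB x) b) = Zop omega I elA axA DA eta x (f b),
      forall b, hcomul (f b) = tmap f f (hcomul b) &
      forall b, hcounit (f b) = hcounit b].
Proof.
have bmA : bilin (@hmul k A) := hmul_bilin (da_bialg dA).
have bmB : bilin (@hmul k B) := hmul_bilin (da_bialg dB).
have bn : bilin neta by rewrite /neta; lin.
have ninv u v w : neta (va u v) (va u w) = neta v w by rewrite /neta einv.
have EA : (fun x y => LamA x y + (eta (vb x) (vb y) + eta (vb y) (vb x))) = LamB.
  by apply/funext => x; apply/funext => y; rewrite LamE.
have EB : (fun x y => LamB x y + (neta (vb x) (vb y) + neta (vb y) (vb x))) = LamA.
  by apply/funext => x; apply/funext => y; rewrite LamE /neta -opprD addrK.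
have ZA := Zop_uniform m1 om key dA be einv; rewrite EA in ZA.
have ZB := Zop_uniform m1 om key dB bn ninv; rewrite EB in ZB.
have [f [lf f1 fel fax]] := uB (hone A) ZA.
have [g [lg g1 gel gax]] := uA (hone B) ZB.
have fK x b := zmorph_Kop m1 om key dA dB be lf f1 fel fax x b be.
have gK x a := zmorph_Kop m1 om key dB dA bn lg g1 gel gax x a be.
exists f, g; split; split=> //.
- move=> b; move: b; apply: (da_ind dB (P := fun b => g (f b) = b)) => //.
  + split=> [|a x y IHx IHy]; first by rewrite (lin0 lf) (lin0 lg).
    by rewrite lf lg IHx IHy.
  + by rewrite f1 g1.
  + by move=> u b IH; rewrite fel gel IH.
  + move=> x b IH; rewrite fax /Zop (linD lg) gax gK IH /Zop Kop_neg //.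
    by rewrite addrNK.
- move=> a; move: a; apply: (da_ind dA (P := fun a => f (g a) = a)) => //.
  + split=> [|a x y IHx IHy]; first by rewrite (lin0 lg) (lin0 lf).
    by rewrite lg lf IHx IHy.
  + by rewrite g1 f1.
  + by move=> u b IH; rewrite gel fel IH.
  + move=> x b IH; rewrite gax /Zop Kop_neg // (linB lf) fax fK IH /Zop.
    by rewrite addrK.
- exact: (zmorph_comul dA dB be lf f1 fel fax).
- exact: (zmorph_counit dA dB be lf f1 fel fax).
Qed.

End Iso.

(** * The exponential of the lifted form *)

Section Words.
Variables (k : fieldType) (m : nat) (omega : k) (r : nat).
Variable (I : r.-tuple (nat * nat)).
Local Notation X := ('I_r * bool)%type.
Local Notation G := (dihedral m).
Local Notation V := (MI m omega I).
Local Notation vect := {ffun X -> k^o}.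
Local Notation c_ := (dcoef omega I).
Local Notation deg := (ddeg m omega I).
Local Notation vb := (vbase (V := V)).
Local Notation va := (vact (V := V)).
Hypothesis (m1 : (1 < m)%N) (om : omega ^+ m = 1).
Hypothesis key : forall s t, omega ^+ (fst_at I s * snd_at I t) = -1.
Variables (Lam : X -> X -> k) (A : hopf k) (el : G -> A) (ax : X -> A).
Variable (D : A -> vect).
Hypothesis dA : dalg omega I Lam el ax D.
Local Notation Delta := (@hcomul k A).
Local Notation eps := (@hcounit k A).
Local Notation "x ** y" := (@hmul k A x y) (at level 40, left associativity).
Local Notation h1 := (hone A).

Let bA : is_bialgebra A := da_bialg dA.
Let bm := hmul_bilin bA.
Let lml y : lin (fun x => x ** y). Proof. exact: hmul_linl. Qed.
Let lmr x : lin (fun y => x ** y). Proof. exact: hmul_linr. Qed.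
Let lD : lin Delta. Proof. exact: hcomul_lin. Qed.
Let le : lin (eps : A -> k^o). Proof. exact: hcounit_lin. Qed.
Let lDD : lin D := da_linD dA.
Let lva u : lin (va u). Proof. exact: vact_lin. Qed.
Let mA := hmulA bA.
#[local] Hint Resolve lml lmr lD le lDD lva : lin.

Definition xword (w : seq X) (a : A) : A := foldr (fun x a => ax x ** a) a w.
Definition bword (w : seq X) (u : G) : A := xword w (el u).

Lemma xword_cat v w a : xword (v ++ w) a = xword v (xword w a).
Proof. exact: foldr_cat. Qed.

Lemma el_bword u w v : exists c : k,
  el u ** bword w v = c *: bword [seq dact u x | x <- w] (u * v)%g.
Proof.
elim: w => [|x w [c IH]]; first by exists 1; rewrite scale1r /bword /= (ur_M (da_rel dA)).
by exists (c_ u x * c); rewrite /bword /= (LX dA) [el u ** _]IH (bilinZr bm) scalerA.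
Qed.

Lemma word_ind (P : A -> Prop) : lin_closed P -> (forall w u, P (bword w u)) ->
  forall a, P a.
Proof.
move=> lP wP a; move: a P lP wP.
apply: (da_ind dA (P := fun a => forall P : A -> Prop, lin_closed P ->
  (forall w u, P (bword w u)) -> P a)).
- split=> [P [P0 _] _ //|c x y IHx IHy P lP wP].
  by apply: lP.2; [apply: IHx|apply: IHy].
- by move=> P lP wP; rewrite -(ur_1 (da_rel dA)); apply: (wP [::]).
- move=> u a IH P [P0 lP] wP; apply: (IH (fun a => P (el u ** a))).
    split=> [|c x y Px Py]; first by rewrite (bilin0r bm).
    by rewrite bm.2; apply: lP.
  move=> w v; have [c ->] := el_bword u w v.
  by rewrite -[_ *: _]addr0; apply: lP.
move=> x a IH P [P0 lP] wP; apply: (IH (fun a => P (ax x ** a))).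
  split=> [|c y z Px Py]; first by rewrite (bilin0r bm).
  by rewrite bm.2; apply: lP.
by move=> w v; apply: (wP (x :: w)).
Qed.

Lemma word_eq W (f g : A -> W : lmodType k) : lin f -> lin g ->
  (forall w u, f (bword w u) = g (bword w u)) -> f =1 g.
Proof.
move=> lf lg fg; apply: word_ind => //; split=> [|a x y fx fy].
  by rewrite (lin0 lf) (lin0 lg).
by rewrite lf lg fx fy.
Qed.

Variable eta : vect -> vect -> k^o.
Hypothesis be : bilin eta.
Hypothesis einv : forall u v w, eta (va u v) (va u w) = eta v w.
Local Notation Il := (Il D eta).

Definition iword (w : seq X) (a : A) : A := foldr (fun x a => Il (vb x) a) a w.

Lemma iword_cat v w a : iword (v ++ w) a = iword v (iword w a).
Proof. exact: foldr_cat. Qed.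

Lemma iword_lin w : lin (iword w).
Proof. by elim: w => [//|x w IH] a y z; rewrite /= IH (Il_lin dA be). Qed.

Lemma Il_anti x y a : Il (vb x) (Il (vb y) a) = - Il (vb y) (Il (vb x) a).
Proof. by apply/eqP; rewrite -addr_eq0 (Il_Il m1 om key dA be einv). Qed.

Lemma iword_Il w x a : iword w (Il (vb x) a) = (-1) ^+ size w *: Il (vb x) (iword w a).
Proof.
have lI v := Il_lin dA be v.
elim: w => [|y w IH] /=; first by rewrite scale1r.
by rewrite IH (linZ (lI _)) Il_anti scalerN -scaleNr exprS mulN1r.
Qed.

(** Words in the generators followed by a group element span A; on them, the lifted
   form sees only the words of length 1. *)
Variable s : A -> A -> k^o.
Hypothesis fs : is_form s.
Hypothesis sE : forall w u a, s (bword w u) a =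
  if w is [:: x] then eta (vb x) (va u (D a)) else 0.
Let bs : bilin s := fs.

Lemma lift_el u a b : s (el u ** a) b = s a b.
Proof.
have l1 : lin (fun a => s (el u ** a) b : k^o) by lin.
have l2 : lin (fun a => s a b : k^o) by lin.
move: a; apply: (word_eq l1 l2) => w v.
case: w => [|x [|y w]].
- by rewrite {1}/bword /= -(ur_M (da_rel dA)) (sE [::] (u * v)%g) (sE [::] v).
- rewrite {1}/bword /= (LX dA) -(ur_M (da_rel dA)) (bilinZl bs) (sE [:: _] (u * v)%g).
  rewrite (sE [:: _] v) -(bilinZl be) -vact_base.
  by have [_ vM _] := MI_ydmod I m1 om; rewrite vM einv.
- have [c ->] := el_bword u (x :: y :: w) v.
  by rewrite (bilinZl bs) !sE scaler0.
Qed.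

Lemma lift_XX x y a b : s (ax x ** (ax y ** a)) b = 0.
Proof.
have l1 : lin (fun a => s (ax x ** (ax y ** a)) b : k^o) by lin.
move: a; apply: (word_eq l1 (@lin_zero _ _ _)) => w v.
exact: (sE [:: x, y & w] v).
Qed.

Lemma Il_el_inv x u a :
  \tsum_(a1, a2 <- Delta a) (eta (vb x) (va u (D a1)) *: a2) =
  el u^-1%g ** Il (vb x) (el u ** a).
Proof.
rewrite /Il (swL dA u a); last by lin.
rewrite (tlift_comp _ _ (lmr _)); apply: eq_tlift => a1 a2.
by rewrite (da_Del1 dA) (bilinZr bm) -(LM dA) mulVg (L1 dA).
Qed.

(** The form vanishes on products of two generators, so that only the group-like
   part of the coproduct of the word contributes; passing x through the degrees
   of the letters gives the sign. *)
Lemma lift_X_ltwist W (F : A -> A -> W : lmodType k) x w u b : bilin F ->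
  \tsum_(a1, a2 <- Delta (bword w u)) \tsum_(b1, b2 <- Delta b)
    (s (ax x ** a1) b1 *: F a2 b2) =
  (-1) ^+ size w *: F (bword w u) (el u^-1%g ** Il (vb x) (el u ** b)).
Proof.
elim: w F => [|y w IH] F bF.
  rewrite /bword /= (da_Del dA) tliftE; last by lin.
  rewrite scale1r -Il_el_inv (tlift_comp _ _ (bilin_r _ bF)).
  by apply: eq_tlift => b1 b2; rewrite (bilinZr bF) (sE [:: x] u).
rewrite /bword /= (swX dA); last by lin.
rewrite -[X in X + _ = _](_ : 0 = _) ?add0r; last first.
  apply/esym; rewrite -[RHS](@tlift0f _ _ _ W (Delta (xword w (el u)))).
  apply: eq_tlift => a1 a2; rewrite -[RHS](@tlift0f _ _ _ W (Delta b)).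
  by apply: eq_tlift => b1 b2; rewrite lift_XX scale0r.
have bFy : bilin (fun a b => F (ax y ** a) b) by lin.
rewrite exprS mulN1r scaleNr -(IH _ bFy) -tliftNf; apply: eq_tlift => a1 a2.
rewrite -tliftNf; apply: eq_tlift => b1 b2.
have -> : ax x ** (el (deg y) ** a1) = - (el (deg y) ** (ax x ** a1)).
  by rewrite (degX m1 om key dA) opprK.
by rewrite (bilinNl bs) lift_el scaleNr.
Qed.

Lemma ltwist_lift_cons W (F : A -> A -> W : lmodType k) x w u b : bilin F ->
  ltwist s F (bword (x :: w) u) b =
  (-1) ^+ size w *: F (bword w u) (el u^-1%g ** Il (vb x) (el u ** b)) +
  ltwist s (fun a => F (ax x ** a)) (bword w u) b.
Proof.
move=> bF; rewrite -lift_X_ltwist // /ltwist {1}/bword /= (swX dA); last by lin.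
congr (_ + _); apply: eq_tlift => a1 a2; apply: eq_tlift => b1 b2.
by rewrite lift_el.
Qed.

Lemma conv_pow_form n : is_form (conv_pow s n).
Proof.
elim: n => [|n IH]; first exact: conv1_form.
exact: conv_form.
Qed.

Lemma eps_el u b : eps (el u ** b) = eps b.
Proof. by rewrite (hcounitM bA) (da_eel dA) mul1r. Qed.

(** A convolution power evaluates to n! times an iterated contraction: each of the
   letters of the word can be the one that goes into the first factor, and the
   contractions anticommute with the same signs as the letters. *)
Lemma conv_pow_word n w u b : conv_pow s n (bword w u) b =
  (size w == n)%:R * n`!%:R * eps (iword w (el u ** b)).
Proof.
elim: n w u b => [|n IH] w u b.
  rewrite /conv_pow /= /conv1; case: w => [|x w] /=.
    by rewrite (da_eel dA) eps_el fact0 !mul1r.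
  by rewrite /bword /= (hcounitM bA) (da_eax dA) !mul0r.
have fn := conv_pow_form n.
pose cp : A -> A -> k^o := conv_pow s n; have bcp : bilin cp := fn.
pose F v (a b : A) := cp (xword v a) b.
have bF v : bilin (F v).
  have lx : lin (xword v) by elim: v => [//|x v IHv] a y z; rewrite /= IHv bm.2.
  by rewrite /F; lin.
have FE v : ltwist s (F v) (bword w u) b = (size v + size w == n.+1)%N%:R *
    (n`!%:R * (size w)%:R) * eps (iword v (iword w (el u ** b))).
  elim: w v => [|x w IHw] v.
    rewrite mulr0 mulr0 mul0r /ltwist /bword /= (da_Del dA) tliftE; last first.
      by have := bF v => bFv; lin.
    rewrite -[RHS](@tlift0f _ _ _ k^o (Delta b)).
    by apply: eq_tlift => b1 b2; rewrite (sE [::] u) scale0r.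
  rewrite (ltwist_lift_cons x w u b (bF v)).
  have -> : (fun a => F v (ax x ** a)) = F (rcons v x).
    apply/funext => a; apply/funext => b'.
    by rewrite /F -cats1 xword_cat.
  rewrite IHw /F /cp /bword -xword_cat IH -(LM dA) mulgV (L1 dA) iword_cat iword_Il.
  rewrite (linZ (iword_lin v)) (linZ le) size_cat size_rcons -cats1 iword_cat /=.
  rewrite /GRing.scale /= addSn addnS eqSS.
  set E := eps _; set S := (-1) ^+ _.
  have SS : S * S = 1 by rewrite /S -expr2 sqrr_sign.
  rewrite mulrCA [S * (_ * _)]mulrCA mulrA SS mul1r -mulrDl; congr (_ * _).
  by rewrite -natr1 mulrDr mulr1 mulrDr addrC.
have := FE [::]; rewrite /= add0n => E.
transitivity (ltwist s (F [::]) (bword w u) b); first by [].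
rewrite E; case: eqP => [->|]; last by rewrite !mul0r.
by rewrite factS natrM !mul1r [n.+1%:R * _]mulrC.
Qed.

End Words.

Section Sigma.
Variables (k : fieldType) (m : nat) (omega : k) (r : nat).
Variable (I : r.-tuple (nat * nat)).
Local Notation X := ('I_r * bool)%type.
Local Notation G := (dihedral m).
Local Notation V := (MI m omega I).
Local Notation vect := {ffun X -> k^o}.
Local Notation c_ := (dcoef omega I).
Local Notation deg := (ddeg m omega I).
Local Notation vb := (vbase (V := V)).
Local Notation va := (vact (V := V)).
Hypothesis (m1 : (1 < m)%N) (om : omega ^+ m = 1).
Hypothesis key : forall s t, omega ^+ (fst_at I s * snd_at I t) = -1.
Variables (Lam : X -> X -> k) (A : hopf k) (el : G -> A) (ax : X -> A).
Variable (D : A -> vect).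
Hypothesis dA : dalg omega I Lam el ax D.
Local Notation Delta := (@hcomul k A).
Local Notation eps := (@hcounit k A).
Local Notation "x ** y" := (@hmul k A x y) (at level 40, left associativity).
Local Notation h1 := (hone A).

Let bA : is_bialgebra A := da_bialg dA.
Let bm := hmul_bilin bA.
Let lml y : lin (fun x => x ** y). Proof. exact: hmul_linl. Qed.
Let lmr x : lin (fun y => x ** y). Proof. exact: hmul_linr. Qed.
Let lD : lin Delta. Proof. exact: hcomul_lin. Qed.
Let le : lin (eps : A -> k^o). Proof. exact: hcounit_lin. Qed.
Let lDD : lin D := da_linD dA.
Let lva u : lin (va u). Proof. exact: vact_lin. Qed.
Let mA := hmulA bA.
#[local] Hint Resolve lml lmr lD le lDD lva : lin.

Local Notation xword := (xword ax).
Local Notation bword := (bword el ax).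
Variable eta : vect -> vect -> k^o.
Hypothesis be : bilin eta.
Hypothesis einv : forall u v w, eta (va u v) (va u w) = eta v w.
Local Notation Il := (Il D eta).
Local Notation Ir := (Ir D eta).
Local Notation iword := (@iword k m omega r I A D eta).
Let lIl v : lin (Il v) := Il_lin dA be v.
Let lIr v : lin (Ir v) := Ir_lin dA be v.
Let liw w : lin (iword w) := iword_lin dA be w.
Let lxw v : lin (xword v).
Proof. by elim: v => [//|x v IH] a y z; rewrite /= IH bm.2. Qed.
Let lew w : lin (fun a => eps (iword w a) : k^o).
Proof. exact: lin_comp (liw w) le. Qed.
#[local] Hint Resolve lIl lIr liw lxw lew : lin.

(** The closed form of the exponential of the lifted form. All later properties of
   the cocycle are derived from it. *)
Definition is_sigma (sg : A -> A -> k^o) := bilin sg /\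
  forall w u b, sg (bword w u) b = eps (iword w (el u ** b)).

Lemma sw_iword W (F : A -> A -> W : lmodType k) w a : bilin F ->
  tlift F (Delta (iword w a)) = \tsum_(a1, a2 <- Delta a) F (iword w a1) a2.
Proof.
elim: w F => [//|x w IH] F bF /=; rewrite (sw_Il dA be _ _ bF).
by rewrite (IH (fun a b => F (Il (vb x) a) b)) //; lin.
Qed.

Lemma eps_iword W (f : A -> W : lmodType k) w a : lin f ->
  \tsum_(a1, a2 <- Delta a) (eps (iword w a1) *: f a2) = f (iword w a).
Proof.
move=> lf; rewrite -[RHS](hcounitl bA _ lf) sw_iword //.
by lin.
Qed.

Lemma el_bword_iword u w : exists c : k, exists w' : seq X,
  (forall v, el u ** bword w v = c *: bword w' (u * v)%g) /\
  (forall z, el u ** iword w z = c *: iword w' (el u ** z)).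
Proof.
elim: w => [|x w [c [w' [IH1 IH2]]]].
  exists 1, [::]; split=> [v|z]; last by rewrite scale1r.
  by rewrite scale1r /bword /= (ur_M (da_rel dA)).
exists (c_ u x * c), (dact u x :: w'); split=> [v|z].
  by rewrite /bword /= (LX dA) [el u ** _]IH1 (bilinZr bm) scalerA.
rewrite /= (Il_L dA be einv) IH2 vact_base (linZ (lIl _)).
by rewrite (linZ (Il_linv D be _)) scalerA mulrC.
Qed.

Lemma xword_deg v y a : el (deg y) ** xword v a = (-1) ^+ size v *: xword v (el (deg y) ** a).
Proof.
elim: v => [|x v IH] /=; first by rewrite scale1r.
by rewrite (degX m1 om key dA) IH (bilinZr bm) exprS mulN1r scaleNr.
Qed.

Lemma Il_el v u : Il v (el u) = 0.
Proof.
rewrite -[el u](hmulr1 bA) -(vaK (I := I) m1 om u v) -(Il_L dA be einv) (Il_1 dA be).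
by rewrite (bilin0r bm).
Qed.

Lemma Ir_el v u : Ir v (el u) = 0.
Proof.
rewrite -[el u](hmulr1 bA) -(vaK (I := I) m1 om u v) -(Ir_L dA be einv) (Ir_1 dA be).
by rewrite (bilin0r bm).
Qed.

(** The component of degree 1 of a product, minus what the first factor
   contributes: left multiplication by a generator kills it. *)
Let P (a b : A) : vect := D (a ** b) - eps b *: D a.
Let bP : bilin P. Proof. by rewrite /P; lin. Qed.

Let P_X x a b : P (ax x ** a) b = 0.
Proof.
by rewrite /P -mA !(da_Dax1 dA) (hcounitM bA) scalerA mulrC subrr.
Qed.

Let P_L u a b : P (el u ** a) b = va u (P a b).
Proof. by rewrite /P -mA !(da_Del1 dA) (linB (lva u)) (linZ (lva u)). Qed.

Let P_el u b : P (el u) b = va u (D b).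
Proof.
by rewrite -[el u](hmulr1 bA) P_L /P (da_D1 dA) scaler0 subr0 (hmul1 bA).
Qed.

Let P_degs y a b : P (el (deg y) ** a) b = - P a b.
Proof. by rewrite P_L vact_deg. Qed.

Lemma sw_P_right W (F : A -> vect -> W : lmodType k) w u b : bilin F ->
  \tsum_(a1, a2 <- Delta (bword w u)) F a1 (P a2 b) = F (bword w u) (va u (D b)).
Proof.
elim: w F => [|y w IH] F bF.
  by rewrite /bword /= (da_Del dA) tliftE ?P_el //; lin.
rewrite {1}/bword /= (swX dA); last by lin.
rewrite [X in _ + X](eq_tlift (g := fun a1 a2 => 0)) ?tlift0f ?addr0; last first.
  by move=> a1 a2; rewrite P_X (bilin0r bF).
by rewrite (IH (fun a v => F (ax y ** a) v)) //; lin.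
Qed.

Lemma sw_P_left W (F : vect -> A -> W : lmodType k) w u b : bilin F ->
  \tsum_(a1, a2 <- Delta (bword w u)) F (P a1 b) a2 =
  (-1) ^+ size w *: F (va u (D b)) (bword w u).
Proof.
elim: w F => [|y w IH] F bF.
  by rewrite /bword /= scale1r (da_Del dA) tliftE ?P_el //; lin.
rewrite {1}/bword /= (swX dA); last by lin.
rewrite [X in X + _](eq_tlift (g := fun a1 a2 => 0)) ?tlift0f ?add0r; last first.
  by move=> a1 a2; rewrite P_X (bilin0l bF).
rewrite exprS mulN1r scaleNr -(IH (fun v a => F v (ax y ** a))); last by lin.
by rewrite -tliftNf; apply: eq_tlift => a1 a2; rewrite P_degs (bilinNl bF).
Qed.

Variable sg : A -> A -> k^o.
Hypothesis hsg : is_sigma sg.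
Let bs : bilin sg. Proof. by case: hsg. Qed.
Let sE w u b : sg (bword w u) b = eps (iword w (el u ** b)). Proof. by case: hsg. Qed.

Lemma sigma_el u a b : sg (el u ** a) b = sg a b.
Proof.
have l1 : lin (fun a => sg (el u ** a) b) by lin.
have l2 : lin (fun a => sg a b) by lin.
move: a; apply: (word_eq dA l1 l2) => w v.
have [c [w' [E1 E2]]] := el_bword_iword u w.
rewrite E1 (bilinZl bs) !sE (LM dA) -(linZ le) -E2.
exact: eps_el dA u _.
Qed.

Lemma sigma_1l b : sg h1 b = eps b.
Proof.
by rewrite -(ur_1 (da_rel dA)) (sE [::] 1%g) /= (eps_el dA).
Qed.

Lemma sigma_1r a : sg a h1 = eps a.
Proof.
have l1 : lin (fun a => sg a h1) by lin.
move: a; apply: (word_eq dA l1 le) => w u; rewrite sE (hmulr1 bA).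
have Z x v : iword (x :: v) (el u) = 0.
  elim: v x => [|y v IH] x; first exact: Il_el.
  have := IH y; rewrite /= => ->. exact: lin0 (lIl _).
case: w => [//|x w]; rewrite Z (lin0 le).
by rewrite /bword /= (hcounitM bA) (da_eax dA) mul0r.
Qed.

Lemma sigma_deg v y a b : sg (xword v (el (deg y) ** a)) b = (-1) ^+ size v *: sg (xword v a) b.
Proof.
rewrite -(sigma_el (deg y) (xword v a)) xword_deg (bilinZl bs) scalerA.
by rewrite -expr2 sqrr_sign scale1r.
Qed.

(** Contracting the first argument from the left or from the right amounts to the
   same for the cocycle, since signs of letters can be exchanged for signs of
   degrees ([sigma_deg]). *)
Lemma sigma_Il_Ir x a b : sg (Il (vb x) a) b = sg (Ir (vb x) a) b.
Proof.
have l1 : lin (fun a => sg (Il (vb x) a) b) by lin.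
have l2 : lin (fun a => sg (Ir (vb x) a) b) by lin.
move: a; apply: (word_eq dA l1 l2) => w u.
suff H v : (-1) ^+ size v *: sg (xword v (Il (vb x) (bword w u))) b =
           sg (xword v (Ir (vb x) (bword w u))) b.
  by have := H [::]; rewrite scale1r.
elim: w v => [|y w IH] v.
  by rewrite /bword /= Il_el Ir_el (lin0 (lxw v)) (bilin0l bs) scaler0.
have E z : xword v (ax y ** z) = xword (rcons v y) z.
  by rewrite -cats1 xword_cat.
rewrite [bword _ _]/(ax y ** bword w u) (Il_X m1 om key dA be) (Ir_X dA be).
rewrite (linB (lxw v)) (linD (lxw v)) !(linZ (lxw v)) !E (bilinBl bs) (bilinDl bs).
rewrite !(bilinZl bs) sigma_deg -(IH (rcons v y)) size_rcons exprS mulN1r scaleNr.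
by rewrite scalerBr addrC !scalerA mulrC.
Qed.

Let Gm x (a b : A) : k^o := eta (vb x) (D (a ** b)).
Let bG x : bilin (Gm x). Proof. by rewrite /Gm; lin. Qed.

Let GE x a b : Gm x a b = eta (vb x) (P a b) + eps b *: eta (vb x) (D a).
Proof. by rewrite /P (bilinBr be) (bilinZr be) subrK. Qed.

(** The infinitesimal form of the cocycle condition: the cocycle convolved with
   the form eta(x, D(ab)). Splitting D(ab) into the part that [P] sees and the
   contribution of a yields the two terms on the left. *)
Lemma sigma_left x a b :
  sg (ax x ** a) b + sg (Il (vb x) a) b = ltwist sg (Gm x) a b.
Proof.
have l1 : lin (fun a => sg (ax x ** a) b + sg (Il (vb x) a) b) by lin.
have l2 : lin (fun a => ltwist sg (Gm x) a b).
  exact: bilin_l (ltwist_bilin bA (bs : is_form sg) (bG x)).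
move: a; apply: (word_eq dA l1 l2) => w u; set a := bword w u.
have E2 : \tsum_(a1, a2 <- Delta a) \tsum_(b1, b2 <- Delta b)
    (sg a1 b1 *: (eps b2 *: eta (vb x) (D a2))) = sg (Ir (vb x) a) b.
  rewrite /Ir (tlift_comp _ _ (bilin_l b bs)); apply: (@eq_tlift k A A k^o) => a1 a2.
  rewrite (bilinZl bs) -(hcounitr bA b (bilin_r a1 bs)) -tliftZf.
  by apply: (@eq_tlift k A A k^o) => b1 b2; rewrite /GRing.scale /= mulrA mulrC [sg _ _ * _]mulrC.
have E1 : \tsum_(a1, a2 <- Delta a) \tsum_(b1, b2 <- Delta b)
    (sg a1 b1 *: eta (vb x) (P a2 b2)) = sg (ax x ** a) b.
  rewrite tlift_exch.
  transitivity (\tsum_(b1, b2 <- Delta b) (sg a b1 *: eta (vb x) (va u (D b2)))).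
    apply: (@eq_tlift k A A k^o) => b1 b2.
    by rewrite (sw_P_right (F := fun a v => sg a b1 *: eta (vb x) v)) //; lin.
  transitivity (\tsum_(c1, c2 <- Delta (el u ** b)) (eps (iword w c1) *: eta (vb x) (D c2))).
    rewrite (swL dA u b); last by lin.
    apply: (@eq_tlift k A A k^o) => b1 b2.
    by rewrite /a sE (da_Del1 dA).
  rewrite (eps_iword w (el u ** b) (f := fun a => eta (vb x) (D a))); last by lin.
  by rewrite -(eps_Il dA be) -(sE (x :: w) u b).
rewrite sigma_Il_Ir -E1 -E2 -tliftDf; apply: (@eq_tlift k A A k^o) => a1 a2.
rewrite -tliftDf; apply: (@eq_tlift k A A k^o) => b1 b2.
by rewrite -scalerDr -GE.
Qed.

Lemma sigma_right x a b :
  sg (ax x ** a) b + sg (Ir (vb x) a) b = rtwist (Gm x) sg a b.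
Proof.
have l1 : lin (fun a => sg (ax x ** a) b + sg (Ir (vb x) a) b) by lin.
have l2 : lin (fun a => rtwist (Gm x) sg a b).
  exact: bilin_l (rtwist_bilin bA (bs : is_form sg) (bG x)).
move: a; apply: (word_eq dA l1 l2) => w u; set a := bword w u.
have E2 : \tsum_(a1, a2 <- Delta a) \tsum_(b1, b2 <- Delta b)
    (sg a2 b2 *: (eps b1 *: eta (vb x) (D a1))) = sg (Il (vb x) a) b.
  rewrite /Il (tlift_comp _ _ (bilin_l b bs)); apply: (@eq_tlift k A A k^o) => a1 a2.
  rewrite (bilinZl bs) -(hcounitl bA b (bilin_r a2 bs)) -tliftZf.
  by apply: (@eq_tlift k A A k^o) => b1 b2; rewrite /GRing.scale /= mulrA mulrC [sg _ _ * _]mulrC.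
have E1 : \tsum_(a1, a2 <- Delta a) \tsum_(b1, b2 <- Delta b)
    (sg a2 b2 *: eta (vb x) (P a1 b1)) = sg (ax x ** a) b.
  rewrite tlift_exch.
  transitivity (\tsum_(b1, b2 <- Delta b)
      ((-1) ^+ size w *: (sg a b2 *: eta (vb x) (va u (D b1))))).
    apply: (@eq_tlift k A A k^o) => b1 b2.
    by rewrite (sw_P_left (F := fun v a => sg a b2 *: eta (vb x) v)) //; lin.
  rewrite tliftZf.
  transitivity ((-1) ^+ size w *: \tsum_(c1, c2 <- Delta (el u ** b))
      (eps (iword w c2) *: eta (vb x) (D c1))).
    rewrite (swL dA u b); last by lin.
    congr (_ *: _); apply: (@eq_tlift k A A k^o) => b1 b2.
    by rewrite /a sE (da_Del1 dA).
  have lf : lin (fun c => eps (iword w c) : k^o) by lin.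
  transitivity ((-1) ^+ size w *: (eps (iword w (Il (vb x) (el u ** b))) : k^o)).
    congr (_ *: _); rewrite /Il (tlift_comp _ _ lf).
    by apply: (@eq_tlift k A A k^o) => b1 b2; rewrite (linZ lf) /GRing.scale /= mulrC.
  rewrite (iword_Il m1 om key dA be einv) (linZ le) scalerA -expr2 sqrr_sign scale1r.
  by rewrite -(sE (x :: w) u b).
rewrite -sigma_Il_Ir -E1 -E2 -tliftDf; apply: (@eq_tlift k A A k^o) => a1 a2.
rewrite -tliftDf; apply: (@eq_tlift k A A k^o) => b1 b2.
by rewrite -scalerDr -GE.
Qed.

End Sigma.

Section Exponential.
Variables (k : fieldType) (m : nat) (omega : k) (r : nat).
Variable (I : r.-tuple (nat * nat)).
Local Notation X := ('I_r * bool)%type.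
Local Notation G := (dihedral m).
Local Notation V := (MI m omega I).
Local Notation vect := {ffun X -> k^o}.
Local Notation c_ := (dcoef omega I).
Local Notation deg := (ddeg m omega I).
Local Notation vb := (vbase (V := V)).
Local Notation va := (vact (V := V)).
Hypothesis (m1 : (1 < m)%N) (om : omega ^+ m = 1).
Hypothesis key : forall s t, omega ^+ (fst_at I s * snd_at I t) = -1.
Variables (Lam : X -> X -> k) (A : hopf k) (el : G -> A) (ax : X -> A).
Variable (D : A -> vect).
Hypothesis dA : dalg omega I Lam el ax D.
Local Notation Delta := (@hcomul k A).
Local Notation eps := (@hcounit k A).
Local Notation "x ** y" := (@hmul k A x y) (at level 40, left associativity).
Local Notation h1 := (hone A).

Let bA : is_bialgebra A := da_bialg dA.
Let bm := hmul_bilin bA.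
Let lml y : lin (fun x => x ** y). Proof. exact: hmul_linl. Qed.
Let lmr x : lin (fun y => x ** y). Proof. exact: hmul_linr. Qed.
Let lD : lin Delta. Proof. exact: hcomul_lin. Qed.
Let le : lin (eps : A -> k^o). Proof. exact: hcounit_lin. Qed.
Let lDD : lin D := da_linD dA.
Let lva u : lin (va u). Proof. exact: vact_lin. Qed.
Let mA := hmulA bA.
#[local] Hint Resolve lml lmr lD le lDD lva : lin.

Local Notation xword := (xword ax).
Local Notation bword := (bword el ax).
Variable eta : vect -> vect -> k^o.
Hypothesis be : bilin eta.
Hypothesis einv : forall u v w, eta (va u v) (va u w) = eta v w.
Hypothesis chark : [pchar k] =i pred0.
Variable s : A -> A -> k^o.
Hypothesis fs : is_form s.
Hypothesis sE : forall w u a, s (bword w u) a =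
  if w is [:: x] then eta (vb x) (va u (D a)) else 0.
Local Notation iword := (@iword k m omega r I A D eta).

Let powE := conv_pow_word m1 om key dA be einv fs sE.
Let bp n : bilin (conv_pow s n : A -> A -> k^o) := conv_pow_form dA fs n.

(** Local nilpotency, which makes the exponential a finite sum at each argument. *)
Lemma conv_pow_bound a : exists N, forall n b, (N <= n)%N -> conv_pow s n a b = 0.
Proof.
move: a; apply: (word_ind dA); last first.
  move=> w u; exists (size w).+1 => n b lt; rewrite powE.
  by rewrite (ltn_eqF lt) !mul0r.
split=> [|c x y [M xM] [N yN]]; first by exists 0%N => n b _; exact: bilin0l (bp n) b.
exists (maxn M N) => n b; rewrite geq_max => /andP[Mn Nn].
transitivity (c *: (conv_pow s n x b : k^o) + conv_pow s n y b).
  exact: (bp n).1.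
by rewrite xM // yN // scaler0 addr0.
Qed.

Lemma conv_exp_sum a b N : (forall n, (N <= n)%N -> conv_pow s n a b = 0) ->
  conv_exp s a b = \sum_(i < N) (i`!%:R)^-1 * conv_pow s i a b.
Proof.
move=> aN; rewrite (@fsbig_ord k 0 _ N (fun i => (i`!%:R)^-1 * conv_pow s i a b)).
symmetry; apply: fsbig_widen => // i [_] /negP; rewrite -leqNgt => Ni.
by rewrite /= aN // mulr0.
Qed.

(** On a word only the convolution power of its length survives, and the factorials
   cancel, which requires characteristic zero. *)
Lemma exp_is_sigma : is_sigma omega I el ax D eta (conv_exp s).
Proof.
split.
  split=> [c x x' y|c x y y'].
    have [M xM] := conv_pow_bound x; have [N yN] := conv_pow_bound x'.
    have bo n : (maxn M N <= n)%N -> conv_pow s n (c *: x + x') y = 0.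
      rewrite geq_max => /andP[Mn Nn].
      transitivity (c *: (conv_pow s n x y : k^o) + conv_pow s n x' y).
        exact: (bp n).1.
      by rewrite xM // yN // scaler0 addr0.
    rewrite (conv_exp_sum bo) (@conv_exp_sum x y (maxn M N)); last first.
      by move=> n; rewrite geq_max => /andP[Mn _]; apply: xM.
    rewrite (@conv_exp_sum x' y (maxn M N)); last first.
      by move=> n; rewrite geq_max => /andP[_ Nn]; apply: yN.
    rewrite scaler_sumr -big_split /=; apply: eq_bigr => i _.
    have -> : conv_pow s i (c *: x + x') y = c * conv_pow s i x y + conv_pow s i x' y.
      exact: (bp i).1.
    by rewrite mulrDr mulrCA.
  have [M xM] := conv_pow_bound x; have xM' z n := xM n z.
  rewrite !(conv_exp_sum (xM' _)) scaler_sumr -big_split /=; apply: eq_bigr => i _.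
  have -> : conv_pow s i x (c *: y + y') = c * conv_pow s i x y + conv_pow s i x y'.
    exact: (bp i).2.
  by rewrite mulrDr mulrCA.
move=> w u b; rewrite (@conv_exp_sum _ _ (size w).+1); last first.
  by move=> n lt; rewrite powE (ltn_eqF lt) !mul0r.
rewrite big_ord_recr big1 => [|i _]; last first.
  by rewrite powE (gtn_eqF (ltn_ord i)) !mul0r mulr0.
rewrite /= add0r powE eqxx mul1r mulrA mulVf ?mul1r //.
by rewrite (proj1 (pcharf0P k) chark) -lt0n fact_gt0.
Qed.

End Exponential.

Section Inverse.
Variables (k : fieldType) (m : nat) (omega : k) (r : nat).
Variable (I : r.-tuple (nat * nat)).
Local Notation X := ('I_r * bool)%type.
Local Notation G := (dihedral m).
Local Notation V := (MI m omega I).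
Local Notation vect := {ffun X -> k^o}.
Local Notation c_ := (dcoef omega I).
Local Notation deg := (ddeg m omega I).
Local Notation vb := (vbase (V := V)).
Local Notation va := (vact (V := V)).
Hypothesis (m1 : (1 < m)%N) (om : omega ^+ m = 1).
Hypothesis key : forall s t, omega ^+ (fst_at I s * snd_at I t) = -1.
Variables (Lam : X -> X -> k) (A : hopf k) (el : G -> A) (ax : X -> A).
Variable (D : A -> vect).
Hypothesis dA : dalg omega I Lam el ax D.
Local Notation Delta := (@hcomul k A).
Local Notation eps := (@hcounit k A).
Local Notation "x ** y" := (@hmul k A x y) (at level 40, left associativity).
Local Notation h1 := (hone A).

Let bA : is_bialgebra A := da_bialg dA.
Let bm := hmul_bilin bA.
Let lml y : lin (fun x => x ** y). Proof. exact: hmul_linl. Qed.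
Let lmr x : lin (fun y => x ** y). Proof. exact: hmul_linr. Qed.
Let lD : lin Delta. Proof. exact: hcomul_lin. Qed.
Let le : lin (eps : A -> k^o). Proof. exact: hcounit_lin. Qed.
Let lDD : lin D := da_linD dA.
Let lva u : lin (va u). Proof. exact: vact_lin. Qed.
Let mA := hmulA bA.
#[local] Hint Resolve lml lmr lD le lDD lva : lin.

Local Notation xword := (xword ax).
Local Notation bword := (bword el ax).
Variables eta eta' : vect -> vect -> k^o.
Hypothesis be : bilin eta.
Hypothesis einv : forall u v w, eta (va u v) (va u w) = eta v w.
Hypothesis etaN : forall v w, eta' v w = - eta v w.
Variables sg sg' : A -> A -> k^o.
Hypothesis hsg : is_sigma omega I el ax D eta sg.
Hypothesis hsg' : is_sigma omega I el ax D eta' sg'.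

Lemma iword_opp w a :
  iword m omega I D eta' w a = (-1) ^+ size w *: iword m omega I D eta w a.
Proof.
elim: w => [|x w IH] /=; first by rewrite scale1r.
by rewrite IH (Il_opp D etaN) (linZ (Il_lin dA be _)) exprS mulN1r scaleNr.
Qed.

Local Notation Il := (Il D eta).
Local Notation iword := (@iword k m omega r I A D eta).
Let bs : bilin sg. Proof. by case: hsg. Qed.
Let bs' : bilin sg'. Proof. by case: hsg'. Qed.
Let lIl v : lin (Il v) := Il_lin dA be v.
Let liw w : lin (iword w) := iword_lin dA be w.
Let lew w : lin (fun a => eps (iword w a) : k^o).
Proof. exact: lin_comp (liw w) le. Qed.
Let lxw v : lin (xword v).
Proof. by elim: v => [//|x v IH] a y z; rewrite /= IH bm.2. Qed.
#[local] Hint Resolve lIl liw lxw lew : lin.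

(** Moving a letter from the product word to either prefix gives two terms that
   cancel, as contractions anticommute; only words without letters remain. *)
Lemma conv_sigma_word v v' w u c :
  \tsum_(a1, a2 <- Delta (bword w u)) \tsum_(c1, c2 <- Delta c)
    (sg (xword v a1) c1 *: sg' (xword v' a2) c2) =
  (if w is [::] then (-1) ^+ size v' *: (eps (iword v' (iword v (el u ** c))) : k^o)
   else 0).
Proof.
elim: w v v' => [|x w IH] v v'.
  rewrite /bword /= (da_Del dA) tliftE; last by lin.
  pose f d : k^o := (-1) ^+ size v' *: (eps (iword v' d) : k^o).
  have lf : lin f by exact: lin_scale.
  transitivity (\tsum_(d1, d2 <- Delta (el u ** c)) (eps (iword v d1) *: f d2)).
    rewrite (swL dA u c); last by lin.
    apply: (@eq_tlift k A A k^o) => c1 c2.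
    have -> := proj2 hsg v u c1; have -> := proj2 hsg' v' u c2.
    by rewrite iword_opp (linZ le).
  by rewrite (eps_iword dA be v (el u ** c) lf).
rewrite {1}/bword /= (swX dA); last by lin.
transitivity (
  (\tsum_(a1, a2 <- Delta (bword w u)) \tsum_(c1, c2 <- Delta c)
    (sg (xword (rcons v x) a1) c1 *: sg' (xword v' a2) c2)) +
  (-1) ^+ size v *: (\tsum_(a1, a2 <- Delta (bword w u)) \tsum_(c1, c2 <- Delta c)
    (sg (xword v a1) c1 *: sg' (xword (rcons v' x) a2) c2))).
  rewrite -!cats1; congr (_ + _).
    apply: (@eq_tlift k A A k^o) => a1 a2; apply: (@eq_tlift k A A k^o) => c1 c2.
    by rewrite xword_cat.
  rewrite -tliftZf; apply: (@eq_tlift k A A k^o) => a1 a2.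
  rewrite -tliftZf; apply: (@eq_tlift k A A k^o) => c1 c2.
  by rewrite (sigma_deg m1 om key dA be einv hsg) xword_cat scalerA.
rewrite !IH; case: w {IH} => [|y w]; last by rewrite scaler0 addr0.
rewrite size_rcons -!cats1 !iword_cat /= (iword_Il m1 om key dA be einv).
rewrite exprS mulN1r scaleNr scalerN (linZ (liw _)) (linZ le) !scalerA mulrC.
by rewrite subrr.
Qed.

Lemma conv_sigma : conv sg sg' = @conv1 k A.
Proof.
apply/funext => a; apply/funext => c.
have l1 : lin (fun a => conv sg sg' a c : k^o).
  exact: bilin_l (conv_form bA (bs : is_form sg) (bs' : is_form sg')).
have l2 : lin (fun a => conv1 a c : k^o) by exact: bilin_l (conv1_form bA).
move: a; apply: (word_eq dA l1 l2) => w u.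
transitivity (\tsum_(a1, a2 <- Delta (bword w u)) \tsum_(c1, c2 <- Delta c)
    (sg (xword [::] a1) c1 *: sg' (xword [::] a2) c2)); first by [].
rewrite conv_sigma_word /conv1; case: w => [|x w] /=.
  by rewrite scale1r (eps_el dA) /bword /= (da_eel dA) mul1r.
by rewrite /bword /= (hcounitM bA) (da_eax dA) !mul0r.
Qed.

End Inverse.

(** * The cocycle and the deformed product *)

Section Deformation.
Variables (k : fieldType) (m : nat) (omega : k) (r : nat).
Variable (I : r.-tuple (nat * nat)).
Local Notation X := ('I_r * bool)%type.
Local Notation G := (dihedral m).
Local Notation V := (MI m omega I).
Local Notation vect := {ffun X -> k^o}.
Local Notation c_ := (dcoef omega I).
Local Notation deg := (ddeg m omega I).
Local Notation vb := (vbase (V := V)).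
Local Notation va := (vact (V := V)).
Hypothesis (m1 : (1 < m)%N) (om : omega ^+ m = 1).
Hypothesis key : forall s t, omega ^+ (fst_at I s * snd_at I t) = -1.
Variables (Lam : X -> X -> k) (A : hopf k) (el : G -> A) (ax : X -> A).
Variable (D : A -> vect).
Hypothesis dA : dalg omega I Lam el ax D.
Local Notation Delta := (@hcomul k A).
Local Notation eps := (@hcounit k A).
Local Notation "x ** y" := (@hmul k A x y) (at level 40, left associativity).
Local Notation h1 := (hone A).

Let bA : is_bialgebra A := da_bialg dA.
Let bm := hmul_bilin bA.
Let lml y : lin (fun x => x ** y). Proof. exact: hmul_linl. Qed.
Let lmr x : lin (fun y => x ** y). Proof. exact: hmul_linr. Qed.
Let lD : lin Delta. Proof. exact: hcomul_lin. Qed.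
Let le : lin (eps : A -> k^o). Proof. exact: hcounit_lin. Qed.
Let lDD : lin D := da_linD dA.
Let lva u : lin (va u). Proof. exact: vact_lin. Qed.
Let mA := hmulA bA.
#[local] Hint Resolve lml lmr lD le lDD lva : lin.

Local Notation xword := (xword ax).
Local Notation bword := (bword el ax).
Variables eta eta' : vect -> vect -> k^o.
Hypothesis be : bilin eta.
Hypothesis einv : forall u v w, eta (va u v) (va u w) = eta v w.
Hypothesis etaN : forall v w, eta' v w = - eta v w.
Variables sg sg' : A -> A -> k^o.
Hypothesis hsg : is_sigma omega I el ax D eta sg.
Hypothesis hsg' : is_sigma omega I el ax D eta' sg'.
Local Notation Il := (Il D eta).
Local Notation Ir := (Ir D eta).
Local Notation Zop := (Zop omega I el ax D eta).
Let bs : bilin sg. Proof. by case: hsg. Qed.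
Let bs' : bilin sg'. Proof. by case: hsg'. Qed.
Let fsg : is_form sg := bs.
Let fsg' : is_form sg' := bs'.
Let lIl v : lin (Il v) := Il_lin dA be v.
Let lIr v : lin (Ir v) := Ir_lin dA be v.
Let lZ x : lin (Zop x) := Zop_lin dA be x.
#[local] Hint Resolve lIl lIr lZ : lin.

Lemma Il_word (P : A -> Prop) v w u : lin_closed P ->
  (forall w' u', (size w' < size w)%N -> P (bword w' u')) -> P (Il v (bword w u)).
Proof.
elim: w P => [|y w IH] P [P0 lP] wP.
  by rewrite /bword /= (Il_el m1 om dA be einv).
rewrite [bword _ _]/(ax y ** bword w u) (Il_X m1 om key dA be).
apply: (lP); first exact: wP.
rewrite -[X in P X]addr0 -scaleN1r; apply: (lP) => //.
apply: (IH (fun z => P (ax y ** z))).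
  split=> [|c a b Pa Pb]; first by rewrite (bilin0r bm).
  by rewrite bm.2; apply: (lP).
by move=> w' u' lt; apply: (wP (y :: w')).
Qed.

(** Contractions lower the length of words, so that the operators
   [ax x + Il x] generate as much as the left multiplications. *)
Lemma clifford_ind (P : A -> Prop) : lin_closed P -> P h1 ->
  (forall u a, P a -> P (el u ** a)) ->
  (forall x a, P a -> P (ax x ** a + Il (vb x) a)) -> forall a, P a.
Proof.
move=> lcP P1 PL PY; apply: (word_ind dA lcP) => w.
have [n] := ubnP (size w); elim: n w => [//|n IHn] [|x w] ltn u.
  by rewrite /bword /= -[el u](hmulr1 bA); apply: PL.
have [P0 lP] := lcP.
have -> : bword (x :: w) u = -1 *: Il (vb x) (bword w u) +
    (ax x ** bword w u + Il (vb x) (bword w u)).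
  by rewrite scaleN1r addrC addrK.
apply: (lP).
  by apply: Il_word => // w' u' lt; apply: IHn; apply: (ltn_trans lt).
by apply: PY; apply: IHn.
Qed.

(** The product twisted on the left only. Its associativity is equivalent to the
   cocycle condition. *)
Definition star := ltwist sg (@hmul k A).

Lemma star_bilin : bilin star.
Proof. by apply: ltwist_bilin. Qed.
Let bst := star_bilin.

Lemma star_el u a b : star (el u ** a) b = el u ** star a b.
Proof.
rewrite /star /ltwist (swL dA u a); last by lin.
rewrite (tlift_comp _ _ (lmr _)); apply: eq_tlift => a1 a2.
rewrite (tlift_comp _ _ (lmr _)); apply: eq_tlift => b1 b2.
by rewrite (sigma_el dA be einv hsg) (bilinZr bm) mA.
Qed.

Lemma star_1l b : star h1 b = b.
Proof.
rewrite /star /ltwist (sw1 dA); last by lin.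
rewrite -[RHS](hcounitl bA b (@lin_id k A)); apply: eq_tlift => b1 b2.
by rewrite (sigma_1l dA hsg) hmul1.
Qed.

Lemma eps_star a b : eps (star a b) = sg a b.
Proof.
transitivity (rtwist sg (@conv1 k A) a b : k^o); last by rewrite rtwist_conv1.
rewrite /star /ltwist (tlift_comp _ _ le); apply: (@eq_tlift k A A k^o) => a1 a2.
rewrite (tlift_comp _ _ le); apply: (@eq_tlift k A A k^o) => b1 b2.
by rewrite (linZ le) (hcounitM bA) /conv1 /GRing.scale /= mulrC.
Qed.

Let Gm x (a b : A) : k^o := eta (vb x) (D (a ** b)).
Let bG x : bilin (Gm x). Proof. by rewrite /Gm; lin. Qed.
Let fG x : is_form (Gm x) := bG x.

Lemma Il_star x a b : Il (vb x) (star a b) = ltwist (ltwist sg (Gm x)) (@hmul k A) a b.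
Proof.
have -> : ltwist sg (Gm x) = conv sg (Gm x) by rewrite conv_ltwist.
rewrite -(ltwist_conv bA fsg (fG x) bm).
rewrite /star {1}/ltwist (tlift_comp _ _ (lIl _)); apply: eq_tlift => a1 a2.
rewrite (tlift_comp _ _ (lIl _)); apply: eq_tlift => b1 b2.
rewrite (linZ (lIl _)) /Il (tlift_comulM bA); last by lin.
by [].
Qed.

(** The operators [ax x + Il x] commute with right multiplications for the twisted
   product; this is [sigma_left] convolved with the product. *)
Lemma star_X x a b :
  star (ax x ** a + Il (vb x) a) b = ax x ** star a b + Il (vb x) (star a b).
Proof.
rewrite (bilinDl bst) Il_star {1 2}/star /ltwist (swX dA); last by lin.
rewrite (sw_Il dA be); last by lin.
rewrite addrAC addrC; congr (_ + _).
  rewrite /star /ltwist (tlift_comp _ _ (lmr _)); apply: eq_tlift => a1 a2.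
  rewrite (tlift_comp _ _ (lmr _)); apply: eq_tlift => b1 b2.
  by rewrite (sigma_el dA be einv hsg) (bilinZr bm) mA.
rewrite -tliftDf; apply: eq_tlift => a1 a2; rewrite -tliftDf; apply: eq_tlift => b1 b2.
by rewrite -scalerDl (sigma_left m1 om key dA be einv hsg).
Qed.

(** Both sides commute, in the first argument, with the left multiplications by the
   group and with the operators [ax x + Il x], which generate everything from 1
   ([clifford_ind]). *)
Lemma starA a b c : star (star a b) c = star a (star b c).
Proof.
have l1 : lin (fun a => star (star a b) c) by lin.
have l2 : lin (fun a => star a (star b c)) by lin.
move: a; apply: clifford_ind.
- split=> [|d x y Hx Hy]; first by rewrite (lin0 l1) (lin0 l2).
  by rewrite l1 l2 Hx Hy.
- by rewrite !star_1l.
- by move=> u a IH; rewrite !star_el IH.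
- by move=> x a IH; rewrite !star_X IH.
Qed.

(** The counit applied to associativity of the twisted product. *)
Lemma sigma_cocycle a b c :
  \ksum_(b1, b2 <- Delta b) \ksum_(c1, c2 <- Delta c)
    sg b1 c1 * sg a (b2 ** c2) =
  \ksum_(a1, a2 <- Delta a) \ksum_(b1, b2 <- Delta b)
    sg a1 b1 * sg (a2 ** b2) c.
Proof.
transitivity (eps (star a (star b c))); [|rewrite -starA]; rewrite eps_star.
  rewrite {1}/star /ltwist (tlift_comp _ _ (bilin_r a bs)).
  apply: (@eq_tlift k A A k^o) => b1 b2; rewrite (tlift_comp _ _ (bilin_r a bs)).
  by apply: (@eq_tlift k A A k^o) => c1 c2; rewrite (bilinZr bs).
rewrite {1}/star /ltwist (tlift_comp _ _ (bilin_l c bs)).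
apply: (@eq_tlift k A A k^o) => a1 a2; rewrite (tlift_comp _ _ (bilin_l c bs)).
by apply: (@eq_tlift k A A k^o) => b1 b2; rewrite (bilinZl bs).
Qed.

Let be' : bilin eta'.
Proof.
have -> : eta' = fun v w => - eta v w.
  by apply/funext => v; apply/funext => w; exact: etaN.
by lin.
Qed.

Let einv' u v w : eta' (va u v) (va u w) = eta' v w.
Proof. by rewrite !etaN einv. Qed.

Let etaN' v w : eta v w = - eta' v w. Proof. by rewrite etaN opprK. Qed.

Lemma sigma_conv_inv : is_conv_inv sg sg'.
Proof.
split=> // a b.
by rewrite (conv_sigma m1 om key dA be einv etaN hsg hsg')
  (conv_sigma m1 om key dA be' einv' etaN' hsg' hsg).
Qed.

Lemma sigma_is_cocycle : is_hopf A -> cocycle sg.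
Proof.
move=> hopfA; split=> //; first by exists sg'; exact: sigma_conv_inv.
- exact: sigma_cocycle.
- move=> a; rewrite (sigma_1l dA hsg); split=> //.
  by rewrite (sigma_1r m1 om dA be einv hsg).
Qed.

Local Notation dm := (@deform_mul k A sg).

Let dmE : dm = rtwist star sg'.
Proof. by rewrite (deform_mulE bA fsg sigma_conv_inv). Qed.

Lemma deform_bilin : bilin dm.
Proof. by rewrite dmE; apply: rtwist_bilin. Qed.

Lemma deform_el u a b : dm (el u ** a) b = el u ** dm a b.
Proof.
rewrite dmE /rtwist (swL dA u a); last by lin.
rewrite (tlift_comp _ _ (lmr _)); apply: eq_tlift => a1 a2.
rewrite (tlift_comp _ _ (lmr _)); apply: eq_tlift => b1 b2.
by rewrite (sigma_el dA be' einv' hsg') star_el (bilinZr bm).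
Qed.

Lemma deform_1l b : dm h1 b = b.
Proof.
rewrite dmE /rtwist (sw1 dA); last by lin.
rewrite -[RHS](hcounitr bA b (@lin_id k A)); apply: eq_tlift => b1 b2.
by rewrite (sigma_1l dA hsg') star_1l.
Qed.

Lemma Ir_star x a b : Ir (vb x) (star a b) = rtwist star (Gm x) a b.
Proof.
have -> : rtwist star (Gm x) = ltwist sg (rtwist (@hmul k A) (Gm x)).
  by rewrite /star (ltwist_rtwist bA fsg (fG x) bm).
rewrite /star {1}/ltwist (tlift_comp _ _ (lIr _)); apply: eq_tlift => a1 a2.
rewrite (tlift_comp _ _ (lIr _)); apply: eq_tlift => b1 b2.
rewrite (linZ (lIr _)) /Ir (tlift_comulM bA); last by lin.
by [].
Qed.

Let sigma_right' x a b :
  sg' (ax x ** a) b - sg' (Ir (vb x) a) b = - rtwist (Gm x) sg' a b.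
Proof.
have IrN := Ir_opp D etaN (vb x) a.
have := sigma_right m1 om key dA be' einv' hsg' x a b.
rewrite IrN (bilinNl bs') => ->.
rewrite /rtwist -tliftNf; apply: (@eq_tlift k A A k^o) => a1 a2.
rewrite -tliftNf; apply: (@eq_tlift k A A k^o) => b1 b2.
by rewrite etaN scalerN.
Qed.

(** To [star_X] is added the twist on the right by the inverse cocycle, which turns
   the contraction of the last factor into [Ir] by [sigma_right] for the opposite
   form; the contractions of middle factors cancel by [sw_slide]. *)
Lemma deform_X x a b : dm (Zop x a) b = Zop x (dm a b).
Proof.
rewrite dmE; set T := rtwist star sg'.
have bT : bilin T by apply: rtwist_bilin.
pose F a1 a2 := \tsum_(b1, b2 <- Delta b) (sg' a2 b2 *: star a1 b1).
have bF : bilin F by rewrite /F; lin.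
pose S := \tsum_(a1, a2 <- Delta a) F a1 (Il (vb x) a2).
pose Q := \tsum_(a1, a2 <- Delta a) (F a1 (ax x ** a2) - F a1 (Ir (vb x) a2)).
have E1 : \tsum_(a1, a2 <- Delta a) F (Zop x a1) a2 =
    ax x ** T a b + Il (vb x) (T a b) - el (deg x) ** S.
  rewrite /S -(sw_slide dA be (vb x) a bF) (tlift_comp _ _ (lmr _)).
  rewrite /T /rtwist (tlift_comp _ _ (lmr _)) (tlift_comp _ _ (lIl _)).
  rewrite -tliftNf -!tliftDf; apply: eq_tlift => a1 a2.
  rewrite (tlift_comp _ _ (lmr _)) (tlift_comp _ _ (lIl _)).
  rewrite /F (tlift_comp _ _ (lmr _)) -tliftNf -!tliftDf; apply: eq_tlift => b1 b2.
  rewrite /Zop /Kop /Jr addrA (bilinBl bst) star_X star_el !(bilinZr bm).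
  by rewrite (linZ (lIl _)) -scalerDr -scalerBr.
have E2 : \tsum_(a1, a2 <- Delta a) F (el (deg x) ** a1) (Zop x a2) =
    el (deg x) ** Q + el (deg x) ** S.
  rewrite -(bilinDr bm) /Q /S -tliftDf (tlift_comp _ _ (lmr _)).
  apply: eq_tlift => a1 a2.
  rewrite /F -tliftNf -!tliftDf (tlift_comp _ _ (lmr _)); apply: eq_tlift => b1 b2.
  rewrite star_el -(bilinZr bm); congr (_ ** _).
  rewrite -scaleNr -!scalerDl; congr (_ *: _).
  rewrite /Zop /Kop /Jr (bilinDl bs') (bilinBl bs') (sigma_el dA be' einv' hsg').
  by rewrite addrA addrAC.
have E3 : Q = - Ir (vb x) (T a b).
  have -> : Ir (vb x) (T a b) = rtwist (rtwist star (Gm x)) sg' a b.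
    rewrite /T {1}/rtwist (tlift_comp _ _ (lIr _)); apply: eq_tlift => a1 a2.
    rewrite (tlift_comp _ _ (lIr _)); apply: eq_tlift => b1 b2.
    by rewrite (linZ (lIr _)) Ir_star.
  rewrite (rtwist_conv bA (fG x) fsg' bst) conv_rtwist /Q /F.
  rewrite {1}/rtwist -tliftNf; apply: eq_tlift => a1 a2.
  rewrite -!tliftNf -tliftDf; apply: eq_tlift => b1 b2.
  by rewrite -scalerBl sigma_right' scaleNr.
transitivity (tlift F (Delta (Zop x a))); first by [].
rewrite (sw_Zop dA be x a bF) E1 E2 addrA [LHS]addrAC subrK E3 (bilinNr bm).
by rewrite /Zop /Kop /Jr addrA.
Qed.

End Deformation.

(** * The tensor algebra of a module whose degrees act by -1 *)

(** An opaque copy of a term; conversion does not unfold it. *)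
Fact seal (T : Type) (a : T) : {b : T | b = a}.
Proof. by exists a. Qed.

Definition sealed (T : Type) (a : T) : T := sval (seal a).

Lemma sealedE (T : Type) (a : T) : sealed a = a.
Proof. exact: (svalP (seal a)). Qed.

Section BraidedTensor.
Variables (k : fieldType) (A : lmodType k).

(** Multiplication by a primitive element in a braided tensor square, for [f]
   the multiplication and [s] the braiding with it. *)
Definition bprim (f s : A -> A) (t : tensor A A) : tensor A A :=
  \tsum_(c, d <- t) (f c \ox d + s c \ox f d).

Variables (f s : A -> A).
Hypothesis (lf : lin f) (ls : lin s).

Lemma bprim_lin : lin (bprim f s).
Proof. by rewrite /bprim; lin. Qed.

Lemma bprimE c d : bprim f s (c \ox d) = f c \ox d + s c \ox f d.
Proof. by rewrite /bprim tliftE //; lin. Qed.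

Lemma braided_bilin (T : finType) (mul : A -> A -> A) (act comp : T -> A -> A) t :
  bilin mul -> (forall g, lin (act g)) -> (forall g, lin (comp g)) ->
  bilin (fun a b => \tsum_(c, d <- t) \sum_g (mul a (act g c) \ox mul (comp g b) d)).
Proof. by move=> bm la lc; lin. Qed.

End BraidedTensor.

Section TensorAlgebra.
Variables (k : fieldType) (gT : finGroupType) (V : ydmod k gT).
Local Notation X := (ydX V).
Local Notation vect := {ffun X -> k^o}.
Local Notation TV := {malg k[{fmonom X}]}.
Local Notation tv := (@tvar k gT V).
Local Notation deg := (@yddeg k gT V).
Local Notation tact := (@tact k gT V).
Local Notation tcomp := (@tcomp k gT V).
Local Notation tcomul := (@tcomul k gT V).
Hypothesis hV : is_ydmod V.
Local Notation vb := (vbase (V := V)).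
Hypothesis neg : forall x y, ydact (deg y) x = - vb x.

Definition tX : X -> TV -> TV := sealed (fun x u => tv x * u).

Lemma tX_tvar x u : tv x * u = tX x u.
Proof. by rewrite /tX sealedE. Qed.

Lemma tX_lin x : lin (tX x).
Proof. by move=> a u v; rewrite -!tX_tvar (bilin_r (tv x) (fmul_bilin _ _)). Qed.

Lemma tmul_lin (u : TV) : lin ( *%R u).
Proof. exact: bilin_r (fmul_bilin _ _). Qed.

Lemma tmul_linl (u : TV) : lin (fun v => v * u).
Proof. exact: bilin_l (fmul_bilin _ _). Qed.

Lemma tX_mul x u v : tX x u * v = tX x (u * v).
Proof. by rewrite -!tX_tvar mulrA. Qed.

Lemma tX_cons x w : tX x << FMonom w >> = << FMonom (x :: w) >>.
Proof. by rewrite -tX_tvar fmonom_cons. Qed.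

Lemma tX_1 x : tX x 1 = tv x.
Proof. by rewrite -tX_tvar mulr1. Qed.

Lemma TV_ind (P : TV -> Prop) : lin_closed P -> P 1 -> (forall x u, P u -> P (tX x u)) ->
  forall u, P u.
Proof.
by move=> [P0 PD] P1 PX; apply: free_ind => // x u Pu; rewrite [_ * _]tX_tvar; apply: PX.
Qed.

Lemma TV_eq (W : lmodType k) (f g : TV -> W) : lin f -> lin g ->
  f 1 = g 1 -> (forall x u, f u = g u -> f (tX x u) = g (tX x u)) -> f =1 g.
Proof.
move=> lf lg fg1 fgX; apply: free_eq => // x u fg; rewrite [_ * _]tX_tvar; exact: fgX.
Qed.

Lemma malg_lin_cons (W : lmodType k) (f f' : {fmonom X} -> W) (op : W -> W) x u :
  lin op -> (forall w, f (FMonom (x :: w)) = op (f' (FMonom w))) ->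
  malg_lin f (tX x u) = op (malg_lin f' u).
Proof.
move=> lop fE; have l1 := lin_comp (tX_lin x) (@lin_malg k _ W f).
have l2 := lin_comp (@lin_malg k _ W f') lop.
by apply: (malg_lin_eq l1 l2) => -[w]; rewrite tX_cons !malg_linU.
Qed.

Lemma malg_lin1 (W : lmodType k) (f : {fmonom X} -> W) : malg_lin f 1 = f (FMonom [::]).
Proof. by rewrite -fmonom_nil malg_linU. Qed.

Lemma tact_lin g : lin (tact g). Proof. exact: lin_malg. Qed.
Lemma tcomp_lin g : lin (tcomp g). Proof. exact: lin_malg. Qed.
Lemma tcomul_lin : lin tcomul. Proof. exact: lin_malg. Qed.

Lemma tact1 g : tact g 1 = 1.
Proof. by rewrite /tact malg_lin1 big_nil. Qed.

Lemma tact_X g x u : tact g (tX x u) = tvect (ydact g x) * tact g u.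
Proof.
apply: (malg_lin_cons _ (tmul_lin _)) => w.
by rewrite big_cons.
Qed.

Lemma tcomp1 g : tcomp g 1 = if g == 1%g then 1 else 0.
Proof. by rewrite /tcomp malg_lin1 /tdeg big_nil fmonom_nil eq_sym. Qed.

Lemma tcomp_X g x u : tcomp g (tX x u) = tX x (tcomp ((deg x)^-1 * g)%g u).
Proof.
apply: (malg_lin_cons _ (tX_lin _)) => w.
rewrite /tdeg big_cons (can2_eq (mulKg _) (mulKVg _)).
case: eqP => _; first by rewrite tX_cons.
by rewrite (lin0 (tX_lin _)).
Qed.

Lemma tcomp_var g x : tcomp g (tv x) = if g == deg x then tv x else 0.
Proof.
rewrite -[in LHS](tX_1 x).
rewrite tcomp_X tcomp1 -eq_mulVg1 eq_sym.
case: (g == deg x); first exact: tX_1.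
exact: (lin0 (tX_lin x)).
Qed.

Lemma tvect_base x : tvect (vb x) = tv x.
Proof.
rewrite /tvect (bigD1 x) //= big1 => [|y /negbTE yx].
  by rewrite ffunE eqxx scale1r addr0.
by rewrite ffunE yx scale0r.
Qed.

Lemma tvect_lin : lin (tvect (V := V)).
Proof.
move=> a v w; rewrite /tvect scaler_sumr -big_split; apply: eq_bigr => x _ /=.
by rewrite !ffunE scalerDl scalerA.
Qed.

(** The sign of the degree, which is how the degree of a generator acts. *)
Definition tsgn : TV -> TV :=
  sealed (malg_lin (fun w : {fmonom X} => (-1) ^+ size w *: << w >>)).

Lemma tsgn_lin : lin tsgn. Proof. by rewrite /tsgn sealedE; exact: lin_malg. Qed.

Lemma tsgn1 : tsgn 1 = 1.
Proof. by rewrite /tsgn sealedE malg_lin1 scale1r fmonom_nil. Qed.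

Lemma tsgn_X x u : tsgn (tX x u) = - tX x (tsgn u).
Proof.
rewrite /tsgn sealedE.
apply: (malg_lin_cons (op := fun u => - tX x u)) => [|w].
  exact: lin_opp (tX_lin x).
have E : (-1) ^+ (size w).+1 = - (-1) ^+ size w :> k by rewrite exprS mulN1r.
rewrite (linZ (tX_lin x)) tX_cons -scaleNr -E.
exact: erefl.
Qed.

Lemma tact_deg y u : tact (deg y) u = tsgn u.
Proof.
apply: (TV_eq (tact_lin _) tsgn_lin); first by rewrite tact1 tsgn1.
move=> x {}u IH; rewrite tact_X neg tsgn_X IH (linN tvect_lin) tvect_base -tX_tvar.
exact: mulNr.
Qed.

Lemma tsgnK u : tsgn (tsgn u) = u.
Proof.
apply: (TV_eq (lin_comp tsgn_lin tsgn_lin) (@lin_id _ _)); first by rewrite !tsgn1.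
by move=> x {}u IH; rewrite tsgn_X (linN tsgn_lin) tsgn_X IH opprK.
Qed.

Lemma tact_1g u : tact 1%g u = u.
Proof.
apply: (TV_eq (tact_lin _) (@lin_id _ _)); first by rewrite tact1.
move=> x {}u IH; rewrite tact_X IH -tX_tvar; congr (_ * _).
rewrite -tvect_base; congr tvect; have [v1 _ _] := hV.
rewrite -[RHS]v1 /vact (bigD1 x) //= big1 => [|y /negbTE yx].
  by rewrite ffunE eqxx scale1r addr0.
by rewrite ffunE yx scale0r.
Qed.

#[local] Hint Resolve tX_lin tact_lin tcomp_lin tcomul_lin tsgn_lin tmul_lin tmul_linl : lin.

Definition bX (x : X) : tensor TV TV -> tensor TV TV := bprim (tX x) tsgn.

Lemma bX_bprim x : bX x = bprim (tX x) tsgn.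
Proof. by []. Qed.

Lemma bX_lin x : lin (bX x).
Proof. exact: bprim_lin (tX_lin x) tsgn_lin. Qed.

Lemma bXE x c d : bX x (c \ox d) = tX x c \ox d + tsgn c \ox tX x d.
Proof. exact: bprimE (tX_lin x) tsgn_lin c d. Qed.

Lemma tcomul1 : tcomul 1 = 1 \ox 1.
Proof. by rewrite /tcomul malg_lin1. Qed.

(** Since the degrees act by signs, the braided coproduct is that of a graded
   Hopf algebra with the usual rule of signs. *)
Lemma tcomul_X x u : tcomul (tX x u) = bX x (tcomul u).
Proof.
apply: (malg_lin_cons _ (bX_lin x)) => w /=.
set t := foldr _ _ _; rewrite /braided_mul.
set H := fun a b => tlift _ t.
have bH : bilin H by exact: braided_bilin (fmul_bilin _ _) tact_lin tcomp_lin.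
have H1 : H (tv x) 1 = \tsum_(c, d <- t) (tX x c \ox d).
  apply: eq_tlift => c d; rewrite (bigD1 1%g (P := xpredT) isT) big1; last first.
    by move=> g /negbTE g1; rewrite tcomp1 g1 mul0r (lin0 (tens_linr _)).
  apply: etrans (addr0 _) _; by rewrite tcomp1 eqxx tact_1g mul1r tX_tvar.
have H2 : H 1 (tv x) = \tsum_(c, d <- t) (tsgn c \ox tX x d).
  apply: eq_tlift => c d; rewrite (bigD1 (deg x) (P := xpredT) isT) big1; last first.
    by move=> g /negbTE gx; rewrite tcomp_var gx mul0r (lin0 (tens_linr _)).
  apply: etrans (addr0 _) _; by rewrite tcomp_var eqxx tact_deg mul1r tX_tvar.
apply: etrans (linD (tlift_lin bH) _ _) _.
apply: etrans (congr2 +%R (tliftE (tv x) 1 bH) (tliftE 1 (tv x) bH)) _.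
apply: etrans (congr2 +%R H1 H2) _; apply: esym; exact: tliftDf.
Qed.

Lemma tcounit_lin : lin (@tcounit k gT V : TV -> k^o).
Proof. by move=> a u v; rewrite /tcounit mcoeffD mcoeffZ. Qed.

Lemma tcounit1 : tcounit (V := V) 1 = 1.
Proof. by rewrite /tcounit -fmonom_nil mcoeffU fmoneE eqxx. Qed.

Lemma mcoeff_lin (w : {fmonom X}) : lin (fun u : TV => u@_w : k^o).
Proof. by move=> a u v; rewrite mcoeffD mcoeffZ. Qed.

Lemma mcoeff_X0 x y (w : seq X) u : x != y -> (tX x u)@_(FMonom (y :: w)) = 0.
Proof.
move=> xy; have l1 := lin_comp (tX_lin x) (mcoeff_lin (FMonom (y :: w))).
apply: (malg_lin_eq l1 (@lin_zero _ _ _)) => -[v]; rewrite tX_cons mcoeffU.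
case: eqP => [[e _]|_]; last exact: erefl.
by rewrite e eqxx in xy.
Qed.

Lemma mcoeff_Xnil x u : (tX x u)@_(FMonom [::]) = 0.
Proof.
have l1 := lin_comp (tX_lin x) (mcoeff_lin (FMonom [::])).
apply: (malg_lin_eq l1 (@lin_zero _ _ _)) => -[v]; rewrite tX_cons mcoeffU.
by case: eqP.
Qed.

Lemma mcoeff_X x (w : seq X) u : (tX x u)@_(FMonom (x :: w)) = u@_(FMonom w).
Proof.
have l1 := lin_comp (tX_lin x) (mcoeff_lin (FMonom (x :: w))).
apply: (malg_lin_eq l1 (mcoeff_lin _)) => -[v]; rewrite tX_cons !mcoeffU.
congr (_ *+ nat_of_bool _); apply/eqP/eqP => [[->]|[->]]; exact: erefl.
Qed.

Lemma tcounitE u : tcounit (V := V) u = u@_(FMonom [::]).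
Proof. by rewrite /tcounit fmoneE. Qed.

Lemma tcounit_X x u : tcounit (tX x u) = 0.
Proof. by rewrite /tcounit fmoneE mcoeff_Xnil. Qed.

End TensorAlgebra.

(** * The Nichols algebra is an exterior algebra *)

Section Span.
Variables (k : fieldType) (W : lmodType k) (S : set W).

Lemma span_closed : lin_closed (Defs.span S).
Proof.
split=> [|a x y sx sy]; first exact: span0.
by apply: spanD => //; apply: spanZ.
Qed.

Lemma span_lin_ind (P : W -> Prop) : lin_closed P -> (forall x, S x -> P x) ->
  forall u, Defs.span S u -> P u.
Proof. by move=> [P0 PD] SP u; elim=> [//|a x y /SP Px _ Py]; apply: PD. Qed.

End Span.

Section LinClosed.
Variables (k : fieldType) (W : lmodType k) (P : W -> Prop).
Hypothesis cP : lin_closed P.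

Lemma lcD x y : P x -> P y -> P (x + y).
Proof. by case: cP => _ PD Px Py; rewrite -[x]scale1r; apply: PD. Qed.

Lemma lcZ a x : P x -> P (a *: x).
Proof. by case: cP => P0 PD Px; rewrite -[_ *: _]addr0; apply: PD. Qed.

Lemma lcN x : P x -> P (- x).
Proof. by move=> Px; rewrite -scaleN1r; apply: lcZ. Qed.

Lemma lc_sum (J : finType) (F : J -> W) : (forall i, P (F i)) -> P (\sum_i F i).
Proof.
move=> PF; apply: (big_ind P) => [|x y|i _]; [by case: cP|exact: lcD|exact: PF].
Qed.

Lemma lin_closed_comp (U : lmodType k) (f : U -> W) : lin f -> lin_closed (fun u => P (f u)).
Proof.
move=> lf; split=> [|a x y Px Py]; first by rewrite (lin0 lf); case: cP.
by rewrite lf; case: cP => _; apply.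
Qed.

End LinClosed.

Lemma lin_sum2 (k : fieldType) (A B : lmodType k) (f : A -> B) x y x' y' : lin f ->
  f x = x' -> f y = y' -> f (x + y) = x' + y'.
Proof. by move=> lf <- <-; exact: linD. Qed.

Section BraidedSquare.
Variables (k : fieldType) (A : lmodType k) (f g s : A -> A).
Hypothesis (lf : lin f) (lg : lin g) (ls : lin s).
Hypothesis (sf : forall c, s (f c) = - f (s c)) (sg : forall c, s (g c) = - g (s c)).
Hypothesis ss : forall c, s (s c) = c.

(** The anticommutator of two primitive elements is primitive: the cross terms
   cancel by the rule of signs. *)
Lemma bprim_anti c d :
  bprim f s (bprim g s (c \ox d)) + bprim g s (bprim f s (c \ox d)) =
  (f (g c) + g (f c)) \ox d + c \ox (f (g d) + g (f d)).
Proof.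
have bt := @tens_bilin k A A.
rewrite (bprimE lg ls) (bprimE lf ls) (linD (bprim_lin lf ls)) (linD (bprim_lin lg ls)).
rewrite !(bprimE lf ls) !(bprimE lg ls) !ss sf sg !(bilinNl bt).
rewrite (bilinDl bt) (bilinDr bt).
set a := f (g c) \ox d; set b := g (s c) \ox f d; set e := f (s c) \ox g d.
set a' := g (f c) \ox d; set h := c \ox f (g d); set h' := c \ox g (f d).
rewrite addrACA [X in X + _]addrACA [X in _ + X]addrACA -opprD [e + b]addrC.
by rewrite -[LHS]addrA addKr.
Qed.

End BraidedSquare.

Section NicholsIdeal.
Variables (k : fieldType) (gT : finGroupType) (V : ydmod k gT).
Local Notation X := (ydX V).
Local Notation vect := {ffun X -> k^o}.
Local Notation TV := {malg k[{fmonom X}]}.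
Local Notation tv := (@tvar k gT V).
Local Notation tX := (@tX k gT V).
Local Notation deg := (@yddeg k gT V).
Local Notation tact := (@tact k gT V).
Local Notation tcomp := (@tcomp k gT V).
Local Notation tcomul := (@tcomul k gT V).
Local Notation tsgn := (@tsgn k gT V).
Local Notation bX := (@bX k gT V).
Local Notation vb := (vbase (V := V)).
Hypothesis hV : is_ydmod V.
Hypothesis neg : forall x y, ydact (deg y) x = - vb x.

#[local] Hint Resolve tX_lin tact_lin tcomp_lin tcomul_lin tsgn_lin : lin.

Definition antic (x y : X) : TV := tX x (tv y) + tX y (tv x).

(** The ideal that turns out to be the defining ideal of the Nichols algebra. *)
Definition antic_ideal : set TV :=
  @ideal_gen k gT V [set e | exists x y, e = antic x y]%classic.
Local Notation K0 := antic_ideal.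

Lemma K0_closed : lin_closed K0.
Proof. exact: span_closed. Qed.

Lemma antic_mul x y b : antic x y * b = tX x (tX y b) + tX y (tX x b).
Proof.
have E u v : tX u (tv v) * b = tX u (tX v b).
  exact: (eq_trans (tX_mul u (tv v) b) (f_equal (tX u) (tX_tvar v b))).
have F := mulrDl (tX x (tv y)) (tX y (tv x)) b.
exact: (eq_trans F (f_equal2 (fun u v : TV => u + v) (E x y) (E y x))).
Qed.

Lemma antic_mul1 x y b : 1 * antic x y * b = tX x (tX y b) + tX y (tX x b).
Proof. rewrite mul1r; exact: antic_mul. Qed.

Lemma ideal_genI (E : set TV) a e b : E e -> @ideal_gen k gT V E (a * e * b).
Proof.
move=> Ee.
exact: span_sub (ex_intro _ a (ex_intro _ e (ex_intro _ b (conj Ee erefl)))).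
Qed.

Lemma ideal_gen_ind (E : set TV) (P : TV -> Prop) : lin_closed P ->
  (forall a e b, E e -> P (a * e * b)) -> forall u, @ideal_gen k gT V E u -> P u.
Proof.
by move=> cP Pe; apply: span_lin_ind => // _ [a [e [b [Ee ->]]]]; apply: Pe.
Qed.

Lemma tX_mul2 x a e b : tX x a * e * b = tX x (a * e * b).
Proof.
have F := congr1 (fun z : TV => z * b) (tX_mul x a e).
exact: (eq_trans F (tX_mul x (a * e) b)).
Qed.

Lemma K0_antic x y b : K0 (tX x (tX y b) + tX y (tX x b)).
Proof.
rewrite -antic_mul1; apply: ideal_genI.
exact: ex_intro _ x (ex_intro _ y erefl).
Qed.

Lemma K0_X x u : K0 u -> K0 (tX x u).
Proof.
move: u; apply: (ideal_gen_ind (P := fun u => K0 (tX x u))).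
  exact: (lin_closed_comp K0_closed (tX_lin x)).
move=> a e b Ee; rewrite -tX_mul2; exact: ideal_genI.
Qed.

(** Since left multiplications by generators suffice, properties of the ideal are
   checked on products that begin with an anticommutator. *)
Lemma K0_ind (P : TV -> Prop) : lin_closed P ->
  (forall x y b, P (tX x (tX y b) + tX y (tX x b))) ->
  (forall x u, P u -> P (tX x u)) -> forall u, K0 u -> P u.
Proof.
move=> cP Pe PX; apply: (ideal_gen_ind cP) => a _ b [x [y ->]].
have l1 : lin (fun a : TV => a * (antic x y) * b).
  exact: lin_comp (tmul_linl _) (tmul_linl _).
move: a; apply: (TV_ind (P := fun a => P (a * (antic x y) * b))).
- exact: (lin_closed_comp cP l1).
- rewrite antic_mul1; exact: Pe.
by move=> z u Pu; rewrite tX_mul2; apply: PX.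
Qed.

Lemma K0_mulr u b : K0 u -> K0 (u * b).
Proof.
move: u; apply: (K0_ind (P := fun u => K0 (u * b))).
- exact: (lin_closed_comp K0_closed (tmul_linl b)).
- move=> x y c.
  have -> : (tX x (tX y c) + tX y (tX x c)) * b = tX x (tX y (c * b)) + tX y (tX x (c * b)).
    apply: etrans (mulrDl _ _ _) (congr2 +%R _ _);
      exact: etrans (tX_mul _ _ b) (congr1 (tX _) (tX_mul _ c b)).
  exact: K0_antic.
- by move=> x u Ku; rewrite tX_mul; apply: K0_X.
Qed.

Lemma K0_mull a u : K0 u -> K0 (a * u).
Proof.
move=> Ku; move: a; apply: (TV_ind (P := fun a => K0 (a * u))).
- exact: (lin_closed_comp K0_closed (tmul_linl u)).
- have -> : 1 * u = u by exact: mul1r.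
  exact: Ku.
- by move=> x a Ka; rewrite tX_mul; apply: K0_X.
Qed.

Lemma tsgn_XX x y b : tsgn (tX x (tX y b)) = tX x (tX y (tsgn b)).
Proof. by rewrite tsgn_X tsgn_X (linN (tX_lin x)) opprK. Qed.

Lemma K0_sgn u : K0 u -> K0 (tsgn u).
Proof.
move: u; apply: (K0_ind (P := fun u => K0 (tsgn u))).
  exact: (lin_closed_comp K0_closed (@tsgn_lin k gT V)).
  move=> x y b; rewrite (lin_sum2 (@tsgn_lin k gT V) (tsgn_XX x y b) (tsgn_XX y x b)).
  exact: K0_antic.
by move=> x u Ku; rewrite tsgn_X; apply: (lcN K0_closed); apply: K0_X.
Qed.

Lemma tact_XX g x y b :
  tact g (tX x (tX y b)) = tvect (ydact g x) * (tvect (ydact g y) * tact g b).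
Proof. by rewrite tact_X tact_X. Qed.

Lemma tvect_mul v c : tvect v * c = \sum_i v i *: tX i c.
Proof.
rewrite /tvect mulr_suml; apply: eq_bigr => i _.
rewrite -tX_tvar; exact: esym (scalerAl _ _ _).
Qed.

Lemma tvect_anti v w c : tvect v * (tvect w * c) + tvect w * (tvect v * c) =
  \sum_i \sum_j ((v i * w j) *: (tX i (tX j c) + tX j (tX i c))).
Proof.
have E v' w' : tvect v' * (tvect w' * c) = \sum_i \sum_j (v' i * w' j) *: tX i (tX j c).
  rewrite tvect_mul; apply: eq_bigr => i _.
  rewrite tvect_mul (lin_big _ _ _ (tX_lin i)) scaler_sumr; apply: eq_bigr => j _.
  by rewrite (linZ (tX_lin i)) scalerA.
rewrite (E v w) (E w v) [X in _ + X]exchange_big -big_split; apply: eq_bigr => i _.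
rewrite -big_split; apply: eq_bigr => j _.
by rewrite scalerDr [w j * _]mulrC.
Qed.

Lemma K0_tact g u : K0 u -> K0 (tact g u).
Proof.
move: u; apply: (K0_ind (P := fun u => K0 (tact g u))).
  exact: (lin_closed_comp K0_closed (tact_lin g)).
  move=> x y b; rewrite (lin_sum2 (@tact_lin k gT V g) (tact_XX g x y b) (tact_XX g y x b)).
  rewrite tvect_anti.
  by apply: (lc_sum K0_closed) => i; apply: (lc_sum K0_closed) => j;
    apply: (lcZ K0_closed); apply: K0_antic.
by move=> x u Ku; rewrite tact_X; apply: K0_mull.
Qed.

Lemma ydegC x y : (deg x * deg y)%g = (deg y * deg x)%g.
Proof.
have [_ _ h] := hV; have := h (deg y) x x.
rewrite neg !ffunE eqxx oppr_eq0 oner_eq0 => /(_ isT) e.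
by rewrite {1}e mulgKV.
Qed.

Lemma tcomp_XX g x y b :
  tcomp g (tX x (tX y b)) = tX x (tX y (tcomp ((deg x * deg y)^-1 * g)%g b)).
Proof. by rewrite tcomp_X tcomp_X mulgA -invMg. Qed.

Lemma K0_tcomp g u : K0 u -> K0 (tcomp g u).
Proof.
move=> Ku; move: u Ku g; apply: (K0_ind (P := fun u => forall g, K0 (tcomp g u))).
- split=> [g|a x y Px Py g]; first by rewrite (lin0 (tcomp_lin g)); case: K0_closed.
  by rewrite (tcomp_lin g); case: K0_closed => _; apply.
- move=> x y b g; rewrite (lin_sum2 (@tcomp_lin k gT V g) (tcomp_XX g x y b) (tcomp_XX g y x b)) ydegC.
  exact: K0_antic.
- by move=> x u Ku g; rewrite tcomp_X; apply: K0_X.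
Qed.

(** Spans the kernel of the square of the projection onto the quotient. *)
Definition biideal : set (tensor TV TV) :=
  [set t | exists a b, (K0 a \/ K0 b) /\ t = a \ox b]%classic.
Local Notation J := (Defs.span biideal).

Lemma J_closed : lin_closed J.
Proof. exact: span_closed. Qed.

Lemma J_l a b : K0 a -> J (a \ox b).
Proof. by move=> Ka; apply: span_sub; exists a, b; split=> //; left. Qed.

Lemma J_r a b : K0 b -> J (a \ox b).
Proof. by move=> Kb; apply: span_sub; exists a, b; split=> //; right. Qed.

Lemma J_bX x t : J t -> J (bX x t).
Proof.
move: t; apply: (span_lin_ind (P := fun t => J (bX x t))).
  exact: (lin_closed_comp J_closed (bX_lin x)).
move=> _ [a [b [Kab ->]]]; rewrite bXE; apply: (lcD J_closed).
  by case: Kab => [Ka|Kb]; [apply/J_l/K0_X|apply: J_r].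
by case: Kab => [Ka|Kb]; [apply/J_l/K0_sgn|apply/J_r/K0_X].
Qed.

Lemma J_bXX x y t : J (bX x (bX y t) + bX y (bX x t)).
Proof.
move: t; apply: tens_ind.
- rewrite (lin0 (bX_lin x)) (lin0 (bX_lin y)) (lin0 (bX_lin x)) addr0.
  by case: J_closed.
- move=> a u v Ju Jv; rewrite (bX_lin y a) (bX_lin x a (bX y u)).
  rewrite (bX_lin x a u) (bX_lin y a (bX x u)) addrACA -scalerDr.
  exact: (proj2 J_closed a _ _ Ju Jv).
- move=> c d; rewrite !bX_bprim (bprim_anti (tX_lin x) (tX_lin y) (@tsgn_lin k gT V)).
  + by apply: (lcD J_closed); [apply: J_l; apply: K0_antic|apply: J_r; apply: K0_antic].
  + exact: tsgn_X.
  + exact: tsgn_X.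
  + exact: tsgnK.
Qed.

Lemma tcomul_XX x y b : tcomul (tX x (tX y b)) = bX x (bX y (tcomul b)).
Proof. by rewrite (tcomul_X hV neg) (tcomul_X hV neg). Qed.

Lemma tcomul_K0 u : K0 u -> J (tcomul u).
Proof.
move: u; apply: (K0_ind (P := fun u => J (tcomul u))).
  exact: (lin_closed_comp J_closed (@tcomul_lin k gT V)).
  move=> x y b; rewrite (lin_sum2 (@tcomul_lin k gT V) (tcomul_XX x y b) (tcomul_XX y x b)).
  exact: J_bXX.
by move=> x u Ju; rewrite (tcomul_X hV neg); apply: J_bX.
Qed.

Lemma tcounit_K0 u : K0 u -> tcounit (V := V) u = 0.
Proof.
move: u; apply: (K0_ind (P := fun u => tcounit u = 0)).
- split=> [|a x y Hx Hy]; first by rewrite (lin0 (@tcounit_lin k gT V)).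
  by rewrite (@tcounit_lin k gT V) Hx Hy scaler0 addr0.
- by move=> x y b; rewrite (lin_sum2 (@tcounit_lin k gT V) (tcounit_X x _) (tcounit_X y _)) addr0.
- by move=> x u _; rewrite tcounit_X.
Qed.

Lemma homog_antic x y : homog 2 (antic x y).
Proof.
move=> w; rewrite /antic -(tX_1 x) -(tX_1 y) -fmonom_nil !tX_cons => /(fsubsetP (msuppD_le _ _)).
by rewrite !msuppU oner_eq0 !inE => /orP[] /eqP ->.
Qed.

Lemma antic_candidate : @nichols_candidate k gT V K0.
Proof.
split; last by move=> u Ku; split; [exact: tcounit_K0|exact: tcomul_K0].
exists [set e | exists x y, e = antic x y]%classic; split=> [e [x [y ->]]|//].
by exists 2%N => //; apply: homog_antic.
Qed.

End NicholsIdeal.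

Lemma zmod_euler (M : zmodType) (a s e n : M) : a - s - (a + n) = e - n - (s + e).
Proof. by rewrite !opprD addrACA subrr [- s - e]addrC addrACA subrr [- n - s]addrC. Qed.

Section TensorContraction.
Variables (k : fieldType) (A : lmodType k).

Definition contr (phi : A -> k^o) (t : tensor A A) : A := \tsum_(a, b <- t) (phi a *: b).

Lemma contr_lin phi : lin phi -> lin (contr phi).
Proof. by move=> lphi; rewrite /contr; lin. Qed.

Lemma contrE phi a b : lin phi -> contr phi (a \ox b) = phi a *: b.
Proof. by move=> lphi; rewrite /contr tliftE //; lin. Qed.

Lemma eq_contr phi psi t : (forall a, phi a = psi a) -> contr phi t = contr psi t.
Proof. by move=> e; apply: eq_tlift => a b; rewrite e. Qed.

Lemma contr0 t : contr (fun _ => 0) t = 0.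
Proof. by rewrite -[RHS](@tlift0f k A A A t); apply: eq_tlift => a b; rewrite scale0r. Qed.

Lemma contrZ phi c t : contr (fun a => c *: phi a) t = c *: contr phi t.
Proof. by rewrite /contr -tliftZf; apply: eq_tlift => a b; rewrite scalerA. Qed.

Lemma contrN phi t : contr (fun a => - phi a) t = - contr phi t.
Proof. by rewrite /contr -tliftNf; apply: eq_tlift => a b; rewrite scaleNr. Qed.

Lemma contr_bprim phi f s t : lin phi -> lin f -> lin s ->
  contr phi (bprim f s t) = contr (fun c => phi (f c)) t + f (contr (fun c => phi (s c)) t).
Proof.
move=> lphi lf ls; rewrite /bprim (tlift_comp _ _ (contr_lin lphi)).
rewrite [in RHS]/contr (tlift_comp _ _ lf) -tliftDf; apply: eq_tlift => a b.
by rewrite (linD (contr_lin lphi)) !contrE // (linZ lf).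
Qed.

End TensorContraction.

Section Largest.
Variables (k : fieldType) (gT : finGroupType) (V : ydmod k gT).
Local Notation X := (ydX V).
Local Notation vect := {ffun X -> k^o}.
Local Notation TV := {malg k[{fmonom X}]}.
Local Notation tv := (@tvar k gT V).
Local Notation tX := (@tX k gT V).
Local Notation deg := (@yddeg k gT V).
Local Notation tact := (@tact k gT V).
Local Notation tcomp := (@tcomp k gT V).
Local Notation tcomul := (@tcomul k gT V).
Local Notation tsgn := (@tsgn k gT V).
Local Notation bX := (@bX k gT V).
Local Notation vb := (vbase (V := V)).
Hypothesis hV : is_ydmod V.
Hypothesis neg : forall x y, ydact (deg y) x = - vb x.

Hypothesis chark : [pchar k] =i pred0.
Local Notation K0 := (@antic_ideal k gT V).
Local Notation eps := (@tcounit k gT V : TV -> k^o).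

Let lX x : lin (tX x) := @tX_lin k gT V x.
Let lDel : lin tcomul := @tcomul_lin k gT V.
Let leps : lin eps := @tcounit_lin k gT V.
Let lS : lin tsgn := @tsgn_lin k gT V.
Let cK := @K0_closed k gT V.

Definition tco : X -> TV -> k^o := sealed (fun x u => u@_(FMonom [:: x])).

Lemma tcoE x u : tco x u = u@_(FMonom [:: x]).
Proof. by rewrite /tco sealedE. Qed.

Lemma eps_X x u : eps (tX x u) = 0.
Proof. exact: (tcounit_X x u). Qed.

Lemma tco_lin x : lin (tco x).
Proof. by move=> a u v; rewrite !tcoE (mcoeff_lin (FMonom [:: x])). Qed.

Lemma tco_X x y u : tco x (tX y u) = (y == x)%:R *: eps u.
Proof.
rewrite tcoE; case: eqP => [->|/eqP yx].
  by rewrite scale1r mcoeff_X tcounitE.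
by rewrite scale0r mcoeff_X0.
Qed.

Lemma tco_1 x : tco x 1 = 0.
Proof. by rewrite tcoE -fmonom_nil mcoeffU. Qed.

Lemma eps_sgn u : eps (tsgn u) = eps u.
Proof.
move: u; apply: (TV_eq (lin_comp lS leps) leps); first by rewrite tsgn1.
move=> x u _; rewrite tsgn_X; apply: etrans (linN leps (tX x (tsgn u))) _.
exact: etrans (congr1 -%R (tcounit_X x _)) (etrans (oppr0 _) (esym (tcounit_X x u))).
Qed.

Lemma tco_sgn x u : tco x (tsgn u) = - tco x u.
Proof.
move: u; apply: (TV_eq (lin_comp lS (tco_lin x)) (lin_opp (tco_lin x))).
  by rewrite tsgn1 tco_1 oppr0.
move=> y u _; rewrite tsgn_X; apply: etrans (linN (tco_lin x) _) _.
have E1 := tco_X x y (tsgn u); have E2 := tco_X x y u; rewrite E1 E2.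
by have -> := eps_sgn u.
Qed.

Lemma tcounitl u : contr eps (tcomul u) = u.
Proof.
move: u; apply: (TV_eq (lin_comp lDel (contr_lin leps)) (@lin_id _ _)).
  by rewrite tcomul1 (contrE _ _ leps) tcounit1 scale1r.
move=> x u IH; rewrite (tcomul_X hV neg) (contr_bprim _ leps (lX x) lS).
rewrite (eq_contr (psi := fun _ => 0) _ (fun a => tcounit_X x a)) contr0 add0r.
by rewrite (eq_contr _ eps_sgn) IH.
Qed.

(** Skew derivations of the tensor algebra. *)
Definition tder : X -> TV -> TV := sealed (fun x u => contr (tco x) (tcomul u)).

Lemma tderE x u : tder x u = contr (tco x) (tcomul u).
Proof. by rewrite /tder sealedE. Qed.

Lemma tder_lin x : lin (tder x).
Proof.
have -> : tder x = fun u => contr (tco x) (tcomul u) by apply/funext => u; exact: tderE.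
exact: lin_comp lDel (contr_lin (tco_lin x)).
Qed.

Lemma tder_1 x : tder x 1 = 0.
Proof. by rewrite tderE tcomul1 (contrE _ _ (tco_lin x)) tco_1 scale0r. Qed.

Lemma tder_X x y u : tder x (tX y u) = (y == x)%:R *: u - tX y (tder x u).
Proof.
rewrite tderE (tcomul_X hV neg) (contr_bprim _ (tco_lin x) (lX y) lS).
rewrite (eq_contr _ (tco_X x y)) contrZ tcounitl (eq_contr _ (tco_sgn x)) contrN.
by rewrite (linN (lX y)) tderE.
Qed.

Definition tnum : TV -> TV :=
  sealed (malg_lin (fun w : {fmonom X} => (size w)%:R *: << w >>)).

Lemma tnumU w : tnum << w >> = (size w)%:R *: << w >>.
Proof. by rewrite /tnum sealedE malg_linU. Qed.

Lemma tnum_lin : lin tnum. Proof. by rewrite /tnum sealedE; exact: lin_malg. Qed.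

Lemma tnum_1 : tnum 1 = 0.
Proof. by rewrite /tnum sealedE malg_lin1 scale0r. Qed.

Lemma tnum_X x u : tnum (tX x u) = tX x u + tX x (tnum u).
Proof.
move: u; apply: (malg_lin_eq (lin_comp (lX x) tnum_lin)
  (lin_add (lX x) (lin_comp tnum_lin (lX x)))) => -[w].
rewrite tX_cons !tnumU (linZ (lX x)) tX_cons.
have E : (size (x :: w))%:R = 1 + (size w)%:R :> k by rewrite -natr1 addrC.
by apply: etrans (congr1 (fun c : k => c *: << FMonom (x :: w) >>) E) _; rewrite scalerDl scale1r.
Qed.

(** The Euler operator, built from the skew derivations. *)
Definition teuler : TV -> TV := sealed (fun u => \sum_x tX x (tder x u)).

Lemma teulerE u : teuler u = \sum_x tX x (tder x u).
Proof. by rewrite /teuler sealedE. Qed.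

Lemma teuler_lin : lin teuler.
Proof.
have -> : teuler = fun u => \sum_x tX x (tder x u) by apply/funext => u; exact: teulerE.
by apply: lin_sum => x; exact: lin_comp (tder_lin x) (lX x).
Qed.

Lemma teuler_X y u :
  teuler (tX y u) = tX y u - \sum_x tX x (tX y (tder x u)).
Proof.
have E x : tX x (tder x (tX y u)) = (y == x)%:R *: tX x u - tX x (tX y (tder x u)).
  by rewrite tder_X (linB (lX x)) (linZ (lX x)).
rewrite teulerE (eq_bigr _ (fun x _ => E x)) big_split; congr (_ + _).
  rewrite (bigD1 y (P := xpredT) isT) big1; last first.
    by move=> x /negbTE xy; rewrite eq_sym xy scale0r.
  by apply: etrans (addr0 _) _; rewrite eqxx scale1r.
by rewrite sumrN.
Qed.

(** Euler's formula: by the skew Leibniz rule [tder_X], passing the derivations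
   through a generator costs an anticommutator for each of them. *)
Lemma teuler_num u : K0 (teuler u - tnum u).
Proof.
have lE := lin_add teuler_lin (lin_opp tnum_lin).
move: u; apply: (TV_ind (P := fun u => K0 (teuler u - tnum u))).
- exact: (lin_closed_comp cK lE).
- rewrite tnum_1 subr0 teulerE big1; first exact: (proj1 cK).
  by move=> x _; rewrite tder_1 (lin0 (lX x)).
- move=> y u IH.
  have S2 : \sum_x tX y (tX x (tder x u)) = tX y (teuler u).
    by rewrite teulerE (lin_big _ _ _ (lX y)).
  have -> : teuler (tX y u) - tnum (tX y u) =
      tX y (teuler u - tnum u) -
      \sum_x (tX x (tX y (tder x u)) + tX y (tX x (tder x u))).
    rewrite (linB (lX y)) tnum_X teuler_X.
    apply: etrans (zmod_euler _ _ (tX y (teuler u)) _) _.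
    apply: (congr1 (fun z => tX y (teuler u) - tX y (tnum u) - z)).
    by rewrite -S2 big_split.
  apply: (lcD cK); first exact: K0_X.
  apply: (lcN cK); apply: (lc_sum cK) => x; exact: K0_antic.
Qed.

Definition tproj : nat -> TV -> TV :=
  sealed (fun n => malg_lin (fun w : {fmonom X} => if size w == n then << w >> else 0)).

Lemma tproj_lin n : lin (tproj n). Proof. by rewrite /tproj sealedE; exact: lin_malg. Qed.

Lemma tprojU n (w : {fmonom X}) : tproj n << w >> = if size w == n then << w >> else 0.
Proof. by rewrite /tproj sealedE malg_linU. Qed.

Lemma tproj_1 n : tproj n 1 = (n == 0%N)%:R *: 1.
Proof.
rewrite /tproj sealedE malg_lin1 eq_sym fmonom_nil; case: (n == 0%N); first by rewrite scale1r.
by rewrite scale0r.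
Qed.

Lemma tproj_X n x u : tproj n.+1 (tX x u) = tX x (tproj n u).
Proof.
rewrite /tproj sealedE; apply: (malg_lin_cons _ (lX x)) => w /=; rewrite eqSS; case: (size w == n).
  by rewrite tX_cons.
by rewrite (lin0 (lX x)).
Qed.

Lemma tproj0_X x u : tproj 0 (tX x u) = 0.
Proof.
move: u; apply: (malg_lin_eq (lin_comp (lX x) (tproj_lin 0)) (@lin_zero _ _ _)) => -[w].
by rewrite tX_cons tprojU.
Qed.

Lemma tproj0 u : tproj 0 u = eps u *: 1.
Proof.
move: u; apply: (TV_eq (tproj_lin 0) (lin_scalel 1 leps)).
  by rewrite tproj_1 tcounit1.
by move=> x u _; rewrite tproj0_X tcounit_X scale0r.
Qed.

Lemma tproj_tder n x u : tder x (tproj n.+1 u) = tproj n (tder x u).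
Proof.
move: u n; apply: (TV_ind (P := fun u => forall n, tder x (tproj n.+1 u) = tproj n (tder x u))).
- split=> [n|a u v IHu IHv n].
    by rewrite (lin0 (tproj_lin _)) (lin0 (tder_lin x)) (lin0 (tproj_lin _)).
  by rewrite tproj_lin tder_lin IHu IHv tder_lin tproj_lin.
- by move=> n; rewrite tproj_1 scale0r tder_1 (lin0 (tder_lin x)) (lin0 (tproj_lin _)).
- move=> y u IH n; rewrite tproj_X tder_X tder_X.
  rewrite (linB (tproj_lin n)) (linZ (tproj_lin n)); congr (_ - _).
  case: n => [|n]; last by rewrite tproj_X IH.
  by rewrite tproj0_X tproj0 (linZ (tder_lin x)) tder_1 scaler0 (lin0 (lX y)).
Qed.

Lemma tnum_proj n u : tnum (tproj n u) = n%:R *: tproj n u.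
Proof.
have l1 := lin_comp (tproj_lin n) tnum_lin.
have l2 := lin_scale n%:R (tproj_lin n).
move: u; apply: (malg_lin_eq l1 l2) => w; rewrite tprojU.
case: eqP => [wn|_]; first by rewrite tnumU wn.
by rewrite (lin0 tnum_lin) scaler0.
Qed.

Lemma tproj_sum u : exists N, forall M, (N <= M)%N -> \sum_(n < M) tproj n u = u.
Proof.
pose T M v := \sum_(n < M) tproj n v.
have lT M : lin (T M) by apply: lin_sum => n; exact: tproj_lin.
move: u; apply: malg_ind => [|a u v [N1 h1] [N2 h2]|w].
- by exists 0%N => M _; exact: (lin0 (lT M)).
- exists (maxn N1 N2) => M; rewrite geq_max => /andP[le1 le2].
  by rewrite -[LHS]/(T M (a *: u + v)) lT [T M u]h1 // [T M v]h2.
exists (size w).+1 => M lt; rewrite (bigD1 (Ordinal lt) (P := xpredT) isT) big1.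
  by apply: etrans (addr0 _) _; rewrite tprojU eqxx.
move=> n; rewrite -val_eqE /= => ne; rewrite tprojU eq_sym.
by rewrite (negbTE ne).
Qed.

Definition deg_ge2 (u : TV) := eps u = 0 /\ forall x, tco x u = 0.

Lemma deg_ge2_closed : lin_closed deg_ge2.
Proof.
split=> [|a u v [u0 u1] [v0 v1]].
  by split=> [|x]; [rewrite (lin0 leps)|rewrite (lin0 (tco_lin x))].
split=> [|x]; first by rewrite leps u0 v0 scaler0 addr0.
by rewrite (tco_lin x) u1 v1 scaler0 addr0.
Qed.

Lemma deg_ge2_X x u : eps u = 0 -> deg_ge2 (tX x u).
Proof. by move=> u0; split=> [|y]; [exact: (eps_X x u)|rewrite tco_X u0 scaler0]. Qed.

Lemma malg_scaleU c (w : {fmonom X}) : << c *g w >> = c *: << w >> :> TV.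
Proof. by apply/malgP => v; rewrite mcoeffZ !mcoeffU mulrnAr mulr1. Qed.

Lemma word_scale_mul c x y (w : seq X) (b : TV) :
  << c *g FMonom [:: x, y & w] >> * b = c *: tX x (tX y (<< FMonom w >> * b)).
Proof.
have E := scalerAl c (<< FMonom [:: x, y & w] >> : TV) b.
rewrite malg_scaleU; apply: (eq_trans (esym E)); apply: (f_equal ( *:%R c)).
by rewrite -(tX_cons x (y :: w)) tX_mul -(tX_cons y w) tX_mul.
Qed.

Lemma deg_ge2_mul a e b n : (2 <= n)%N -> homog n e -> deg_ge2 (a * e * b).
Proof.
move=> n2 he; have cD := deg_ge2_closed.
move: a; apply: (TV_ind (P := fun a => deg_ge2 (a * e * b))).
- exact: (lin_closed_comp cD (lin_comp (tmul_linl e) (tmul_linl b))).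
- rewrite mul1r [e]monalgE mulr_suml big_seq.
  apply: (big_ind deg_ge2); [by case: cD|exact: (lcD cD)|move=> w we].
  have := he w we; case: w {we} => -[|x [|y w]] wn; rewrite -wn // in n2.
  have -> : << e@_(FMonom [:: x, y & w]) *g FMonom [:: x, y & w] >> * b =
      e@_(FMonom [:: x, y & w]) *: tX x (tX y (<< FMonom w >> * b)).
    exact: word_scale_mul.
  by apply: (lcZ cD); apply: deg_ge2_X; exact: (eps_X y _).
- move=> x a [a0 _]; rewrite tX_mul2; exact: deg_ge2_X.
Qed.

Section Candidate.
Variable S : set TV.
Hypothesis hS : @nichols_candidate k gT V S.

Lemma cand_ideal : exists E : set TV,
  (forall e, E e -> exists2 n, (2 <= n)%N & homog n e) /\ S = ideal_gen E.
Proof. by case: hS. Qed.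

Lemma cand_closed : lin_closed S.
Proof. by have [E [_ ->]] := cand_ideal; exact: span_closed. Qed.

Lemma cand_ge2 u : S u -> deg_ge2 u.
Proof.
have [E [hE ->]] := cand_ideal; move: u.
apply: (ideal_gen_ind deg_ge2_closed) => a e b /hE[n n2 he].
exact: deg_ge2_mul n2 he.
Qed.

(** The derivations apply a functional to the first factor of the coproduct. It
   vanishes on S, which has no component of degree 1, so that only the terms with
   second factor in S survive. *)
Lemma cand_tder x u : S u -> S (tder x u).
Proof.
move=> Su; have [_ /(_ u Su)[_]] := hS; rewrite tderE.
move: (tcomul u); apply: (span_lin_ind (P := fun t => S (contr (tco x) t))).
  exact: (lin_closed_comp cand_closed (contr_lin (tco_lin x))).
move=> _ [a [b [Sab ->]]]; rewrite (contrE _ _ (tco_lin x)).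
case: Sab => [Sa|Sb]; last exact: (lcZ cand_closed).
by rewrite (proj2 (cand_ge2 Sa)) scale0r; case: cand_closed.
Qed.

(** A homogeneous element of degree n > 0 is, up to the factor n and modulo the
   anticommutators, a combination of its skew derivatives, which remain in any
   candidate: candidates consist of combinations of anticommutators by induction
   on the degree. *)
Lemma cand_tproj n u : S u -> K0 (tproj n u).
Proof.
elim: n u => [|n IH] u Su.
  by rewrite tproj0 (proj1 (cand_ge2 Su)) scale0r; case: cK.
have n0 : n.+1%:R != 0 :> k by rewrite (proj1 (pcharf0P k) chark).
rewrite -[tproj _ _]scale1r -(mulVf n0) -scalerA; apply: (lcZ cK).
rewrite -tnum_proj -[tnum _](subKr (teuler (tproj n.+1 u))).
apply: (lcD cK); last by apply: (lcN cK); exact: teuler_num.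
rewrite teulerE; apply: (lc_sum cK) => x; apply: K0_X; rewrite tproj_tder.
by apply: IH; apply: cand_tder.
Qed.

Lemma cand_sub u : S u -> K0 u.
Proof.
move=> Su; have [N /(_ N (leqnn N)) <-] := tproj_sum u.
by apply: (lc_sum cK) => n; exact: cand_tproj.
Qed.

End Candidate.

Lemma nichols_unionE u : @nichols_union k gT V u <-> K0 u.
Proof.
split=> [[S hS Su]|Ku]; first exact: (@cand_sub S hS u Su).
by exists K0 => //; exact: antic_candidate.
Qed.

End Largest.

(** * Transport of structure and bosonization *)

Section Transport.
Variables (k : fieldType) (H A : hopf k) (f : H -> A) (g : A -> H).
Hypothesis hA : is_hopf A.
Hypothesis lf : lin f.
Hypotheses (fK : cancel f g) (gK : cancel g f).
Hypothesis fM : forall x y, f (hmul x y) = hmul (f x) (f y).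
Hypothesis f1 : f (hone H) = hone A.
Hypothesis fD : forall x, hcomul (f x) = tmap f f (hcomul x).
Hypothesis fe : forall x, hcounit (f x) = hcounit x.

Let finj : injective f := can_inj fK.
Let bA : is_bialgebra A. Proof. by case: hA. Qed.

Lemma transport_lin : lin g.
Proof. by move=> a x y; apply: finj; rewrite lf !gK. Qed.
Let lg := transport_lin.

Let gM x y : g (hmul x y) = hmul (g x) (g y).
Proof. by apply: finj; rewrite fM !gK. Qed.

Let tgK t : tmap g g (tmap f f t) = t.
Proof.
rewrite {1}/tmap tlift_tmap //; last by lin.
by rewrite -[RHS]tlift_id; apply: eq_tlift => a b; rewrite !fK.
Qed.

Lemma transport_comul a : hcomul (g a) = tmap g g (hcomul a).
Proof. by rewrite -[hcomul (g a)]tgK -fD gK. Qed.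

Let lDA : lin (@hcomul k A). Proof. exact: hcomul_lin. Qed.
Let leA : lin (@hcounit k A : A -> k^o). Proof. exact: hcounit_lin. Qed.

Lemma transport_bilin : bilin (@hmul k H).
Proof.
have bm := hmul_bilin bA.
split=> *; apply: finj; rewrite fM !lf !fM.
  by rewrite bm.1.
by rewrite bm.2.
Qed.

Let swg W (F : H -> H -> W : lmodType k) x : bilin F ->
  tlift F (hcomul x) = \tsum_(a, b <- hcomul (f x)) F (g a) (g b).
Proof. by move=> bF; rewrite -[x in LHS]fK transport_comul tlift_tmap. Qed.

Let lDH : lin (@hcomul k H).
Proof.
have lt := tmap_lin lg lg.
by move=> a x y; rewrite -[x]fK -[y]fK -lg !transport_comul lDA lt.
Qed.
#[local] Hint Resolve lg lDA leA lDH : lin.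

Lemma transport_coassoc x :
  \tsum_(a, b <- hcomul x) \tsum_(a1, a2 <- hcomul a) a1 \ox (a2 \ox b) =
  \tsum_(a, b <- hcomul x) a \ox (hcomul b : tensor H H).
Proof.
rewrite [LHS]swg; last by lin.
rewrite [RHS]swg; last by lin.
transitivity (\tsum_(a, b <- hcomul (f x)) \tsum_(a1, a2 <- hcomul a)
    (g a1 \ox (g a2 \ox g b))).
  apply: eq_tlift => a b; rewrite transport_comul tlift_tmap //; by lin.
rewrite (hcoassoc bA) ; last by split=> *; lin.
apply: eq_tlift => a b; rewrite transport_comul {1}/tmap.
by rewrite (tlift_comp _ _ (tens_linr (g a))).
Qed.

Lemma transport_bialgebra : is_bialgebra H.
Proof.
have bH := transport_bilin.
split.
- split=> [//|x y z|x|x]; apply: finj.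
  + by rewrite !fM (hmulA bA).
  + by rewrite fM f1 (hmul1 bA).
  + by rewrite fM f1 (hmulr1 bA).
- split=> [|||x|x].
  + exact: lDH.
  + by move=> a x y; rewrite -!fe lf leA.
  + exact: transport_coassoc.
  + rewrite swg; last first.
      have leH : lin (@hcounit k H : H -> k^o) by move=> a z y; rewrite -!fe lf leA.
      by lin.
    rewrite -[RHS]fK -[RHS](hcounitl bA _ lg); apply: eq_tlift => a b.
    by rewrite -fe gK.
  + rewrite swg; last first.
      have leH : lin (@hcounit k H : H -> k^o) by move=> a z y; rewrite -!fe lf leA.
      by lin.
    rewrite -[RHS]fK -[RHS](hcounitr bA _ lg); apply: eq_tlift => a b.
    by rewrite -fe gK.
- move=> x y; rewrite -[hmul x y]fK transport_comul fM (hcomulM bA).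
  rewrite (tmap_tmul (hmul_bilin bA) bH lg gM) -!transport_comul !fK.
  by [].
- have -> : hone H = g (hone A) by rewrite -f1 fK.
  by rewrite transport_comul (hcomul1 bA) tmapE.
- by split=> [x y|]; rewrite -!fe ?fM ?(hcounitM bA) // f1 (hcounit1 bA).
Qed.

Lemma transport_hopf : is_hopf H.
Proof.
split; first exact: transport_bialgebra.
have bH := transport_bilin; have [_ [S [lS SE]]] := hA.
have lS' : lin (S : A -> A) by [].
exists (fun x => g (S (f x))); split=> [a x y|x]; first by rewrite lf lS lg.
have [E1 E2] := SE (f x); rewrite fe in E1 E2; split.
  rewrite swg; last by lin.
  rewrite -[hone H]fK f1 -(linZ lg) -E1 (tlift_comp _ _ lg); apply: eq_tlift => a b.
  by rewrite gK gM.
rewrite swg; last by lin.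
rewrite -[hone H]fK f1 -(linZ lg) -E2 (tlift_comp _ _ lg); apply: eq_tlift => a b.
by rewrite gK gM.
Qed.

End Transport.

Section Boson.
Variables (k : fieldType) (m : nat) (omega : k) (r : nat).
Variable (I : r.-tuple (nat * nat)).
Local Notation X := ('I_r * bool)%type.
Local Notation G := (dihedral m).
Local Notation V := (MI m omega I).
Local Notation vect := {ffun X -> k^o}.
Local Notation c_ := (dcoef omega I).
Local Notation deg := (ddeg m omega I).
Local Notation vb := (vbase (V := V)).

(** The properties of the Nichols algebra that its bosonization relies on, stated
   for the multiplications [nx] by the generators and for the projection [n1] on
   degree 1. Together, [ba_XX], [ba_ind] and [ba_rec] say that B is the quotient of the
   free algebra by the anticommutators. *)
Record exterior (B : bhopf k G) (nx : X -> B -> B) (n1 : B -> vect) : Prop := Exterior {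
  ba_rec : forall (W : lmodType k) (Z : X -> W -> W) (w : W),
    (forall x, lin (Z x)) -> (forall x y w, Z x (Z y w) + Z y (Z x w) = 0) ->
    exists f : B -> W, [/\ lin f, f (bone B) = w & forall x b, f (nx x b) = Z x (f b)];
  ba_ind : forall P : B -> Prop, lin_closed P -> P (bone B) ->
    (forall x b, P b -> P (nx x b)) -> forall b, P b;
  ba_bm : bilin (@bmul k G B);
  ba_mul1 : forall b, bmul (bone B) b = b;
  ba_mulX : forall x a b, bmul (nx x a) b = nx x (bmul a b);
  ba_lx : forall x, lin (nx x);
  ba_XX : forall x y b, nx x (nx y b) + nx y (nx x b) = 0;
  ba_la : forall g, lin (@bact k G B g);
  ba_act1 : forall g, bact g (bone B) = bone B;
  ba_actX : forall g x b, bact g (nx x b) = c_ g x *: nx (dact g x) (bact g b);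
  ba_lc : forall g, lin (@bcomp k G B g);
  ba_comp1 : forall g, bcomp g (bone B) = if g == 1%g then bone B else 0;
  ba_compX : forall g x b, bcomp g (nx x b) = nx x (bcomp ((deg x)^-1 * g)%g b);
  ba_lD : lin (@bcomul k G B);
  ba_D1 : bcomul (bone B) = bone B \ox bone B;
  ba_DX : forall x b, bcomul (nx x b) =
    \tsum_(c, d <- bcomul b) (nx x c \ox d + bact (deg x) c \ox nx x d);
  ba_le : lin (@bcounit k G B : B -> k^o);
  ba_e1 : bcounit (bone B) = 1;
  ba_eX : forall x b, bcounit (nx x b) = 0;
  ba_l1 : lin n1;
  ba_11 : n1 (bone B) = 0;
  ba_1X : forall x b, n1 (nx x b) = bcounit b *: vb x
}.

Hypothesis (m1 : (1 < m)%N) (om : omega ^+ m = 1).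
Hypothesis key : forall s t, omega ^+ (fst_at I s * snd_at I t) = -1.
Variables (B : bhopf k G) (nx : X -> B -> B) (n1 : B -> vect).
Hypothesis xB : exterior nx n1.
Local Notation H := (bosonization B).
Local Notation BG := {ffun G -> B}.
Local Notation h1 := (hone H).

Let bm := ba_bm xB.
Let lx := ba_lx xB.
Let la := ba_la xB.
Let lc := ba_lc xB.
Let lD := ba_lD xB.
Let le := ba_le xB.
#[local] Hint Resolve lx la lc lD le : lin.

Lemma actgM g h b : bact (g * h)%g b = bact g (bact h b) :> B.
Proof.
move: b; apply: (ba_ind xB (P := fun b => bact (g * h)%g b = bact g (bact h b))).
- split=> [|a x y IHx IHy]; first by rewrite !(lin0 (la _)).
  by rewrite !(la _ a) IHx IHy.
- by rewrite !(ba_act1 xB).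
- move=> x b IH; rewrite !(ba_actX xB) (linZ (la g)) (ba_actX xB) IH scalerA.
  by rewrite dactM (dcoefM I m1 om) mulrC.
Qed.

Lemma actg1 b : bact 1%g b = b :> B.
Proof.
move: b; apply: (ba_ind xB (P := fun b => bact 1%g b = b)).
- split=> [|a x y IHx IHy]; first by rewrite (lin0 (la _)).
  by rewrite (la _ a) IHx IHy.
- exact: ba_act1 xB _.
- by move=> x b IH; rewrite (ba_actX xB) dact1 dcoef1 IH scale1r.
Qed.

Lemma smash_lin g : lin (fun b : B => smash b g : H).
Proof.
move=> a b b'; apply/ffunP => h; rewrite !ffunE; case: eqP => // _.
by rewrite scaler0 addr0.
Qed.

Lemma ffun_lin (g : G) : lin (fun u : H => (u : BG) g).
Proof. by move=> a u v; rewrite !ffunE. Qed.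
#[local] Hint Resolve smash_lin ffun_lin : lin.

Lemma smash_sum (u : H) : u = \sum_g (smash ((u : BG) g) g : H).
Proof.
apply/ffunP => h; rewrite sum_ffunE (bigD1 h) //= big1 => [|g gh].
  by rewrite ffunE eqxx addr0.
by rewrite ffunE eq_sym (negbTE gh).
Qed.

Definition bosX (x : X) (u : H) : H := [ffun h => nx x ((u : BG) h)].
Definition bosL (g : G) (u : H) : H := [ffun h => bact g ((u : BG) (g^-1 * h)%g)].
Definition bosel (g : G) : H := smash (bone B) g.

Lemma bosX_lin x : lin (bosX x).
Proof. by move=> a u v; apply/ffunP => h; rewrite !ffunE (lx x). Qed.

Lemma bosL_lin g : lin (bosL g).
Proof. by move=> a u v; apply/ffunP => h; rewrite !ffunE (la g). Qed.
#[local] Hint Resolve bosX_lin bosL_lin : lin.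

Lemma bosX_smash x b g : bosX x (smash b g) = smash (nx x b) g.
Proof.
apply/ffunP => h; rewrite !ffunE; case: eqP => // _.
exact: lin0 (lx x).
Qed.

Lemma bosL_smash h b g : bosL h (smash b g) = smash (bact h b) (h * g)%g.
Proof.
apply/ffunP => h'; rewrite !ffunE -(can2_eq (mulKVg h) (mulKg h)).
by case: eqP => // _; exact: lin0 (la h).
Qed.

Lemma bos_ind (P : H -> Prop) : lin_closed P -> (forall g, P (bosel g)) ->
  (forall x u, P u -> P (bosX x u)) -> forall u, P u.
Proof.
move=> cP Pe PX u; rewrite [u]smash_sum; apply: (lc_sum cP) => g.
move: ((u : BG) g); apply: (ba_ind xB (P := fun b => P (smash b g))).
- exact: (lin_closed_comp cP (smash_lin g)).
- exact: Pe.
- by move=> x b Pb; rewrite -bosX_smash; apply: PX.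
Qed.

Lemma bosL_el g h : bosL g (bosel h) = bosel (g * h)%g.
Proof. by rewrite bosL_smash (ba_act1 xB). Qed.

Lemma bosLX g x u : bosL g (bosX x u) = c_ g x *: bosX (dact g x) (bosL g u).
Proof. by apply/ffunP => h; rewrite !ffunE (ba_actX xB). Qed.

Lemma bos_uniform : uniform omega I (fun _ _ => 0) bosL bosX.
Proof.
split=> [u|x|w|u v w|u x w|x y w].
- exact: bosL_lin.
- exact: bosX_lin.
- by apply/ffunP => h; rewrite !ffunE invg1 mul1g actg1.
- by apply/ffunP => h; rewrite !ffunE actgM invMg mulgA.
- exact: bosLX.
- by rewrite scale0r; apply/ffunP => h; rewrite !ffunE (ba_XX xB).
Qed.

Lemma bos_mul_bilin : bilin (@hmul k H).
Proof.
have lS (J : finType) (F : J -> H -> H) : (forall i, lin (F i)) -> lin (fun u => \sum_i F i u).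
  by move=> lF; apply: lin_sum.
apply: bilinI => [v|u]; rewrite /hmul /= /boson_mul.
  apply: (lS G (fun g u => \sum_h smash (bmul ((u : BG) g) (bact g ((v : BG) h))) (g * h)%g)) => g.
  apply: (lS G (fun h u => smash (bmul ((u : BG) g) (bact g ((v : BG) h))) (g * h)%g)) => h.
  apply: lin_comp (smash_lin _); exact: lin_comp (ffun_lin g) (bilin_l _ bm).
apply: (lS G (fun g v => \sum_h smash (bmul ((u : BG) g) (bact g ((v : BG) h))) (g * h)%g)) => g.
apply: (lS G (fun h v => smash (bmul ((u : BG) g) (bact g ((v : BG) h))) (g * h)%g)) => h.
apply: lin_comp (smash_lin _); apply: lin_comp (bilin_r _ bm).
exact: lin_comp (ffun_lin h) (la g).
Qed.

Lemma bos_mulX x u v : hmul (bosX x u) v = bosX x (hmul u v).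
Proof.
rewrite /hmul /= /boson_mul (lin_big _ _ _ (bosX_lin x)); apply: eq_bigr => g _.
rewrite (lin_big _ _ _ (bosX_lin x)); apply: eq_bigr => h _.
by rewrite bosX_smash ffunE (ba_mulX xB).
Qed.

Lemma bos_mul_el g v : hmul (bosel g) v = bosL g v.
Proof.
rewrite /hmul /= /boson_mul (bigD1 g) //= [X in _ + X]big1 => [|g' /negbTE gg].
  rewrite addr0 ffunE eqxx; apply/ffunP => h; rewrite sum_ffunE (bigD1 (g^-1 * h)%g) //=.
  rewrite big1 => [|h' hh]; first by rewrite ffunE mulKVg eqxx addr0 (ba_mul1 xB) ffunE.
  rewrite ffunE; case: eqP => // e; move: hh; rewrite e mulKg eqxx.
  by [].
by apply: big1 => h _; rewrite ffunE gg (bilin0l bm) (lin0 (smash_lin _)).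
Qed.

Let F2 g (x1 x2 : B) : tensor H H :=
  \sum_(h : G) (smash x1 (h * g)%g : H) \ox (smash (bcomp h x2) g : H).

Let bF2 g : bilin (F2 g).
Proof.
rewrite /F2; apply: bilinI => [y|x]; apply: lin_sum => h.
  exact: lin_comp (smash_lin _) (tens_linl _).
exact: lin_comp (lin_comp (lc h) (smash_lin g)) (tens_linr _).
Qed.

Lemma bos_comulE u : hcomul u = \sum_g tlift (F2 g) (bcomul ((u : BG) g)) :> tensor H H.
Proof. by []. Qed.

Lemma bos_comul_lin : lin (@hcomul k H).
Proof.
rewrite /hcomul /= /boson_comul; apply: lin_sum => g.
exact: lin_comp (lin_comp (ffun_lin g) lD) (tlift_lin (bF2 g)).
Qed.

Lemma bos_comul_el g : hcomul (bosel g) = bosel g \ox bosel g.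
Proof.
rewrite bos_comulE (bigD1 g) //= [X in _ + X]big1 => [|h /negbTE hg].
  rewrite addr0 ffunE eqxx (ba_D1 xB) tliftE // /F2 (bigD1 1%g) //= big1 => [|h /negbTE h1].
    by rewrite addr0 mul1g (ba_comp1 xB) eqxx.
  by rewrite (ba_comp1 xB) h1 (lin0 (smash_lin g)) (lin0 (tens_linr _)).
by rewrite ffunE hg (lin0 lD) (lin0 (tlift_lin (bF2 h))).
Qed.

(** The coaction in the coproduct of the bosonization turns the braided rule for a
   generator into the one for a skew-primitive element. *)
Lemma bos_comulX x u : hcomul (bosX x u) =
  \tsum_(c, d <- hcomul u) (bosX x c \ox d + bosL (deg x) c \ox bosX x d) :> tensor H H.
Proof.
set T := fun c d : H => _; have bT : bilin T by rewrite /T; lin.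
rewrite !bos_comulE (lin_big _ _ _ (tlift_lin bT)); apply: eq_bigr => g _.
rewrite ffunE (ba_DX xB) (tlift_comp _ _ (tlift_lin (bF2 g))) (tlift_comp _ _ (tlift_lin bT)).
apply: eq_tlift => c d; rewrite (linD (tlift_lin (bF2 g))) !tliftE //.
apply: esym; apply: etrans (lin_big _ _ _ (tlift_lin bT)) _.
have E h : tlift T ((smash c (h * g)%g : H) \ox (smash (bcomp h d) g : H)) =
    (smash (nx x c) (h * g)%g : H) \ox (smash (bcomp h d) g : H) +
    (smash (bact (deg x) c) (deg x * h * g)%g : H) \ox
    (smash (bcomp (deg x * h)%g (nx x d)) g : H).
  apply: etrans (tliftE _ _ bT) _.
  by rewrite /T !bosX_smash bosL_smash (ba_compX xB) mulKg mulgA.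
apply: etrans (eq_bigr _ (fun h _ => E h)) _; apply: etrans (big_split _ _ _ _ _) _.
have R : F2 g (bact (deg x) c) (nx x d) = \sum_h
    (smash (bact (deg x) c) (deg x * h * g)%g : H) \ox
    (smash (bcomp (deg x * h)%g (nx x d)) g : H).
  exact: (reindex_inj (mulgI (deg x))).
exact: (f_equal (fun z => F2 g (nx x c) d + z) (esym R)).
Qed.

Lemma bos_counit_lin : lin (@hcounit k H : H -> k^o).
Proof. rewrite /hcounit /=; apply: lin_sum => g; exact: lin_comp (ffun_lin g) le. Qed.

Lemma bos_counit_el g : hcounit (bosel g) = 1.
Proof.
rewrite /hcounit /= (bigD1 g) //= big1 => [|h /negbTE hg].
  by rewrite ffunE eqxx (ba_e1 xB) addr0.
by rewrite ffunE hg (lin0 le).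
Qed.

Lemma bos_counitX x u : hcounit (bosX x u) = 0.
Proof. by rewrite /hcounit /=; apply: big1 => g _; rewrite ffunE (ba_eX xB). Qed.

End Boson.

Section BosonIso.
Variables (k : fieldType) (m : nat) (omega : k) (r : nat).
Variable (I : r.-tuple (nat * nat)).
Local Notation X := ('I_r * bool)%type.
Local Notation G := (dihedral m).
Local Notation V := (MI m omega I).
Local Notation vect := {ffun X -> k^o}.
Local Notation c_ := (dcoef omega I).
Local Notation deg := (ddeg m omega I).
Local Notation vb := (vbase (V := V)).
Hypothesis (m1 : (1 < m)%N) (om : omega ^+ m = 1).
Variables (B : bhopf k G) (nx : X -> B -> B) (n1 : B -> vect).
Hypothesis xB : exterior omega I nx n1.
Local Notation H := (bosonization B).
Local Notation BG := {ffun G -> B}.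
Local Notation h1 := (hone H).
Local Notation Lam0 := (fun _ _ : X => 0 : k).
Local Notation bosX := (bosX nx).
Local Notation bosel := (@bosel k m B).

Definition bosax (x : X) : H := bosX x h1.
Definition bosD (u : H) : vect := \sum_g n1 ((u : BG) g).

Lemma bosD_lin : lin bosD.
Proof.
apply: lin_sum => g; exact: lin_comp (ffun_lin g) (ba_l1 xB).
Qed.

Lemma bosD_el g : bosD (bosel g) = 0.
Proof.
rewrite /bosD big1 // => h _; rewrite ffunE; case: eqP => _; first exact: ba_11 xB.
exact: lin0 (ba_l1 xB).
Qed.

Lemma bosD_X x u : bosD (bosX x u) = hcounit u *: vb x.
Proof.
rewrite /bosD /hcounit /= scaler_suml; apply: eq_bigr => g _.
by rewrite ffunE (ba_1X xB).
Qed.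

Lemma bosL_1 u : bosL 1%g u = u :> H.
Proof. exact: uni_1 (bos_uniform m1 om xB) u. Qed.

Lemma bos_mul_ax x u : hmul (bosax x) u = bosX x u.
Proof. by rewrite (bos_mulX xB) (bos_mul_el xB) bosL_1. Qed.

Section Compare.
Variables (A : hopf k) (elA : G -> A) (axA : X -> A) (DA : A -> vect).
Hypothesis dA : dalg omega I Lam0 elA axA DA.
Hypothesis uA : universal omega I Lam0 elA axA.
Local Notation "x ** y" := (@hmul k A x y) (at level 40, left associativity).
Let bA : is_bialgebra A := da_bialg dA.
Let bmA := hmul_bilin bA.
Let leA : lin (@hcounit k A : A -> k^o). Proof. exact: hcounit_lin. Qed.
Let lDA : lin (@hcomul k A). Proof. exact: hcomul_lin. Qed.
Let lml y : lin (fun x => x ** y). Proof. exact: hmul_linl. Qed.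
Let lmr x : lin (fun y => x ** y). Proof. exact: hmul_linr. Qed.

Let F x (a b : A) : tensor A A := (axA x ** a) \ox b + (elA (deg x) ** a) \ox (axA x ** b).

Let bF x : bilin (F x).
Proof.
rewrite /F; apply: bilinI => a; apply: lin_add.
- exact: lin_comp (lmr _) (tens_linl _).
- exact: lin_comp (lmr _) (tens_linl _).
- exact: tens_linr.
- exact: lin_comp (lmr _) (tens_linr _).
Qed.

Let comulX x a : hcomul (axA x ** a) = tlift (F x) (hcomul a).
Proof.
rewrite -[LHS]tlift_id (swX dA); last exact: tens_bilin.
exact: esym (tliftDf _ _ _).
Qed.

Section Map.
Variable f : H -> A.
Hypothesis lf : lin f.
Hypothesis fel : forall g, f (bosel g) = elA g.
Hypothesis fX : forall x u, f (bosX x u) = axA x ** f u.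
#[local] Hint Resolve lf lml lmr leA lDA : lin.

Lemma bosmap_L g u : f (bosL g u) = elA g ** f u.
Proof.
have lL := bosL_lin xB g.
move: u; apply: (bos_ind xB (P := fun u => f (bosL g u) = elA g ** f u)).
- split=> [|a u v Hu Hv]; first by rewrite (lin0 lL) (lin0 lf) (bilin0r bmA).
  by rewrite lL !lf Hu Hv bmA.2.
- by move=> h; rewrite (bosL_el xB) !fel (ur_M (da_rel dA)).
- by move=> x u IH; rewrite (bosLX xB) (linZ lf) !fX IH (LX dA).
Qed.

Lemma bosmap_M u v : f (hmul u v) = f u ** f v.
Proof.
have bH := bos_mul_bilin xB.
move: u; apply: (bos_ind xB (P := fun u => f (hmul u v) = f u ** f v)).
- split=> [|a u w Hu Hv]; first by rewrite (bilin0l bH) (lin0 lf) (bilin0l bmA).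
  by rewrite bH.1 !lf Hu Hv bmA.1.
- by move=> g; rewrite (bos_mul_el xB) bosmap_L fel.
- by move=> x u IH; rewrite (bos_mulX xB) !fX IH (hmulA bA).
Qed.

Lemma bosmap_counit u : hcounit (f u) = hcounit u.
Proof.
have le := bos_counit_lin xB.
move: u; apply: (bos_ind xB (P := fun u => hcounit (f u) = hcounit u)).
- split=> [|a u v Hu Hv]; first by rewrite (lin0 le) (lin0 lf) (lin0 leA).
  by rewrite le lf leA Hu Hv.
- by move=> g; rewrite fel (da_eel dA) (bos_counit_el xB).
- by move=> x u _; rewrite fX (hcounitM bA) (da_eax dA) mul0r (bos_counitX xB).
Qed.

Lemma bosmap_comul u : hcomul (f u) = tmap f f (hcomul u).
Proof.
have lD := bos_comul_lin xB; have lt := tmap_lin lf lf.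
have lX x := bosX_lin xB x; have lL g := bosL_lin xB g.
move: u; apply: (bos_ind xB (P := fun u => hcomul (f u) = tmap f f (hcomul u))).
- split=> [|a u v Hu Hv]; first by rewrite (lin0 lD) (lin0 lf) (lin0 lDA) (lin0 lt).
  by rewrite lD lf lDA lt Hu Hv.
- by move=> g; rewrite fel (da_Del dA) (bos_comul_el xB) tmapE // fel.
- move=> x u IH; rewrite fX comulX IH (tlift_tmap _ lf lf (bF x)).
  rewrite (bos_comulX xB) (tlift_comp _ _ lt); apply: eq_tlift => c d.
  by rewrite (linD lt) (tmapE _ _ lf lf) (tmapE _ _ lf lf) !fX bosmap_L.
Qed.

End Map.

(** The bosonization maps to A by multiplying out, and A maps back because the
   operators [bosL] and [bosX] satisfy its relations; both composites fix the
   generators. *)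
Lemma bos_iso : exists f : H -> A, exists g : A -> H,
  [/\ lin f, cancel f g, cancel g f, f h1 = hone A & forall g, f (bosel g) = elA g] /\
  [/\ forall x u, f (bosX x u) = axA x ** f u,
      forall u v, f (hmul u v) = f u ** f v,
      forall u, hcomul (f u) = tmap f f (hcomul u) &
      forall u, hcounit (f u) = hcounit u].
Proof.
have XX0 x y a : axA x ** (axA y ** a) + axA y ** (axA x ** a) = 0.
  by rewrite (XX dA) scale0r.
have [phi [lphi phi1 phiX]] := ba_rec xB (hone A) (fun x => lmr (axA x)) XX0.
pose f (u : H) := \sum_g phi ((u : BG) g) ** elA g.
have lf : lin f.
  apply: lin_sum => g; exact: lin_comp (lin_comp (ffun_lin g) lphi) (lml _).
have fel g : f (bosel g) = elA g.
  rewrite /f (bigD1 g) //= big1 => [|h /negbTE hg].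
    by rewrite addr0 ffunE eqxx phi1 (hmul1 bA).
  by rewrite ffunE hg (lin0 lphi) (bilin0l bmA).
have fX x u : f (bosX x u) = axA x ** f u.
  rewrite /f (lin_big _ _ _ (lmr _)); apply: eq_bigr => g _.
  by rewrite ffunE phiX (hmulA bA).
have [g [lg g1 gel gax]] := uA h1 (bos_uniform m1 om xB).
exists f, g; split; split=> //.
- apply: (bos_ind xB (P := fun u => g (f u) = u)) => [|h|x u IH].
  + split=> [|a u v Hu Hv]; first by rewrite (lin0 lf) (lin0 lg).
    by rewrite lf lg Hu Hv.
  + rewrite fel -[elA h](hmulr1 bA) gel g1 (bosL_el xB) mulg1.
    by [].
  + by rewrite fX gax IH.
- apply: (da_ind dA (P := fun a => f (g a) = a)) => [||u a IH|x a IH].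
  + split=> [|a u v Hu Hv]; first by rewrite (lin0 lg) (lin0 lf).
    by rewrite lg lf Hu Hv.
  + by rewrite g1 fel (ur_1 (da_rel dA)).
  + by rewrite gel (bosmap_L lf fel fX) IH.
  + by rewrite gax fX IH.
- by rewrite fel (ur_1 (da_rel dA)).
- exact: bosmap_M lf fel fX.
- exact: bosmap_comul lf fel fX.
- exact: bosmap_counit lf fel fX.
Qed.

Lemma bos_hopf : is_hopf A -> is_hopf H.
Proof.
move=> hA; have [f [g [[lf fK gK f1 _] [_ fM fD fe]]]] := bos_iso.
exact: transport_hopf hA lf fK gK fM f1 fD fe.
Qed.

Lemma bos_universal : universal omega I Lam0 bosel bosax.
Proof.
move=> W L Z w uLZ; have [f [g [[lf fK gK f1 fel] [fX fM fD fe]]]] := bos_iso.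
have [a [la a1 ael aax]] := uA w uLZ.
exists (fun u => a (f u)); split=> [||u v|x v]; first exact: lin_comp lf la.
- by rewrite f1.
- by rewrite fM fel ael.
- by rewrite bos_mul_ax fX aax.
Qed.

End Compare.

Hypothesis hH : is_hopf H.

Lemma bos_dalg : dalg omega I Lam0 bosel bosax bosD.
Proof.
have bH : is_bialgebra H by case: hH.
have bm := hmul_bilin bH; have lD := bos_comul_lin xB; have le := bos_counit_lin xB.
split=> //.
- apply: (uniform_urel (hmulr1 bH)).
  have -> : (fun u => hmul (bosel u)) = @bosL k m B.
    by apply/funext => g; apply/funext => u; exact: bos_mul_el xB g u.
  have -> : (fun x => hmul (bosax x)) = bosX.
    by apply/funext => x; apply/funext => u; exact: bos_mul_ax.
  exact: (bos_uniform m1 om xB).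
- move=> P cP P1 PL PX; apply: (bos_ind xB cP) => [g|x u Pu].
    by rewrite -[bosel g](hmulr1 bH); apply: PL.
  by rewrite -bos_mul_ax; apply: PX.
- exact: bos_comul_el xB.
- move=> x; rewrite (bos_comulX xB) (hcomul1 bH) tliftE.
    by rewrite (bosL_el xB) mulg1.
  have lX x' := bosX_lin xB x'; have lL g := bosL_lin xB g.
  by lin.
- exact: bos_counit_el xB.
- by move=> x; exact: (bos_counitX xB x h1).
- exact: bosD_lin.
- exact: bosD_el.
- move=> g u; rewrite (bos_mul_el xB).
  have lL := bosL_lin xB g; have lv := @vact_lin k m omega r I g; have ld := bosD_lin.
  move: u; apply: (bos_ind xB (P := fun u => bosD (bosL g u) = vact (V := V) g (bosD u))).
  + split=> [|a u v Hu Hv]; first by rewrite (lin0 lL) (lin0 ld) (lin0 lv).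
    by rewrite lL ld ld lv Hu Hv.
  + by move=> h; rewrite (bosL_el xB) !bosD_el (lin0 lv).
  + move=> x u IH; rewrite (bosLX xB) (linZ ld) !bosD_X (linZ lv) vact_base.
    have -> : hcounit (bosL g u) = hcounit u.
      by rewrite -(bos_mul_el xB) (hcounitM bH) (bos_counit_el xB) mul1r.
    by rewrite !scalerA mulrC.
- by move=> x u; rewrite bos_mul_ax bosD_X.
Qed.

Lemma bos_word w g :
  bword bosel bosax w g = smash (foldr nx (bone B) w) g :> H.
Proof.
elim: w => [//|x w IH]; apply: etrans (bos_mul_ax x (bword bosel bosax w g)) _.
rewrite IH; exact: bosX_smash xB x _ g.
Qed.

End BosonIso.

(** * The Nichols algebra of M_I *)

Lemma tmap_bprim (k : fieldType) (A B : lmodType k) (p : A -> B) (f s : A -> A)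
    (f' s' : B -> B) t : lin p -> lin f -> lin s -> lin f' -> lin s' ->
  (forall c, p (f c) = f' (p c)) -> (forall c, p (s c) = s' (p c)) ->
  tmap p p (bprim f s t) = bprim f' s' (tmap p p t).
Proof.
move=> lp lf ls lf' ls' pf ps; have lt := tmap_lin lp lp.
rewrite {1}/bprim (tlift_comp _ _ lt) /bprim tlift_tmap //; last by lin.
by apply: eq_tlift => c d; rewrite (linD lt) !tmapE // !pf ps.
Qed.

Section NicholsMI.
Variables (k : fieldType) (m : nat) (omega : k) (r : nat).
Variable (I : r.-tuple (nat * nat)).
Local Notation X := ('I_r * bool)%type.
Local Notation G := (dihedral m).
Local Notation V := (MI m omega I).
Local Notation vect := {ffun X -> k^o}.
Local Notation TV := {malg k[{fmonom (ydX V)}]}.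
Local Notation tX := (@tX k G V).
Local Notation tact := (@tact k G V).
Local Notation tcomp := (@tcomp k G V).
Local Notation tcomul := (@tcomul k G V).
Local Notation tsgn := (@tsgn k G V).
Local Notation tco := (@tco k G V).
Local Notation eps := (@tcounit k G V : TV -> k^o).
Local Notation K0 := (@antic_ideal k G V).
Local Notation vb := (vbase (V := V)).
Local Notation deg := (ddeg m omega I).
Hypothesis (m1 : (1 < m)%N) (om : omega ^+ m = 1).
Hypothesis key : forall s t, omega ^+ (fst_at I s * snd_at I t) = -1.
Hypothesis chark : [pchar k] =i pred0.

Let hV : is_ydmod V := MI_ydmod I m1 om.

Lemma MI_neg (x y : ydX V) : ydact (yddeg y) x = - vb x.
Proof.
rewrite [LHS](MI_actE omega I) (dcoef_deg m1 om key) dact_deg.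
exact: scaleN1r.
Qed.

Local Notation N := (nichols V).
Local Notation S := (@nichols_union k G V).
Local Notation pi := (vpi S : TV -> N).

Let SK u : S u <-> K0 u := nichols_unionE hV MI_neg chark u.

Let lX x : lin (tX x) := @tX_lin k G V x.
Let lpi : lin pi := @vpi_lin k TV S.

Lemma pi_K0 u : K0 u -> pi u = 0.
Proof.
move=> /SK Su; rewrite -(lin0 lpi); apply/vpiP; rewrite subr0.
exact: span_sub.
Qed.

Lemma quot_E (W : lmodType k) (F : TV -> W) u : lin F ->
  (forall v, K0 v -> F v = 0) -> F (vrepr (pi u)) = F u.
Proof. by move=> lF FK; apply: vquot_lin => // v /SK; apply: FK. Qed.

Lemma quot_lin (W : lmodType k) (F : TV -> W) : lin F ->
  (forall v, K0 v -> F v = 0) -> lin (fun b : N => F (vrepr b)).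
Proof. by move=> lF FK; apply: vquot_lift_lin => // v /SK; apply: FK. Qed.

Lemma N_pi (b : N) : exists u, b = pi u.
Proof. by exists (vrepr b); rewrite vreprK. Qed.

Definition nichX (x : X) (b : N) : N := pi (tX x (vrepr b)).

Let KX x u : K0 u -> pi (tX x u) = 0.
Proof. by move=> Ku; apply: pi_K0; apply: K0_X. Qed.

Lemma nichX_lin x : lin (nichX x).
Proof. exact: quot_lin (lin_comp (lX x) lpi) (KX x). Qed.

Lemma nichX_pi x u : nichX x (pi u) = pi (tX x u).
Proof. exact: quot_E (lin_comp (lX x) lpi) (KX x). Qed.

Let l_mull (a : TV) : lin (fun b : TV => pi (a * b)).
Proof. exact: lin_comp (tmul_lin a) lpi. Qed.
Let l_mulr (b : TV) : lin (fun a : TV => pi (a * b)).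
Proof. exact: lin_comp (tmul_linl b) lpi. Qed.
Let k_mull a v : K0 v -> pi (a * v) = 0.
Proof. by move=> Kv; apply: pi_K0; apply: K0_mull. Qed.
Let k_mulr b v : K0 v -> pi (v * b) = 0.
Proof. by move=> Kv; apply: pi_K0; apply: K0_mulr. Qed.

Lemma nich_mul_pi a b : @bmul k G N (pi a) (pi b) = pi (a * b).
Proof.
apply: etrans (quot_E a (l_mulr (vrepr (pi b))) (k_mulr _)) _.
exact: (quot_E b (l_mull a) (k_mull a)).
Qed.

Lemma nich_mul_bilin : bilin (@bmul k G N).
Proof.
apply: bilinI => [y|x].
  exact: (quot_lin (l_mulr (vrepr y)) (k_mulr _)).
exact: (quot_lin (l_mull (vrepr x)) (k_mull _)).
Qed.

Lemma nichX_mul x a b : @bmul k G N (nichX x a) b = nichX x (bmul a b).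
Proof.
have [u ->] := N_pi a; have [v ->] := N_pi b.
rewrite nichX_pi !nich_mul_pi nichX_pi; congr pi; exact: tX_mul.
Qed.

Lemma nich_ind (P : N -> Prop) : lin_closed P -> P (bone N) ->
  (forall x b, P b -> P (nichX x b)) -> forall b, P b.
Proof.
move=> cP P1 PX b; have [u ->] := N_pi b; move: u.
apply: (TV_ind (P := fun u => P (pi u))).
- exact: (lin_closed_comp cP lpi).
- exact: P1.
- by move=> x u Pu; rewrite -nichX_pi; apply: PX.
Qed.

Lemma fact_tX (W : lmodType k) (Z : ydX V -> W -> W) x u w : (forall x, lin (Z x)) ->
  fact Z (tX x u) w = Z x (fact Z u w).
Proof. by move=> lZ; rewrite -tX_tvar; apply: fact_cons. Qed.

Lemma nich_rec (W : lmodType k) (Z : X -> W -> W) (w : W) : (forall x, lin (Z x)) ->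
  (forall x y w, Z x (Z y w) + Z y (Z x w) = 0) ->
  exists f : N -> W, [/\ lin f, f (bone N) = w & forall x b, f (nichX x b) = Z x (f b)].
Proof.
move=> lZ ZZ; pose F (u : TV) := fact (Z : ydX V -> W -> W) u w.
have lF : lin F by exact: fact_linl.
have FX x u : F (tX x u) = Z x (F u) by exact: fact_tX.
have F1 : F 1 = w by exact: fact1.
have FK u : K0 u -> F u = 0.
  move: u; apply: (K0_ind (P := fun u => F u = 0)).
  - split=> [|a u v Fu Fv]; first exact: lin0 lF.
    by rewrite lF Fu Fv scaler0 addr0.
  - move=> x y b; have E x' y' : F (tX x' (tX y' b)) = Z x' (Z y' (F b)).
      by rewrite FX FX.
    by rewrite (lin_sum2 lF (E x y) (E y x)) ZZ.
  - by move=> x u Fu; rewrite FX Fu (lin0 (lZ x)).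
exists (fun b => F (vrepr b)); split=> [||x b]; first exact: quot_lin.
  by apply: etrans (quot_E 1 lF FK) F1.
have [u ->] := N_pi b; rewrite nichX_pi (quot_E _ lF FK) (quot_E _ lF FK).
exact: FX.
Qed.

Let k_act g v : K0 v -> pi (tact g v) = 0.
Proof. by move=> Kv; apply: pi_K0; apply: K0_tact. Qed.
Let l_act g : lin (fun u => pi (tact g u)).
Proof. exact: lin_comp (tact_lin g) lpi. Qed.
Let k_comp g v : K0 v -> pi (tcomp g v) = 0.
Proof. by move=> Kv; apply: pi_K0; apply: (K0_tcomp hV MI_neg). Qed.
Let l_comp g : lin (fun u => pi (tcomp g u)).
Proof. exact: lin_comp (tcomp_lin g) lpi. Qed.

Lemma nich_act_pi g u : @bact k G N g (pi u) = pi (tact g u).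
Proof. exact: (quot_E u (l_act g) (k_act g)). Qed.

Lemma nich_comp_pi g u : @bcomp k G N g (pi u) = pi (tcomp g u).
Proof. exact: (quot_E u (l_comp g) (k_comp g)). Qed.

Let lt : lin (tmap pi pi) := tmap_lin lpi lpi.

Let k_comul v : K0 v -> tmap pi pi (tcomul v) = 0.
Proof.
move=> Kv; have := tcomul_K0 hV MI_neg Kv; move: (tcomul v).
apply: (span_lin_ind (P := fun t => tmap pi pi t = 0)).
  split=> [|a s t Hs Ht]; first exact: lin0 lt.
  by rewrite lt Hs Ht scaler0 addr0.
move=> _ [a [b [Kab ->]]]; rewrite (tmapE _ _ lpi lpi).
case: Kab => [Ka|Kb]; first by rewrite (pi_K0 Ka) (lin0 (tens_linl _)).
by rewrite (pi_K0 Kb) (lin0 (tens_linr _)).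
Qed.

Let l_comul : lin (fun u => tmap pi pi (tcomul u)).
Proof. exact: lin_comp (@tcomul_lin k G V) lt. Qed.

Lemma nich_comul_pi u : @bcomul k G N (pi u) = tmap pi pi (tcomul u).
Proof. exact: (quot_E u l_comul k_comul). Qed.

Let leps : lin eps := @tcounit_lin k G V.
Let k_eps v : K0 v -> eps v = 0.
Proof. by move=> Kv; exact: tcounit_K0 Kv. Qed.

Lemma nich_counit_pi u : @bcounit k G N (pi u) = tcounit u.
Proof. exact: (quot_E u leps k_eps). Qed.

Definition tdeg1 (u : TV) : vect := [ffun i : X => tco i u].

Let l_deg1 : lin tdeg1.
Proof. by move=> a u v; apply/ffunP => i; rewrite !ffunE (@tco_lin k G V i). Qed.

Let k_deg1 v : K0 v -> tdeg1 v = 0.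
Proof.
move=> Kv; apply/ffunP => i; rewrite !ffunE.
by have [_ h] := cand_ge2 (antic_candidate hV MI_neg) Kv; apply: h.
Qed.

Lemma nichols1E (b : N) : nichols1 b = tdeg1 (vrepr b).
Proof.
apply/ffunP => i; rewrite !ffunE tcoE; congr (_ @_ _).
by apply/eqP; rewrite fmP fmU.
Qed.

Lemma nichols1_pi u : nichols1 (pi u) = tdeg1 u.
Proof. by rewrite nichols1E; exact: (quot_E u l_deg1 k_deg1). Qed.

(** Every structure map of the Nichols algebra is induced by one of the tensor
   algebra that preserves the ideal of anticommutators. *)
Lemma nichols_exterior : exterior omega I nichX (@nichols1 k G V).
Proof.
split.
- exact: nich_rec.
- exact: nich_ind.
- exact: nich_mul_bilin.
- move=> b; have [u ->] := N_pi b; apply: etrans (nich_mul_pi 1 u) _; congr pi.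
  exact: mul1r.
- exact: nichX_mul.
- exact: nichX_lin.
- move=> x y b; have [u ->] := N_pi b.
  rewrite (nichX_pi y) (nichX_pi x u) (nichX_pi x) (nichX_pi y).
  apply: etrans (esym (linD lpi _ _)) _; apply: pi_K0; exact: K0_antic.
- by move=> g; exact: (quot_lin (l_act g) (k_act g)).
- by move=> g; apply: etrans (nich_act_pi g 1) _; rewrite tact1.
- move=> g x b; have [u ->] := N_pi b; rewrite nichX_pi !nich_act_pi nichX_pi tact_X.
  rewrite -(linZ lpi); congr pi.
  rewrite [ydact _ _](MI_actE omega I) (linZ (@tvect_lin k G V)) tvect_base.
  rewrite -tX_tvar; exact: esym (scalerAl _ _ _).
- by move=> g; exact: (quot_lin (l_comp g) (k_comp g)).
- move=> g; apply: etrans (nich_comp_pi g 1) _; rewrite tcomp1.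
  by case: (g == 1%g) => //; exact: lin0 lpi.
- move=> g x b; have [u ->] := N_pi b; rewrite nichX_pi !nich_comp_pi nichX_pi.
  by rewrite tcomp_X.
- exact: (quot_lin l_comul k_comul).
- by apply: etrans (nich_comul_pi 1) _; rewrite tcomul1 (tmapE _ _ lpi lpi).
- move=> x b; have [u ->] := N_pi b.
  have E : tmap pi pi (tcomul (tX x u)) =
      bprim (nichX x) (@bact k G N (deg x)) (tmap pi pi (tcomul u)).
    rewrite (tcomul_X hV MI_neg); apply: tmap_bprim => //.
    - exact: @tsgn_lin k G V.
    - exact: nichX_lin.
    - exact: (quot_lin (l_act _) (k_act _)).
    - by move=> c; exact: esym (nichX_pi x c).
    - move=> c; apply: esym; apply: etrans (nich_act_pi _ c) _.
      by congr pi; exact: (tact_deg MI_neg).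
  rewrite nichX_pi; apply: etrans (nich_comul_pi _) _; apply: etrans E _.
  by rewrite -(nich_comul_pi u).
- exact: (quot_lin leps k_eps).
- by apply: etrans (nich_counit_pi 1) _; exact: tcounit1.
- by move=> x b; have [u ->] := N_pi b; rewrite nichX_pi nich_counit_pi tcounit_X.
- move=> a b b'; rewrite !nichols1E; exact: (quot_lin l_deg1 k_deg1).
- rewrite [bone N]/(pi 1) nichols1_pi; apply/ffunP => i; rewrite !ffunE.
  exact: tco_1.
- move=> x b; have [u ->] := N_pi b; rewrite nichX_pi nichols1_pi nich_counit_pi.
  apply/ffunP => i; rewrite !ffunE tco_X eq_sym; exact: mulrC.
Qed.

End NicholsMI.

(** * Admissible sequences and forms on M_I *)

Section RootsOfUnity.
Variables (k : fieldType) (n : nat) (omega : k).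
Hypothesis chark : [pchar k] =i pred0.
Hypothesis prim : (n.*2).-primitive_root omega.

Let two_neq0 : 2%:R != 0 :> k.
Proof. by rewrite (proj1 (pcharf0P k) chark). Qed.

Let neg1 : -1 != 1 :> k.
Proof. by rewrite eq_sym -subr_eq0 opprK -[1 + 1]/(2%:R). Qed.

Lemma half_order : omega ^+ n = -1.
Proof.
have n0 : (0 < n)%N by have := prim_order_gt0 prim; rewrite double_gt0.
have : omega ^+ n ^+ 2 == 1 by rewrite -exprM muln2 (prim_expr_order prim).
rewrite sqrf_eq1 => /orP[|/eqP //]; rewrite -(prim_order_dvd prim).
by move=> /(dvdn_leq n0); rewrite -addnn -{3}[n]addn0 leq_add2l leqNgt n0.
Qed.

Lemma expr_neg1 x : omega ^+ x = -1 -> exists2 y, x = (n * y)%N & odd y.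
Proof.
move=> ox; have /dvdnP[y xy] : (n.*2 %| x.*2)%N.
  by rewrite (prim_order_dvd prim) -muln2 exprM ox sqrrN expr1n.
have x_ny : x = (n * y)%N by apply: double_inj; rewrite xy -doubleMr mulnC.
exists y => //; move: ox; rewrite x_ny exprM half_order -signr_odd.
by case: (odd y) => // /esym/eqP; rewrite expr0 (negbTE neg1).
Qed.

(** Completing the square, (a - d e)^2 = d^2 (e^2 - c) when a + b = 2 d e. *)
Lemma dvdn_sum_prod (d a b c : nat) : (d.*2 %| a + b)%N -> (a * b = d ^ 2 * c)%N ->
  (d %| a)%N.
Proof.
move=> /dvdnP[e ab] abc; case: (posnP d) => [d0|d_gt0].
  move: ab abc; rewrite d0 double0 muln0 => /eqP; rewrite addn_eq0 => /andP[/eqP -> _].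
  by rewrite dvdn0.
have E : (a%:Z - (d * e)%N%:Z) ^+ 2 = (d ^ 2)%N%:Z * ((e ^ 2)%N%:Z - c%:Z).
  have bE : b%:Z = (2 * d * e)%N%:Z - a%:Z.
    apply/eqP; rewrite eq_sym subr_eq -PoszD addnC ab.
    by rewrite -mul2n mulnC.
  have abZ : a%:Z * b%:Z = (d ^ 2)%N%:Z * c%:Z by rewrite -!PoszM abc.
  rewrite mulrBr -abZ bE !PoszM.
  by ring.
have : (d ^ 2 %| `|(a%:Z - (d * e)%N%:Z)%R|%N ^ 2)%N.
  by rewrite -abszX E abszM absz_nat dvdn_mulr.
rewrite dvdn_pexp2r // -[(d %| _)%N]/(d%:Z %| a%:Z - (d * e)%N%:Z)%Z.
have de : (d%:Z %| (d * e)%N%:Z)%Z by rewrite PoszM dvdz_mulr.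
by rewrite (rpredBr _ de).
Qed.

(** Writing n for half of the order, n divides a and b, and the cofactor of a is
   odd because it divides the product of two odd numbers. *)
Lemma expr_mixed a b x y : omega ^+ (a + b) = 1 -> omega ^+ x = -1 -> omega ^+ y = -1 ->
  (a * b = x * y)%N -> omega ^+ a = -1.
Proof.
move=> /eqP; rewrite -(prim_order_dvd prim) => dab /expr_neg1[x' -> ox] /expr_neg1[y' -> oy].
rewrite mulnACA mulnn => ab.
have [n0|n_gt0] := posnP n; first by have := prim_order_gt0 prim; rewrite n0.
have /dvdnP[a' aE] := dvdn_sum_prod dab ab.
have dba : (n.*2 %| b + a)%N by rewrite addnC.
have ba : (b * a = n ^ 2 * (x' * y'))%N by rewrite mulnC.
have /dvdnP[b' bE] := dvdn_sum_prod dba ba.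
have oab : (a' * b' = x' * y')%N.
  move: ab; rewrite aE bE mulnACA mulnC mulnn => /eqP.
  by rewrite eqn_pmul2l ?expn_gt0 ?n_gt0 // => /eqP.
have : odd (a' * b') by rewrite oab oddM ox oy.
by rewrite oddM => /andP[oa _]; rewrite aE mulnC exprM half_order -signr_odd oa.
Qed.

End RootsOfUnity.

Section Forms.
Variables (k : fieldType) (m : nat) (omega : k) (r : nat).
Variable (I : r.-tuple (nat * nat)).
Local Notation X := ('I_r * bool)%type.
Local Notation G := (dihedral m).
Local Notation V := (MI m omega I).
Local Notation vect := {ffun X -> k^o}.
Local Notation vb := (vbase (V := V)).
Local Notation va := (vact (V := V)).
Local Notation p := (fst_at I).
Local Notation q := (snd_at I).
Hypothesis (m1 : (1 < m)%N) (om : omega ^+ m = 1).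
Hypothesis qm : forall s, (q s <= m)%N.
Variable alpha : 'I_r -> 'I_r -> bool -> bool -> k.

Definition eta_of (v w : vect) : k^o := MI_form (m := m) (omega := omega) (I := I) alpha v w.

Lemma MI_form_bilin : bilin eta_of.
Proof.
have lE (x : X) : lin (fun v : vect => v x : k^o) by move=> a u v; rewrite !ffunE.
apply: bilinI => [w|v]; rewrite /eta_of /MI_form /MI_dual.
  do 4!(apply: lin_sum => ?); apply: lin_mulr; apply: lin_mull; exact: lE.
by do 4!(apply: lin_sum => ?); apply: lin_mulr; apply: lin_mulr; exact: lE.
Qed.

Lemma MI_form_base x y : eta_of (vb x) (vb y) = alpha x.1 y.1 x.2 y.2.
Proof.
have vbE (z : X) s a : vb z (s, a) = (s == z.1)%:R * (a == z.2)%:R :> k.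
  by case: z => t b; rewrite ffunE xpair_eqE; case: (s == t); case: (a == b);
    rewrite ?mulr1 ?mulr0.
rewrite /eta_of /MI_form /MI_dual (bigD1 x.1) //= [X in _ + X]big1 => [|s /negbTE sx].
  rewrite addr0 (bigD1 y.1) //= [X in _ + X]big1 => [|t /negbTE ty].
    rewrite addr0 (bigD1 x.2) //= [X in _ + X]big1 => [|a /negbTE ax].
      rewrite addr0 (bigD1 y.2) //= [X in _ + X]big1 => [|b /negbTE by_].
        by rewrite addr0 !vbE !eqxx !mulr1.
      by rewrite !vbE by_ !mulr0.
    by apply: big1 => b _; rewrite !vbE ax mulr0 mul0r mulr0.
  by apply: big1 => a _; apply: big1 => b _; rewrite !vbE ty mul0r !mulr0.
apply: big1 => t _; apply: big1 => a _; apply: big1 => b _.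
by rewrite !vbE sx !mul0r mulr0.
Qed.

Hypothesis hal : coef_cond m I alpha.

Lemma alpha_shift c s t a b : alpha s t (c (+) a) (c (+) b) = alpha s t a b.
Proof. by have [h1 h2 _ _] := hal s t; case: c a b => [] [] []. Qed.

(** The conditions on the coefficients make the weights of h cancel wherever the
   coefficient is not zero. *)
Lemma alpha_phase (u : G) (x y : X) :
  dcoef omega I u x * dcoef omega I u y * alpha x.1 y.1 x.2 y.2 = alpha x.1 y.1 x.2 y.2.
Proof.
case: x y => s a [t b]; rewrite /dcoef /=; have [_ _ h3 h4] := hal s t.
have dX c n : dsgn omega c ^+ (m * n) = 1 by rewrite exprM (dsgnX om) expr1n.
case: (a =P b) => [<-|/eqP ab].
  rewrite h3; case: eqP => [e|_]; last by rewrite !mul0r mulr0.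
  by rewrite -exprD -mulnDl e subnK // dX mul1r.
rewrite h4 //; case: eqP => [e|_]; last by rewrite !mul0r mulr0.
have -> : u.2 (+) b = ~~ (u.2 (+) a) by case: (u.2) a b ab => [] [] [].
rewrite dsgnN e exprVn mulfV ?mul1r //.
by rewrite expf_neq0 // (dsgn_neq0 m1 om).
Qed.

(** Checked on basis vectors, where g permutes indices ([alpha_shift]) and h acts by
   weights ([alpha_phase]). *)
Lemma MI_form_inv u v w : eta_of (va u v) (va u w) = eta_of v w.
Proof.
have be := MI_form_bilin; have lv := @vact_lin k m omega r I u.
rewrite [v](vbase_sum m omega I v) [w](vbase_sum m omega I w) !(lin_big _ _ _ lv).
rewrite (lin_big _ _ _ (bilin_l _ be)) [RHS](lin_big _ _ _ (bilin_l _ be)).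
apply: eq_bigr => x _.
rewrite (lin_big _ _ _ (bilin_r _ be)) [RHS](lin_big _ _ _ (bilin_r _ be)).
apply: eq_bigr => y _.
rewrite !(linZ lv) !(bilinZl be) !(bilinZr be) !vact_base !(bilinZl be) !(bilinZr be).
rewrite !MI_form_base /= alpha_shift; congr (_ *: (_ *: _)).
rewrite -[RHS](alpha_phase u x y) /GRing.scale /= mulrA.
by [].
Qed.

End Forms.

(** * The cocycle deformations *)

Section LiftForm.
Variables (k : fieldType) (m : nat) (omega : k) (r : nat).
Variable (I : r.-tuple (nat * nat)).
Local Notation X := ('I_r * bool)%type.
Local Notation G := (dihedral m).
Local Notation V := (MI m omega I).
Local Notation vect := {ffun X -> k^o}.
Local Notation vb := (vbase (V := V)).
Local Notation va := (vact (V := V)).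
Local Notation N := (nichols V).
Local Notation H := (bosonization N).
Local Notation nX := (@nichX k m omega r I).
Local Notation n1 := (@nichols1 k G V : N -> vect).
Local Notation el := (@bosel k m N).
Local Notation ax := (@bosax k m r N nX).
Local Notation D := (@bosD k m r N n1).
Hypothesis xB : exterior omega I nX n1.
Hypothesis (m1 : (1 < m)%N) (om : omega ^+ m = 1).
Variable eta : vect -> vect -> k^o.
Hypothesis be : bilin eta.

(** The lifted form, with values in k as a vector space over itself. *)
Definition lform : H -> H -> k^o := lift_form (V := V) eta.

Let la u : lin (va u) := @vact_lin k m omega r I u.
Let l1 : lin n1 := ba_l1 xB.

Lemma lformE u v :
  lform u v = \sum_g eta (n1 ((u : {ffun G -> N}) g)) (va g (D v)).
Proof.
rewrite /lform /lift_form; apply: eq_bigr => g _.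
by rewrite /bosD (lin_big _ _ _ (la g)) (lin_big _ _ _ (bilin_r _ be)).
Qed.

Lemma lform_form : is_form lform.
Proof.
have E : lform = fun u v => \sum_g eta (n1 ((u : {ffun G -> N}) g)) (va g (D v)).
  by apply/funext => u; apply/funext => v; exact: lformE.
rewrite /is_form E; apply: bilinI => [v|u]; apply: lin_sum => g.
  apply: lin_comp (bilin_l _ be); exact: lin_comp (ffun_lin g) l1.
apply: lin_comp (bilin_r _ be); apply: lin_comp (la g); exact: bosD_lin xB.
Qed.

Lemma lform_word w u a : lform (bword el ax w u) a =
  if w is [:: x] then eta (vb x) (va u (D a)) else 0.
Proof.
rewrite lformE (bos_word m1 om xB) (bigD1 u) //= big1 => [|g /negbTE gu]; last first.
  by rewrite ffunE gu (lin0 l1) (bilin0l be).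
rewrite addr0 ffunE eqxx; case: w => [|x [|y w]] /=.
- by rewrite (ba_11 xB) (bilin0l be).
- by rewrite (ba_1X xB) (ba_e1 xB) scale1r.
- by rewrite (ba_1X xB) (ba_eX xB) scale0r (bilin0l be).
Qed.

End LiftForm.

Section DeformIso.
Variables (k : fieldType) (m : nat) (omega : k) (r : nat).
Variable (I : r.-tuple (nat * nat)).
Local Notation X := ('I_r * bool)%type.
Local Notation G := (dihedral m).
Local Notation V := (MI m omega I).
Local Notation vect := {ffun X -> k^o}.
Local Notation vb := (vbase (V := V)).
Local Notation va := (vact (V := V)).
Hypothesis (m1 : (1 < m)%N) (om : omega ^+ m = 1).
Hypothesis key : forall s t, omega ^+ (fst_at I s * snd_at I t) = -1.
Variables (LamA LamB : X -> X -> k).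
Variables (A : hopf k) (elA : G -> A) (axA : X -> A) (DA : A -> vect).
Variables (B : hopf k) (elB : G -> B) (axB : X -> B) (DB : B -> vect).
Hypothesis dA : dalg omega I LamA elA axA DA.
Hypothesis dB : dalg omega I LamB elB axB DB.
Hypothesis uA : universal omega I LamA elA axA.
Hypothesis uB : universal omega I LamB elB axB.
Variables eta eta' : vect -> vect -> k^o.
Hypothesis be : bilin eta.
Hypothesis einv : forall u v w, eta (va u v) (va u w) = eta v w.
Hypothesis LamE : forall x y,
  LamB x y = LamA x y + (eta (vb x) (vb y) + eta (vb y) (vb x)).
Hypothesis etaN : forall v w, eta' v w = - eta v w.
Variables sg sg' : A -> A -> k^o.
Hypothesis hsg : is_sigma omega I elA axA DA eta sg.
Hypothesis hsg' : is_sigma omega I elA axA DA eta' sg'.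
Hypothesis hB : is_hopf B.

(** The isomorphism of coalgebras of [zop_iso] is multiplicative: for both products
   the elements are generated from 1 by left multiplications, and these correspond
   to operators [Zop] that commute with right multiplications in the deformed
   algebra. *)
Lemma deform_iso : hopf_iso (deform sg) B.
Proof.
have [f [g [[lf fK gK f1] [fel fax fD fe]]]] := zop_iso m1 om key dA dB uA uB be einv LamE.
have bB : is_bialgebra B by case: hB.
have bmB := hmul_bilin bB.
have bd := deform_bilin m1 om key dA be einv etaN hsg hsg'.
have fM a b : f (hmul a b) = deform_mul sg (f a) (f b).
  move: a; apply: (da_ind dB (P := fun a => f (hmul a b) = deform_mul sg (f a) (f b))).
  - split=> [|c x y Hx Hy].
      by rewrite (bilin0l bmB) (lin0 lf) (bilin0l bd).
    by rewrite bmB.1 !lf bd.1 Hx Hy.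
  - rewrite (hmul1 bB) f1; apply: esym.
    exact: (deform_1l m1 om key dA be einv etaN hsg hsg').
  - move=> u a IH; rewrite -(hmulA bB) !fel IH; apply: esym.
    exact: (deform_el m1 om key dA be einv etaN hsg hsg').
  - move=> x a IH; rewrite -(hmulA bB) !fax IH; apply: esym.
    exact: (deform_X m1 om key dA be einv etaN hsg hsg').
have lg := transport_lin lf fK gK.
have lg2 := tmap_lin lg lg.
have gM (x y : deform sg) : g (hmul x y) = hmul (g x) (g y).
  by apply: (can_inj fK); rewrite fM !gK.
have gf1 : g (hone (deform sg)) = hone B.
  by apply: (can_inj fK); rewrite gK f1.
have gD (x : deform sg) : hcomul (g x) = tmap g g (hcomul x).
  rewrite -[x in RHS]gK [hcomul (f (g x))]fD {1}/tmap tlift_tmap //; last by lin.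
  by rewrite -[LHS]tlift_id; apply: eq_tlift => a b; rewrite !fK.
have ge (x : deform sg) : hcounit (g x) = hcounit x.
  by rewrite -[x in RHS]gK [hcounit (f (g x))]fe.
split=> //.
  exact: (transport_hopf (H := deform sg) hB lg gK fK gM gf1 gD ge).
by exists g; split=> //; exists f.
Qed.

End DeformIso.

Section Main.
Variables (k : fieldType) (m : nat) (omega : k) (r : nat).
Variable (I : r.-tuple (nat * nat)).
Local Notation X := ('I_r * bool)%type.
Local Notation G := (dihedral m).
Local Notation V := (MI m omega I).
Local Notation vect := {ffun X -> k^o}.
Local Notation vb := (vbase (V := V)).
Local Notation va := (vact (V := V)).
Local Notation p := (fst_at I).
Local Notation q := (snd_at I).
Local Notation N := (nichols V).
Local Notation H := (bosonization N).
Local Notation el := (@bosel k m N).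
Local Notation ax := (@bosax k m r N (@nichX k m omega r I)).
Local Notation D := (@bosD k m r N (@nichols1 k G V)).
Hypothesis (m1 : (1 < m)%N) (om : omega ^+ m = 1).
Hypothesis key : forall s t, omega ^+ (p s * q t) = -1.
Hypothesis chark : [pchar k] =i pred0.
Hypothesis pm : forall s, (p s <= m)%N.
Hypothesis qm : forall s, (q s <= m)%N.

Let xB := nichols_exterior m1 om key chark.
Local Notation Lam0 := (fun _ _ : X => 0 : k).

Let Lam00 : Lam m I (fun _ _ => 0) (fun _ _ => 0) = Lam0.
Proof.
by apply/funext => x; apply/funext => y; rewrite /Lam; case: (x.2 == y.2); rewrite mulr0.
Qed.

Lemma boson_hopf : is_hopf H.
Proof.
have g0 s t : q s = q t -> 0 = 0 :> k by [].
have dA := AI_dalg m1 om key pm (fun _ _ => 0) (gam := fun _ _ => 0) g0.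
have uA := @AI_universal k m omega r I m1 om (fun _ _ => 0) (fun _ _ => 0) pm g0.
rewrite Lam00 in dA uA.
exact: (bos_hopf m1 om xB dA uA (AI_hopf m1 om key pm (fun _ _ => 0) g0)).
Qed.

Lemma boson_dalg : dalg omega I Lam0 el ax D.
Proof. by have := bos_dalg m1 om xB boson_hopf. Qed.

Lemma boson_universal : universal omega I Lam0 el ax.
Proof.
have g0 s t : q s = q t -> 0 = 0 :> k by [].
have dA := AI_dalg m1 om key pm (fun _ _ => 0) (gam := fun _ _ => 0) g0.
have uA := @AI_universal k m omega r I m1 om (fun _ _ => 0) (fun _ _ => 0) pm g0.
rewrite Lam00 in dA uA.
exact: (bos_universal m1 om xB dA uA).
Qed.

Section Form.
Variable eta : vect -> vect -> k^o.
Hypothesis be : bilin eta.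
Hypothesis einv : forall u v w, eta (va u v) (va u w) = eta v w.
Local Notation sigma := (conv_exp (lform eta) : H -> H -> k^o).
Let neta v w : k^o := - eta v w.

Let bn : bilin neta. Proof. by rewrite /neta; lin. Qed.
Let ninv u v w : neta (va u v) (va u w) = neta v w.
Proof. by rewrite /neta einv. Qed.

Lemma lform_exp (theta : vect -> vect -> k^o) : bilin theta ->
  (forall u v w, theta (va u v) (va u w) = theta v w) ->
  is_sigma omega I el ax D theta (conv_exp (lform theta)).
Proof.
move=> bt ti; apply: (exp_is_sigma m1 om key boson_dalg bt ti chark).
  exact: lform_form xB _ bt.
exact: lform_word xB m1 om _ bt.
Qed.

Let hs := lform_exp be einv.
Let hs' := lform_exp bn ninv.
Let nE v w : neta v w = - eta v w. Proof. by []. Qed.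

Lemma exp_cocycle : cocycle sigma.
Proof. by have := sigma_is_cocycle m1 om key boson_dalg be einv nE hs hs' boson_hopf. Qed.

Variables lam gam : 'I_r -> 'I_r -> k.
Hypothesis gsym : forall s t, q s = q t -> gam s t = gam t s.
Hypothesis LamE : forall x y,
  Lam m I lam gam x y = eta (vb x) (vb y) + eta (vb y) (vb x).
Local Notation A := (AI m omega I lam gam).

Lemma AI_deform_iso : hopf_iso (deform sigma) A.
Proof.
have hA : is_hopf A := AI_hopf m1 om key pm lam gsym.
have dA := AI_dalg m1 om key pm lam gsym.
have uA := AI_universal m1 om (lam := lam) pm gsym.
have LE x y : Lam m I lam gam x y = 0 + (eta (vb x) (vb y) + eta (vb y) (vb x)).
  by rewrite LamE add0r.
by have := deform_iso m1 om key boson_dalg dA boson_universal uA be einv LE nE hs hs' hA.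
Qed.

End Form.
End Main.

Section Coefficients.
Variables (k : fieldType) (m : nat) (omega : k) (r : nat).
Variable (I : r.-tuple (nat * nat)).
Local Notation X := ('I_r * bool)%type.
Local Notation V := (MI m omega I).
Local Notation vb := (vbase (V := V)).
Local Notation q := (snd_at I).
Local Notation eta_of := (@eta_of k m omega r I).
Hypothesis qm : forall s, (q s <= m)%N.

Lemma sub_eqC s t : (q s == m - q t)%N = (q t == m - q s)%N.
Proof. by have := qm s; have := qm t; lia. Qed.

(** The conditions on the coefficients imply the Kronecker factors in the relations
   of A_I. *)
Lemma Lam_form alpha lam gam : coef_cond m I alpha ->
  (forall s t a, lam s t = alpha s t a a + alpha t s a a) ->
  (forall s t a b, a != b -> gam s t = alpha s t a b + alpha t s a b) ->
  forall x y, Lam m I lam gam x y =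
    eta_of alpha (vb x) (vb y) + eta_of alpha (vb y) (vb x).
Proof.
move=> hal hlam hgam [s a] [t b]; rewrite !MI_form_base /Lam /=.
have [h1 _ h3 h4] := hal s t; have [h1' _ h3' h4'] := hal t s.
case: (a =P b) => [<-|/eqP ab].
  by rewrite (hlam s t a) mulrDr -h3 sub_eqC -h3'.
by rewrite (hgam s t a b ab) mulrDr -h4 // eq_sym [alpha t s b a]h1' -h4'.
Qed.

(** A choice of coefficients whose symmetrization is a given lifting datum. *)
Definition half_coef (lam gam : 'I_r -> 'I_r -> k) s t (a b : bool) : k :=
  2%:R^-1 * (if a == b then (q s == m - q t)%N%:R * lam s t else (q s == q t)%:R * gam s t).

Lemma half_coef_cond lam gam : coef_cond m I (half_coef lam gam).
Proof.
have idem (c : bool) z : 2%:R^-1 * (c%:R * z) = c%:R * (2%:R^-1 * (c%:R * z)) :> k.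
  by case: c; rewrite ?mul1r ?mul0r ?mulr0.
move=> s t; split=> [a b||a|a b /negbTE ab]; rewrite /half_coef.
- by rewrite eq_sym.
- by [].
- by rewrite eqxx -idem.
- by rewrite ab -idem.
Qed.

Lemma Lam_half_coef lam gam : 2%:R != 0 :> k -> lifting_datum m I lam gam ->
  forall x y, Lam m I lam gam x y =
    eta_of (half_coef lam gam) (vb x) (vb y) + eta_of (half_coef lam gam) (vb y) (vb x).
Proof.
move=> k2 [ls gs _] [s a] [t b]; rewrite !MI_form_base /Lam /half_coef /=.
have half (z : k) : z = 2%:R^-1 * z + 2%:R^-1 * z.
  by rewrite -mulrDr -mulr2n -[z *+ 2]mulr_natl mulKf.
rewrite [b == a]eq_sym; case: (a == b).
  rewrite -(sub_eqC s t).
  by case: eqP => [e|_]; [rewrite -(ls s t e) -half|rewrite !mul0r mulr0 addr0].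
rewrite (eq_sym (q t) (q s)).
by case: eqP => [e|_]; [rewrite -(gs s t e) -half|rewrite !mul0r mulr0 addr0].
Qed.

End Coefficients.

Theorem theorem3p11 (k : closedFieldType) (chark : [pchar k] =i pred0)
  (m : nat) (m_mod4 : (4 %| m)%N) (m_ge12 : (12 <= m)%N)
  (omega : k) (omega_prim : m.-primitive_root omega)
  (r : nat) (I : r.-tuple (nat * nat)) (I_adm : admissible m omega I) :
  let H := bosonization (nichols (MI m omega I)) in
  (forall (alpha : 'I_r -> 'I_r -> bool -> bool -> k),
     coef_cond m I alpha ->
     let sigma : H -> H -> k := conv_exp (lift_form (MI_form alpha)) in
     cocycle sigma /\
     forall lam gam : 'I_r -> 'I_r -> k,
       (forall s t a, lam s t = alpha s t a a + alpha t s a a) ->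
       (forall s t a b, a != b ->
          gam s t = alpha s t a b + alpha t s a b) ->
       hopf_iso (deform sigma) (AI m omega I lam gam)) /\
  (forall lam gam : 'I_r -> 'I_r -> k,
     lifting_datum m I lam gam ->
     cocycle_deformation H (AI m omega I lam gam)).
Proof.
have [hJ hJ2] := I_adm.
have mE : m = (m./2).*2.
  have m_even : ~~ odd m by rewrite -dvdn2; exact: dvdn_trans m_mod4.
  by rewrite -[LHS]odd_double_half (negbTE m_even).
have m1 : (1 < m)%N by exact: leq_trans m_ge12.
have om : omega ^+ m = 1 := prim_expr_order omega_prim.
have prim2 : ((m./2).*2).-primitive_root omega by rewrite -mE.
have pm s : (fst_at I s <= m)%N.
  have [/andP[_ /ltnW le] _ _] := hJ s; apply: leq_trans le _.
  by rewrite [leqRHS]mE -addnn leq_addr.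
have qm s : (snd_at I s <= m)%N by have [_ /andP[_ /ltnW]] := hJ s.
have key s t : omega ^+ (fst_at I s * snd_at I t) = -1.
  have [_ _ os] := hJ s; have [_ _ ot] := hJ t.
  apply: (expr_mixed chark prim2 (hJ2 s t) os ot).
  by rewrite /fst_at /snd_at; lia.
have k2 : 2%:R != 0 :> k by rewrite (proj1 (pcharf0P k) chark).
have be := @MI_form_bilin k m omega r I.
split=> [alpha hal sigma|lam gam hd].
  have einv := MI_form_inv m1 om qm hal.
  split; first by have := exp_cocycle m1 om key chark pm (be alpha) einv.
  move=> lam gam hlam hgam.
  have gsym s t : snd_at I s = snd_at I t -> gam s t = gam t s.
    by rewrite (hgam s t false true) // (hgam t s false true) // addrC.
  by have := AI_deform_iso m1 om key chark pm (be alpha) einv gsym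
    (Lam_form omega qm hal hlam hgam).
have hal := half_coef_cond m I lam gam.
have einv := MI_form_inv m1 om qm hal.
have [_ gsym _] := hd.
exists (conv_exp (lift_form (MI_form (half_coef m I lam gam)))); split.
  by have := exp_cocycle m1 om key chark pm (be _) einv.
by have := AI_deform_iso m1 om key chark pm (be _) einv gsym (Lam_half_coef omega qm k2 hd).
Qed.
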